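(* We have \begin{align*} &\sum_{i,j,k\geq 0} \frac{q^{3i^2+4j^2+4k^2-4ij-4ik+2i-4j}}{(q^8;q^8)_i(q^8;q^8)_j(q^8;q^8)_k} =2\frac{J_{2,8}J_{10}^2J_{2,20}}{J_2J_{20}J_{1,10}J_{4,20}}, \\ &\sum_{i,j,k\geq 0} \frac{q^{3i^2+4j^2+4k^2-4ij-4ik}}{(q^8;q^8)_i(q^8;q^8)_j(q^8;q^8)_k} \\ &\quad=\frac{J_{80}^{11}J_{8,80}J_{24,80}^2J_{40,80}^2}{J_{4,80}^3J_{12,80}^2J_{20,80}^4J_{28,80}^2J_{32,80}^2J_{36,80}^3} +4q^3\frac{J_{80}^{11}}{J_{8,80}^4J_{16,80}J_{24,80}^3J_{32,80}J_{40,80}^2}, \\ &\sum_{i,j,k\geq 0} \frac{q^{3i^2+4j^2+4k^2-4ij-4ik+4i-4j}}{(q^8;q^8)_i(q^8;q^8)_j(q^8;q^8)_k} =2\frac{J_{40}^{11/2}J_{6,40}J_{10,40}J_{14,40}}{J_{3,40}J_{4,40}J_{7,40}J_{8,40}J_{12,40}^2J_{13,40}J_{17,40}J_{20,40}^{1/2}}, \\ &\sum_{i,j,k\geq 0} \frac{q^{3i^2+4j^2+4k^2-4ij-4ik+2i-4j+4k}}{(q^8;q^8)_i(q^8;q^8)_j(q^8;q^8)_k} \\ &\quad=2\frac{J_{80}^{11}}{J_{8,80}^4J_{16,80}J_{24,80}^4J_{32,80}J_{40,80}} +q\frac{J_{80}^{11}J_{8,80}^2J_{24,80}^2J_{40,80}}{J_{4,80}^3J_{12,80}^3J_{16,80}J_{20,80}^2J_{28,80}^3J_{32,80}J_{36,80}^3},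 \\ &\sum_{i,j,k\geq 0} \frac{q^{3i^2+4j^2+4k^2-4ij-4ik+4i}}{(q^8;q^8)_i(q^8;q^8)_j(q^8;q^8)_k} \\ &\quad=\frac{J_{8,80}^2J_{80}^{11}J_{24,80}J_{40,80}^2}{J_{4,80}^2J_{12,80}^3J_{16,80}^2J_{20,80}^4J_{28,80}^3J_{36,80}^2} +4q^7\frac{J_{80}^{11}}{J_{8,80}^3J_{16,80}J_{24,80}^4J_{32,80}J_{40,80}^2}. \end{align*}
   Context: Throughout $|q|<1$. Notation: $(a;q)_n=\prod_{k=0}^{n-1}(1-aq^k)$, $(a;q)_\infty=\prod_{k\ge0}(1-aq^k)$, $(a_1,\dots,a_r;q)_\infty=\prod_s(a_s;q)_\infty$; $J_m:=(q^m;q^m)_\infty$ and $J_{a,m}:=(q^a,q^{m-a},q^m;q^m)_\infty$. Half-integer powers denote the branch that is a power series in $q$ with constant term $1$. *)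

(* Defs.v *)
From HB Require Import structures.
From mathcomp Require Import all_boot all_order all_algebra finmap.
From mathcomp Require Import complex.
From mathcomp Require Import all_classical all_reals all_analysis.
From mathcomp Require Import summability.

Set Implicit Arguments.
Unset Strict Implicit.
Unset Printing Implicit Defensive.

Import Order.TTheory GRing.Theory Num.Theory.
Import numFieldNormedType.Exports.
Local Open Scope classical_set_scope.
Local Open Scope ring_scope.

(* Naming the target structure gives [R[i]] its norm topology, which is not
   inferred from [R[i]] directly. *)
Definition Cplx (R : realType) : numClosedFieldType := R[i].

Section QSeries.
Variable R : realType.
Local Notation C := (Cplx R).
Implicit Types (a q s : C) (n m : nat) (F g : C -> C).

Definition qpoch a q n : C := \prod_(k < n) (1 - a * q ^+ k).

Definition qpoch_inf a q : C := lim (qpoch a q n @[n --> \oo]).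

Definition qpochs_inf (s : seq C) q : C := \prod_(a <- s) qpoch_inf a q.

Definition J m q : C := qpoch_inf (q ^+ m) (q ^+ m).

(* [m - r] is truncated subtraction: only used with [0 < r < m]. *)
Definition J2 r m q : C :=
  qpochs_inf [:: q ^+ r; q ^+ (m - r); q ^+ m] (q ^+ m).

(* [g] is the branch of F^(n/2) on the open unit disc given by a power series
   with constant term 1. *)
Definition is_half_power F n g : Prop :=
  (forall q, `|q| < 1 -> g q ^+ 2 = F q ^+ n) /\
  exists c : nat -> C, c 0%N = 1 /\
    forall q, `|q| < 1 -> series (fun k => c k * q ^+ k) @ \oo --> g q.

(* Such a [g] is unique on the open unit disc; its values elsewhere are
   irrelevant. *)
Definition half_power F n : C -> C :=
  xget (fun=> 0) [set g | is_half_power F n g].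

(* Unconditional (equivalently, absolute) convergence of the family [f] to [s],
   along the filter of finite subsets of the index type. *)
Definition has_sum (I : choiceType) (f : I -> C) s : Prop :=
  partial_sum f @ totally --> s.

Definition expo (b c d : int) (i j k : nat) : int :=
  3 * i%:Z ^+ 2 + 4 * j%:Z ^+ 2 + 4 * k%:Z ^+ 2
  - 4 * i%:Z * j%:Z - 4 * i%:Z * k%:Z + b * i%:Z + c * j%:Z + d * k%:Z.

(* The exponent is an integer, and [q ^ e] is the integer power. For the five
   linear forms of the theorem it is never negative, so [q = 0] is harmless. *)
Definition summand q (b c d : int) (t : nat * nat * nat) : C :=
  let: (i, j, k) := t in
  q ^ expo b c d i j k /
  (qpoch (q ^+ 8) (q ^+ 8) i * qpoch (q ^+ 8) (q ^+ 8) j *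
   qpoch (q ^+ 8) (q ^+ 8) k).

End QSeries.

(* Main.v *)
(** Euler's identity sums over j and k, so each triple sum becomes a single sum
  over i of [q^(3i^2+bi) / (q^8;q^8)_i] times two shifted products; for the
  second, fourth and fifth identities the sum over i is then split by parity.
  The resulting single sums, of Rogers-Ramanujan type, are evaluated by the
  Bailey lemma (one parameter finite, the other sent to infinity) from finite
  pairs such as
    [sum_r (-1)^r s^(r(3r+1)/2) [2n; n-r]_(s^2) = (s;s^2)_n] and
    [sum_k (-1)^k t^(3k^2+k) [2n; n-2k]_t = (-t;t)_n],
  which follow from the q-Pascal rules. Letting n tend to infinity (Tannery)
  leaves a theta series, hence a product by the Jacobi triple product, and two
  products agree once the exponents of the factors [(q^n;q^m)_oo] do. The
  branches of the half-integer powers are products of the power series of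
  [(1-q^m)^(1/2)], unique because of their constant term. *)

Require Import Defs.
From mathcomp Require Import all_boot all_order all_algebra.
From mathcomp Require Import all_classical all_reals all_analysis.
From mathcomp Require Import finmap complex summability ring lra zify.

Set Implicit Arguments.
Unset Strict Implicit.
Unset Printing Implicit Defensive.

Import Order.TTheory GRing.Theory Num.Theory.
Import numFieldNormedType.Exports.
Local Open Scope classical_set_scope.
Local Open Scope ring_scope.

(** * Gaussian binomial sums and finite Bailey pairs *)

(** Euler's identity replaces the sums over j and k by (-q^(4-4i+c);q^8)_oo (-q^(4-4i+d);q^8)_oo.
    For (c, d) = (-4, 0) the exponents differ by 4, so the two products merge into one of base q^4
    whose exponent -4i is a multiple of 4 for every i. In the other three cases the exponents agree
    modulo 8, with a residue that depends on the parity of i; this forces the split. The pentagonal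
    pair is also needed at the negative argument -q^4, to produce numerators (-q^4;q^8)_m. Its theta
    series then has base -q^20, and separating even from odd factors of that base brings in the
    modulus 40. Half-integer powers occur only in the quotient of J_40^(11/2) by J_{20,40}^(1/2),
    where they cancel to J_40^5 / (q^20;q^40)_oo once the branches are identified. Since q is
    complex, every interchange of limits rests on a geometric majorant. The case q = 0 is separate
    because the reductions use negative powers of q. *)

Section GaussianSums.
Variables (F : numFieldType) (t : F).
Hypothesis ht : forall n, 1 - t ^+ n.+1 != 0.

Definition poch (a q : F) n := \prod_(k < n) (1 - a * q ^+ k).

Lemma poch0 a q : poch a q 0 = 1. Proof. exact: big_ord0. Qed.

Lemma pochS a q n : poch a q n.+1 = poch a q n * (1 - a * q ^+ n).
Proof. exact: big_ord_recr. Qed.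

Lemma pochD a q m n : poch a q (m + n) = poch a q m * poch (a * q ^+ m) q n.
Proof.
by rewrite /poch big_split_ord; congr (_ * _); apply: eq_bigr => k _; rewrite /= exprD mulrA.
Qed.

Lemma pochSl a q n : poch a q n.+1 = (1 - a) * poch (a * q) q n.
Proof. by rewrite -add1n pochD pochS poch0 mul1r expr0 mulr1 expr1. Qed.

Lemma poch_sqr a q n : poch a q n * poch (- a) q n = poch (a ^+ 2) (q ^+ 2) n.
Proof.
elim: n => [|n IH]; first by rewrite !poch0 mulr1.
by rewrite !pochS -IH exprAC; ring.
Qed.

Lemma poch_double a q n :
  poch a q n.*2 = poch a (q ^+ 2) n * poch (a * q) (q ^+ 2) n.
Proof.
elim: n => [|n IH]; first by rewrite !poch0 mulr1.
by rewrite doubleS !pochS IH (exprS q n.*2) -mul2n exprM; ring.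
Qed.

Local Notation qq := (poch t t).

Lemma qqS n : qq n.+1 = qq n * (1 - t ^+ n.+1).
Proof. by rewrite pochS exprS. Qed.

Lemma qq_neq0 n : qq n != 0.
Proof. by elim: n => [|n IH]; rewrite ?poch0 ?oner_eq0 // qqS mulf_neq0. Qed.

Definition qb m j := if (j <= m)%N then qq m / (qq j * qq (m - j)) else 0.

Lemma qb0 m : qb m 0 = 1.
Proof. by rewrite /qb leq0n subn0 poch0 mul1r divff ?qq_neq0. Qed.

Lemma qb_small m j : (m < j)%N -> qb m j = 0.
Proof. by rewrite ltnNge /qb => /negbTE->. Qed.

Lemma qb_sym m j : (j <= m)%N -> qb m (m - j) = qb m j.
Proof. by move=> h; rewrite /qb h leq_subr subKn // (mulrC (poch t t j)). Qed.

Lemma qbS1 m j : (j <= m)%N ->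
  qb m.+1 j.+1 = qb m j.+1 + t ^+ (m - j) * qb m j.
Proof.
move=> h; rewrite {1 3}/qb ltnS h subSS.
have nz := qq_neq0; have ntj := ht j.
case: (ltnP j m) => hjm.
  have e : (m - j = (m - j.+1).+1)%N by lia.
  rewrite /qb hjm e !qqS.
  have nt2 := ht (m - j.+1).
  have -> : t ^+ m.+1 = t ^+ (m - j.+1).+1 * t ^+ j.+1
    by rewrite -exprD; congr (_ ^+ _); lia.
  by field; rewrite !nz ntj nt2.
have -> : j = m by lia.
rewrite qb_small // subnn expr0 poch0 qqS.
by have ntm := ht m; field; rewrite !nz ntm.
Qed.

Lemma qbS2 m j : (j <= m)%N ->
  qb m.+1 j.+1 = qb m j + t ^+ j.+1 * qb m j.+1.
Proof.
move=> h; rewrite {1 2}/qb ltnS h subSS.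
have nz := qq_neq0; have ntj := ht j.
case: (ltnP j m) => hjm.
  have e : (m - j = (m - j.+1).+1)%N by lia.
  rewrite /qb hjm e !qqS.
  have nt2 := ht (m - j.+1).
  have -> : t ^+ m.+1 = t ^+ (m - j.+1).+1 * t ^+ j.+1
    by rewrite -exprD; congr (_ ^+ _); lia.
  by field; rewrite !nz ntj nt2.
have -> : j = m by lia.
rewrite qb_small // subnn poch0 qqS.
by have ntm := ht m; field; rewrite !nz ntm.
Qed.

Definition qbsum m (w : nat -> F) := \sum_(j < m.+1) w j * qb m j.

Lemma eq_qbsum m w w' : (forall j, (j <= m)%N -> w j = w' j) ->
  qbsum m w = qbsum m w'.
Proof. by move=> e; apply: eq_bigr => j _; rewrite e // leq_ord. Qed.

Lemma qbsumZ m c w : qbsum m (fun j => c * w j) = c * qbsum m w.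
Proof. by rewrite /qbsum mulr_sumr; apply: eq_bigr => j _; rewrite mulrA. Qed.

Lemma qbsum_sym m w : qbsum m w = qbsum m (fun j => w (m - j)%N).
Proof.
rewrite /qbsum (reindex_inj rev_ord_inj); apply: eq_bigr => j _ /=.
by have hj : (j <= m)%N := ltn_ord j; rewrite subSS qb_sym.
Qed.

Lemma qbsum_anti m w : (forall j, (j <= m)%N -> w (m - j)%N = - w j) ->
  qbsum m w = 0.
Proof.
move=> h; have : qbsum m w = - qbsum m w.
  rewrite {1}qbsum_sym (eq_qbsum h) -mulN1r -qbsumZ.
  by apply: eq_qbsum => j _; rewrite mulN1r.
by move/eqP; rewrite -addr_eq0 -mulr2n mulrn_eq0 => /eqP.
Qed.

Lemma qbsumS1 m w :
  qbsum m.+1 w = qbsum m w + qbsum m (fun j => w j.+1 * t ^+ (m - j)).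
Proof.
have -> : qbsum m w = \sum_(j < m.+2) w j * qb m j.
  by rewrite [RHS]big_ord_recr /= qb_small // mulr0 addr0.
rewrite /qbsum big_ord_recl [in RHS]big_ord_recl !qb0 -addrA; congr (_ + _).
rewrite -big_split /=; apply: eq_bigr => j _.
have hj : (j <= m)%N := ltn_ord j.
by rewrite /bump leq0n add1n (qbS1 hj) mulrDr mulrA.
Qed.

Lemma qbsumS2 m w :
  qbsum m.+1 w = qbsum m (fun j => w j.+1) + qbsum m (fun j => w j * t ^+ j).
Proof.
have -> : qbsum m (fun j => w j * t ^+ j) = \sum_(j < m.+2) w j * t ^+ j * qb m j.
  by rewrite [RHS]big_ord_recr /= qb_small // mulr0 addr0.
rewrite /qbsum big_ord_recl [X in _ = _ + X]big_ord_recl !qb0 addrCA expr0 !mulr1.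
congr (_ + _); rewrite -big_split /=; apply: eq_bigr => j _.
have hj : (j <= m)%N := ltn_ord j.
by rewrite /bump leq0n add1n (qbS2 hj) mulrDr mulrA.
Qed.

(** The summand of the q-Chu-Vandermonde sum with a = -c/Y, cleared of denominators: the product
    over k is Y^m t^C(m,2) (-c/Y;t)_m, written without dividing by Y. *)
Definition gauss_term Y c M m :=
  qb M m * (\prod_(k < m) (Y * t ^+ k + c * t ^+ (2 * k)))
  * poch (c * t ^+ m) t (M - m).

(* WZ certificate of the recurrence in [M] satisfied by the sum of [gauss_term]. *)
Let gauss_cert Y c M m := if m is j.+1 then
  - (t ^+ (M - j) * qb M j * (\prod_(k < m) (Y * t ^+ k + c * t ^+ (2 * k)))
  * poch (c * t ^+ j) t (M - j)) else 0.

Lemma gauss_telescope Y c M m : (m <= M.+1)%N ->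
  gauss_term Y c M.+1 m - (1 + Y * t ^+ M) * gauss_term Y c M m
  = gauss_cert Y c M m.+1 - gauss_cert Y c M m.
Proof.
case: m => [_|j hj].
  rewrite /gauss_term /gauss_cert !qb0 !subn0 !big_ord0 big_ord_recr big_ord0 /=.
  by rewrite pochS !expr0 !mulr1; ring.
rewrite ltnS in hj; rewrite /gauss_term /gauss_cert subSS.
have nz := qq_neq0; have ntj := ht j.
rewrite [\prod_(k < j.+2) _]big_ord_recr /=.
set A := \prod_(k < j.+1) _.
case: (ltnP j M) => hjM; last first.
  have -> : j = M by lia.
  rewrite (@qb_small M M.+1) // qbS1 // (@qb_small M M.+1) // !subnn !expr0 !poch0.
  by ring.
have [d ->] : exists d, M = (d + j.+1)%N by exists (M - j.+1)%N; lia.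
have e1 : (d + j.+1 - j = d.+1)%N by lia.
have e2 : (d + j.+1 - j.+1 = d)%N by lia.
have ntd := ht d.
have -> : qb (d + j.+1) j.+1 = qb (d + j.+1) j * (1 - t ^+ d.+1) / (1 - t ^+ j.+1).
  rewrite /qb leq_addl (_ : (j <= d + j.+1)%N); last lia.
  by rewrite e1 e2 !qqS; field; rewrite !nz ntj ntd.
rewrite (_ : qb (d + j.+1).+1 j.+1 = qb (d + j.+1) j * (1 - t ^+ (d + j.+2)) / (1 - t ^+ j.+1)); last first.
  rewrite /qb ltnS (_ : (j <= d + j.+1)%N); last lia.
  rewrite subSS e1 !addnS !qqS.
  by field; rewrite !nz ntj ntd.
rewrite e1 e2 pochS pochSl -!mulrA -!exprSr !mulrA.
set B := poch (c * t ^+ j.+1) t d; set q0 := qb _ j.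
rewrite (_ : t ^+ (2 * j.+1) = t ^+ j.+1 * t ^+ j.+1); last by rewrite -exprD addnn mul2n.
rewrite !exprD ![t ^+ _.+1]exprS.
rewrite exprS in ntj.
by field.
Qed.

(** The parameter [c] drops out of the value, so it can be chosen freely: c = 0 gives the q-binomial
    theorem, c = t^(2r+e+1) the inner sum of the Bailey lemma. *)
Lemma gauss_sum Y c M : \sum_(m < M.+1) gauss_term Y c M m = poch (- Y) t M.
Proof.
elim: M => [|M IH].
  by rewrite big_ord1 /gauss_term qb0 big_ord0 !poch0 !mulr1.
rewrite pochS mulNr opprK -IH.
have -> : \sum_(m < M.+1) gauss_term Y c M m = \sum_(m < M.+2) gauss_term Y c M m.
  by rewrite [RHS]big_ord_recr /= [X in _ + X]/gauss_term qb_small // !mul0r addr0.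
apply/eqP; rewrite -subr_eq0 mulrC mulr_sumr -sumrB.
rewrite (eq_bigr (fun m : 'I_M.+2 => gauss_cert Y c M m.+1 - gauss_cert Y c M m)).
  rewrite -(big_mkord xpredT (fun m => gauss_cert Y c M m.+1 - gauss_cert Y c M m)).
  by rewrite telescope_sumr //= qb_small // mulr0 !mul0r !oppr0 addr0.
by move=> m _; have hm : (m <= M.+1)%N := ltn_ord m; rewrite gauss_telescope.
Qed.

Lemma q_binomial Y M :
  \sum_(m < M.+1) qb M m * t ^+ 'C(m, 2) * Y ^+ m = poch (- Y) t M.
Proof.
rewrite -(gauss_sum Y 0); apply: eq_bigr => m _.
rewrite /gauss_term mul0r.
have -> n : poch 0 t n = 1.
  by elim: n => [|n IH]; rewrite ?poch0 // pochS IH mul0r subr0 mulr1.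
rewrite mulr1 -mulrA; congr (_ * _).
elim: (m : nat) => [|k IH]; first by rewrite big_ord0 mulr1.
by rewrite big_ord_recr /= -IH mul0r addr0 binS bin1 exprD exprS; ring.
Qed.

(* Bailey's weight (rho1)_n (rho2)_n (a t / (rho1 rho2))^n for a = t^e, rho1 = - b
   and rho2 -> oo, where [y] stands for a t / b. *)
Definition bailey_weight b y n := poch (- b) t n * y ^+ n * t ^+ 'C(n, 2).

(** After the shift k = m + r, the ratio of the weights at k and r is the product in [gauss_term]
    for Y = y t^r and c = t^(2r+e+1), because b y = t^(e+1). *)
Lemma bailey_inner e b y r N : b * y = t ^+ e.+1 -> (r <= N)%N ->
  \sum_(r <= k < N.+1)
     bailey_weight b y k / (qq (N - k) * (qq (k - r) * qq (k + r + e)))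
  = bailey_weight b y r * poch (- (y * t ^+ r)) t (N - r)
    / (qq (N - r) * qq (N + r + e)).
Proof.
move=> hby hr; have nz := qq_neq0.
have [M ->] : exists M, N = (M + r)%N by exists (N - r)%N; lia.
rewrite -{1}[r]add0n big_addn -addSn addnK big_mkord.
rewrite -(gauss_sum _ (t ^+ (r + r + e).+1)) addnK -mulrA [X in _ * X]mulr_suml mulr_sumr.
apply: eq_bigr => m _; have hm : (m <= M)%N := ltn_ord m.
rewrite subnDr addnK /gauss_term /qb hm.
have -> : qq (M + r + r + e) = qq (m + r + r + e)
    * poch (t ^+ (r + r + e).+1 * t ^+ m) t (M - m).
  rewrite (_ : (M + r + r + e = m + r + r + e + (M - m))%N); last lia.
  by rewrite pochD; congr (_ * poch _ _ _); rewrite -exprS -exprD; congr (_ ^+ _); lia.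
have -> : bailey_weight b y (m + r) = bailey_weight b y r *
    \prod_(k < m) (y * t ^+ r * t ^+ k + t ^+ (r + r + e).+1 * t ^+ (2 * k)).
  elim: (m : nat) => [|k IH]; first by rewrite big_ord0 mulr1.
  rewrite big_ord_recr /= mulrA -IH addSn.
  have -> : t ^+ (r + r + e).+1 * t ^+ (2 * k) = b * y * t ^+ (k + r) * t ^+ (k + r).
    by rewrite hby -!exprD; congr (_ ^+ _); lia.
  have -> : y * t ^+ r * t ^+ k = y * t ^+ (k + r) by rewrite exprD; ring.
  rewrite /bailey_weight pochS exprS binS bin1 (exprD t 'C(k + r, 2)).
  set T := t ^+ (k + r); ring.
have := nz (m + r + r + e)%N.
have := nz (M + r + r + e)%N.
rewrite (_ : (M + r + r + e = m + r + r + e + (M - m))%N); last lia.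
rewrite pochD (_ : t * t ^+ (m + r + r + e) = t ^+ (r + r + e).+1 * t ^+ m); last first.
  by rewrite -exprS -exprD; congr (_ ^+ _); lia.
rewrite mulf_eq0 negb_or => /andP[n1 n2] _.
by field; rewrite !nz n2.
Qed.

Lemma bailey_lemma e b y (alpha : nat -> F) N : b * y = t ^+ e.+1 ->
  \sum_(k < N.+1) bailey_weight b y k *
     (\sum_(r < k.+1) alpha r / (qq (k - r) * qq (k + r + e))) / qq (N - k)
  = \sum_(r < N.+1) alpha r * bailey_weight b y r *
     poch (- (y * t ^+ r)) t (N - r) / (qq (N - r) * qq (N + r + e)).
Proof.
move=> hby.
transitivity (\sum_(k < N.+1) \sum_(r < N.+1 | (r <= k)%N)
   alpha r * (bailey_weight b y k / (qq (N - k) * (qq (k - r) * qq (k + r + e))))).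
  apply: eq_bigr => k _; rewrite mulr_sumr mulr_suml.
  rewrite (big_ord_widen_cond N.+1 xpredT (fun r => bailey_weight b y k *
     (alpha r / (qq (k - r) * qq (k + r + e))) / qq (N - k))) //.
  apply: eq_big => [r|r _]; first by rewrite ltnS.
  by rewrite !invfM; ring.
rewrite (exchange_big_dep xpredT) //=; apply: eq_bigr => r _.
rewrite -mulr_sumr -2!mulrA; congr (_ * _).
rewrite mulrA -(bailey_inner hby) ?leq_ord //.
by rewrite big_geq_mkord.
Qed.


(** A bilateral weight becomes a one-sided Bailey sequence by joining r with -r (for a = 1) or with
    -r-1 (for a = t). The joined indices share the denominator (t;t)_(n-r) (t;t)_(n+r+e), so a full
    row of Gaussian binomials results. *)
Definition fold0 (w : int -> F) r := if r is 0 then w 0 else w r%:Z + w (- r%:Z).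
Definition fold1 (w : int -> F) r := w r%:Z + w (- r%:Z - 1).

Lemma qbsum_fold0 n w :
  \sum_(r < n.+1) fold0 w r / (qq (n - r) * qq (n + r + 0))
  = qbsum (n + n) (fun j => w (n%:Z - j%:Z)) / qq (n + n).
Proof.
rewrite /qbsum -addSn big_split_ord /= [X in (X + _) / _](reindex_inj rev_ord_inj) /=.
rewrite big_ord_recl [X in (X + _) / _]big_ord_recl -addrA -big_split /=.
rewrite mulrDl mulr_suml; congr (_ + _).
  rewrite !subSS !subn0 !addn0 subrr /qb leq_addr addnK /=.
  by field; rewrite !qq_neq0.
apply: eq_bigr => r _; have hr := ltn_ord r.
rewrite /bump leq0n add1n addn0 subSS.
have -> : n%:Z - (n - r.+1)%N%:Z = r.+1%:Z by lia.
have -> : n%:Z - (n.+1 + r)%N%:Z = - r.+1%:Z by lia.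
rewrite /qb (_ : (n - r.+1 <= n + n)%N); last lia.
rewrite (_ : (n.+1 + r <= n + n)%N); last lia.
rewrite (_ : (n + n - (n - r.+1) = n + r.+1)%N); last lia.
rewrite (_ : (n + n - (n.+1 + r) = n - r.+1)%N); last lia.
by rewrite addSnnS; field; rewrite !qq_neq0.
Qed.

Lemma qbsum_fold1 n w :
  \sum_(r < n.+1) fold1 w r / (qq (n - r) * qq (n + r + 1))
  = qbsum (n + n).+1 (fun j => w (n%:Z - j%:Z)) / qq (n + n).+1.
Proof.
rewrite /qbsum -addnS -addSn big_split_ord /= [X in (X + _) / _](reindex_inj rev_ord_inj) /=.
rewrite -big_split /= mulr_suml.
apply: eq_bigr => r _; have hr := ltn_ord r.
rewrite subSS /fold1.
have -> : n%:Z - (n - r)%N%:Z = r%:Z by lia.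
have -> : n%:Z - (n.+1 + r)%N%:Z = - r%:Z - 1 by lia.
rewrite /qb (_ : (n - r <= n + n.+1)%N); last lia.
rewrite (_ : (n.+1 + r <= n + n.+1)%N); last lia.
rewrite (_ : (n + n.+1 - (n - r) = n + r + 1)%N); last lia.
rewrite (_ : (n + n.+1 - (n.+1 + r) = n - r)%N); last lia.
by rewrite (_ : (n.+1 + r = n + r + 1)%N); [field; rewrite !qq_neq0 | lia].
Qed.

Section SignedPowers.
Variable h : F.
Hypothesis h0 : h != 0.

Definition spow (a b : int) : F := (-1) ^ a * h ^ b.

Lemma spowN a b : - spow a b = spow (a + 1) b.
Proof. by rewrite /spow expfzDr ?oppr_eq0 ?oner_eq0 // expr1z mulrN1 mulNr. Qed.

Lemma spowM a b (k : nat) : spow a b * h ^+ k = spow a (b + k%:Z).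
Proof. by rewrite /spow expfzDr // mulrA. Qed.

(** Only the parity of the exponent of -1 matters. Half of the difference is passed explicitly as
    [c], which leaves two identities of integer arithmetic. *)
Lemma eq_spow (c a b a' b' : int) : a = a' + c + c -> b = b' -> spow a b = spow a' b'.
Proof.
move=> -> ->; rewrite /spow !expfzDr ?oppr_eq0 ?oner_eq0 // -mulrA -expfzMl.
by rewrite mulrNN mulr1 exp1rz mulr1.
Qed.

End SignedPowers.

(* The base is [t = h^4]: with s = h^2 the half-integer exponent r (3 r + 1) / 2 of s
   becomes the integer exponent r (3 r + 1) of [h]. *)
Section PentagonalPairs.
Variable h : F.
Hypotheses (h0 : h != 0) (h4 : h ^+ 4 = t).

Definition pent (r : int) := spow h r (r * (3 * r + 1)).

Lemma pent_tX a b k : spow h a b * t ^+ k = spow h a (b + 4 * k%:Z).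
Proof. by rewrite -h4 -exprM spowM. Qed.

(** The two Pascal rules alternate. From row 2m to 2m+1 the first rule adds the same sum read
    backwards, times -h^2 t^m; from row 2n+1 to 2n+2 the second rule adds a sum that is
    antisymmetric under reversal, hence zero. *)
Lemma qbsum_pent n :
  qbsum (n + n) (fun j => pent (n%:Z - j%:Z)) = poch (h ^+ 2) t n /\
  qbsum (n + n).+1 (fun j => pent (n%:Z - j%:Z)) = poch (h ^+ 2) t n.+1.
Proof.
have odd_step m : qbsum (m + m).+1 (fun j => pent (m%:Z - j%:Z)) =
    qbsum (m + m) (fun j => pent (m%:Z - j%:Z)) * (1 - h ^+ 2 * t ^+ m).
  rewrite qbsumS1 mulrBr mulr1; congr (_ + _).
  rewrite mulrC -mulNr -qbsumZ [RHS]qbsum_sym; apply: eq_qbsum => j hj.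
  rewrite pent_tX [RHS]mulrC mulrN mulrA spowM // pent_tX spowN.
  have -> : (m + m - j)%N%:Z = m%:Z + m%:Z - j%:Z by lia.
  have -> : j.+1%:Z = j%:Z + 1 by lia.
  by apply: (@eq_spow h (m%:Z - j%:Z - 1)); ring.
elim: n => [|n [_ IH]].
  have e : qbsum (0 + 0) (fun j => pent (0 - j%:Z)) = 1.
    by rewrite /qbsum big_ord1 qb0 mulr1 /pent /spow !mulr1.
  by rewrite odd_step e pochS poch0 mul1r.
have -> : (n.+1 + n.+1 = (n + n).+2)%N by lia.
have e : qbsum (n + n).+2 (fun j => pent (n.+1%:Z - j%:Z)) = poch (h ^+ 2) t n.+1.
  rewrite qbsumS2 [X in _ + X]qbsum_anti ?addr0.
    by rewrite -IH; apply: eq_qbsum => j _; congr pent; lia.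
  move=> j hj; rewrite !pent_tX spowN.
  have -> : ((n + n).+1 - j)%N%:Z = n%:Z + n%:Z + 1 - j%:Z by lia.
  have -> : n.+1%:Z = n%:Z + 1 by lia.
  by apply: (@eq_spow h (j%:Z - n%:Z - 1)); ring.
split=> //.
have := odd_step n.+1; rewrite (_ : (n.+1 + n.+1 = (n + n).+2)%N); last lia.
by move=> ->; rewrite e -pochS.
Qed.

(** Reversing row 2n+2 and applying the second Pascal rule gives the reflected sum minus h^2 t^n
    times row 2n+1; the other two terms are known from [qbsum_pent]. *)
Lemma qbsum_pentN n :
  qbsum (n + n).+1 (fun j => pent (j%:Z - n%:Z))
  = (1 + h ^+ 2 * t ^+ n) * poch (h ^+ 2) t n.+1.
Proof.
have [_ eE] := qbsum_pent n.
have [] := qbsum_pent n.+1; rewrite (_ : (n.+1 + n.+1 = (n + n).+2)%N); last lia.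
rewrite qbsum_sym qbsumS2 => eD _.
rewrite (eq_qbsum (w' := fun j => pent (j%:Z - n%:Z))) in eD; last first.
  by move=> j hj; congr pent; lia.
rewrite [X in _ + X](_ : _ = - (h ^+ 2 * t ^+ n) * poch (h ^+ 2) t n.+1) in eD.
  by rewrite mulrDl mul1r -{1}eD mulNr subrK.
rewrite -eE -qbsumZ; apply: eq_qbsum => j hj.
rewrite pent_tX [RHS]mulrC mulrN mulrA spowM // pent_tX spowN.
have -> : ((n + n).+2 - j)%N%:Z = n%:Z + n%:Z + 2 - j%:Z by lia.
have -> : n.+1%:Z = n%:Z + 1 by lia.
by apply: (@eq_spow h (j%:Z - n%:Z - 1)); ring.
Qed.

End PentagonalPairs.

Section EvenPairs.
(** Extending by zero to odd [r] turns a sum over every second Gaussian binomial into a sum over a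
    full row, to which the Pascal rules apply. *)
Definition evenw (r : int) :=
  if (r %% 2)%Z == 0 then
    spow t (r %/ 2)%Z (3 * (r %/ 2)%Z ^+ 2 + (r %/ 2)%Z) else 0.

Lemma evenw_even k : evenw (2 * k) = spow t k (3 * k ^+ 2 + k).
Proof.
rewrite /evenw (_ : (2 * k %% 2)%Z = 0); last lia.
by rewrite eqxx (_ : (2 * k %/ 2)%Z = k); last lia.
Qed.

Lemma evenw_odd k : evenw (2 * k + 1) = 0.
Proof. by rewrite /evenw (_ : ((2 * k + 1) %% 2)%Z = 1); last lia. Qed.

Lemma parity_int (r : int) : exists k, r = 2 * k \/ r = 2 * k + 1.
Proof. by exists (r %/ 2)%Z; lia. Qed.

Hypothesis t0 : t != 0.

Let spow_tX a b k : spow t a b * t ^+ k = spow t a (b + k%:Z).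
Proof. exact: spowM. Qed.

(** The roles are exchanged with respect to [qbsum_pent]: the step to an odd row adds an
    antisymmetric sum, and the step to an even row adds t^(n+1) times the reversed previous row. *)
Lemma qbsum_evenw n :
  qbsum (n + n) (fun j => evenw (n%:Z - j%:Z)) = poch (- t) t n /\
  qbsum (n + n).+1 (fun j => evenw (n%:Z - j%:Z)) = poch (- t) t n.
Proof.
have odd_step m : qbsum (m + m).+1 (fun j => evenw (m%:Z - j%:Z)) =
    qbsum (m + m) (fun j => evenw (m%:Z - j%:Z)).
  rewrite qbsumS1 [X in _ + X]qbsum_anti ?addr0 // => j hj.
  have [k [e|e]] := parity_int (m%:Z - j%:Z).
    have -> : m%:Z - (m + m - j).+1%:Z = 2 * (- k - 1) + 1 by lia.
    have -> : m%:Z - j.+1%:Z = 2 * (k - 1) + 1 by lia.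
    by rewrite !evenw_odd !mul0r oppr0.
  have -> : m%:Z - (m + m - j).+1%:Z = 2 * (- k - 1) by lia.
  have -> : m%:Z - j.+1%:Z = 2 * k by lia.
  rewrite !evenw_even !spow_tX spowN // subKn //.
  have -> : (m + m - j)%N%:Z = m%:Z + 2 * k + 1 by lia.
  have -> : j%:Z = m%:Z - 2 * k - 1 by lia.
  by apply: (@eq_spow t (- k - 1)); ring.
elim: n => [|n [_ IH]].
  rewrite odd_step; have -> : qbsum (0 + 0) (fun j => evenw (0 - j%:Z)) = 1.
    by rewrite /qbsum big_ord1 qb0 mulr1 /evenw /spow /= mulr1.
  by rewrite poch0.
rewrite odd_step (_ : (n.+1 + n.+1 = (n + n).+2)%N); last lia.
suff -> : qbsum (n + n).+2 (fun j => evenw (n.+1%:Z - j%:Z)) = poch (- t) t n.+1 by [].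
rewrite qbsumS2 [X in _ + X]qbsum_sym pochS mulrBr mulr1 mulNr mulrN opprK.
rewrite -{2}IH [in RHS]mulrC -qbsumZ; congr (_ + _).
  by rewrite -IH; apply: eq_qbsum => j _; congr evenw; lia.
apply: eq_qbsum => j hj; rewrite -exprS.
have [k [e|e]] := parity_int (n%:Z - j%:Z).
  have -> : n.+1%:Z - ((n + n).+1 - j)%N%:Z = 2 * - k by lia.
  rewrite e !evenw_even [RHS]mulrC !spow_tX.
  have -> : ((n + n).+1 - j)%N%:Z = n.+1%:Z + 2 * k by lia.
  by apply: (@eq_spow t (- k)); ring.
have -> : n.+1%:Z - ((n + n).+1 - j)%N%:Z = 2 * (- k - 1) + 1 by lia.
by rewrite e !evenw_odd mul0r mulr0.
Qed.

(** The second Pascal rule writes row 2n+1 as the shifted sum plus t^n times row 2n, and both rows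
    equal (-t;t)_n. *)
Lemma qbsum_evenw_shift n :
  qbsum (n + n) (fun j => evenw (n%:Z - j%:Z - 1)) = (1 - t ^+ n) * poch (- t) t n.
Proof.
have [eD eE] := qbsum_evenw n.
move: eE; rewrite qbsumS2 [X in _ + X]qbsum_sym => eE.
rewrite mulrBl mul1r -{1}eE -[in RHS]eD -qbsumZ -addrA.
rewrite (eq_qbsum (w' := fun j => evenw (n%:Z - j%:Z - 1))); last first.
  by move=> j _; congr evenw; lia.
rewrite -[LHS]addr0; congr (_ + _); apply/esym/eqP; rewrite subr_eq0; apply/eqP.
apply: eq_qbsum => j hj.
have [k [e|e]] := parity_int (n%:Z - j%:Z).
  have -> : n%:Z - (n + n - j)%N%:Z = 2 * - k by lia.
  rewrite e !evenw_even [RHS]mulrC !spow_tX.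
  have -> : (n + n - j)%N%:Z = n%:Z + 2 * k by lia.
  by apply: (@eq_spow t (- k)); ring.
have -> : n%:Z - (n + n - j)%N%:Z = 2 * (- k - 1) + 1 by lia.
by rewrite e !evenw_odd mul0r mulr0.
Qed.

End EvenPairs.

Section FiniteTripleProduct.
Variables (a b : F).
Hypothesis hab : a * b = t.

(* As [a * b = t], this is a^(r (r + 1) / 2) b^(r (r - 1) / 2). *)
Definition thetaw (r : int) := match r with
  | Posz n => t ^+ 'C(n, 2) * a ^+ n
  | Negz n => t ^+ 'C(n.+1, 2) * b ^+ n.+1
  end.

(** Finite Jacobi triple product. In the step from row 2n to row 2n+2 the second Pascal rule
    contributes the factor 1 + a t^n and the first one 1 + b t^n. Keeping both [a] and [b], instead
    of z and t/z, avoids inverses. *)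
Lemma qbsum_thetaw n :
  qbsum (n + n) (fun j => thetaw (n%:Z - j%:Z)) = poch (- a) t n * poch (- b) t n.
Proof.
elim: n => [|n IH]; first by rewrite /qbsum big_ord1 qb0 !poch0 !mulr1 /= mulr1.
rewrite (_ : (n.+1 + n.+1 = (n + n).+2)%N); last lia.
rewrite qbsumS2.
rewrite (eq_qbsum (w' := fun j => thetaw (n%:Z - j%:Z))); last first.
  by move=> j _; congr thetaw; lia.
rewrite [X in _ + X](eq_qbsum (w' := fun j => a * t ^+ n * thetaw (n%:Z - j%:Z))).
  rewrite qbsumZ qbsumS1.
  rewrite [qbsum (n + n) (fun j => thetaw _ * _)](eq_qbsum
    (w' := fun j => b * t ^+ n * thetaw (n%:Z - j%:Z))).
    by rewrite qbsumZ IH !pochS; ring.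
  move=> j hj; case: (leqP j.+1 n) => hjn.
    have -> : n%:Z - j.+1%:Z = Posz (n - j.+1) by lia.
    have -> : n%:Z - j%:Z = Posz (n - j.+1).+1 by lia.
    have -> : (n + n - j = n + (n - j.+1).+1)%N by lia.
    rewrite /thetaw binS bin1 !exprD !exprS; set T := t ^+ (n - j.+1).
    by rewrite -[X in _ * (_ * (X * _))]hab; ring.
  have -> : n%:Z - j.+1%:Z = Negz (j - n) by lia.
  have [d dE] : exists d, j = (n + d)%N by exists (j - n)%N; lia.
  subst j.
  rewrite (_ : (n + d - n = d)%N); last lia.
  case: d hj hjn => [|d] hj hjn.
    by rewrite addn0 addnK (_ : n%:Z - n%:Z = 0) ?subrr //= !mulr1 expr1 mul1r.
  have -> : n%:Z - (n + d.+1)%N%:Z = Negz d by lia.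
  have e : (n + n - (n + d.+1) + d.+1 = n)%N by lia.
  by rewrite /thetaw binS bin1 exprD -[in RHS]e exprD (exprS b d.+1); ring.
move=> j hj; case: (leqP j n) => hjn.
  have -> : n.+1%:Z - j%:Z = Posz (n - j).+1 by lia.
  have -> : n%:Z - j%:Z = Posz (n - j) by lia.
  have -> : t ^+ n = t ^+ (n - j) * t ^+ j by rewrite -exprD subnK.
  by rewrite /thetaw binS bin1 exprD (exprS a (n - j)); ring.
have [d ->] : exists d, j = (n.+1 + d)%N by exists (j - n.+1)%N; lia.
have -> : n%:Z - (n.+1 + d)%N%:Z = Negz d by lia.
have -> : n.+1%:Z - (n.+1 + d)%N%:Z = - d%:Z by lia.
have -> : thetaw (- d%:Z) = t ^+ 'C(d, 2) * b ^+ d.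
  by case: d => [|d] //=; rewrite !expr0.
rewrite /thetaw binS bin1 !exprD exprS (exprS b d).
by rewrite -[X in _ * (X * _ * _)]hab; ring.
Qed.

End FiniteTripleProduct.

End GaussianSums.

(** * Limits of complex sequences and infinite products *)

Section ComplexLimits.
Variable R : realType.
Local Notation C := (Cplx R).
Implicit Types (x y z l : C) (u v : nat -> C).

(** The modulus as a real number; [|x|] itself takes its values in [C], where the order is only
    partial. *)
Definition nm x : R := Normc.normc x.
Arguments nm : simpl never.

Lemma normE x : `|x| = (nm x)%:C%C. Proof. by []. Qed.
Lemma nm_ge0 x : 0 <= nm x.
Proof. by case: x => a b; rewrite sqrtr_ge0. Qed.
Lemma nm0 : nm 0 = 0. Proof. exact: Normc.normc0. Qed.
Lemma nm1 : nm 1 = 1. Proof. exact: Normc.normc1. Qed.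
Lemma nmM x y : nm (x * y) = nm x * nm y. Proof. exact: Normc.normcM. Qed.
Lemma nmN x : nm (- x) = nm x. Proof. exact: normcN. Qed.
Lemma nmV x : nm x^-1 = (nm x)^-1. Proof. exact: Normc.normcV. Qed.
Lemma nmD x y : nm (x + y) <= nm x + nm y. Proof. exact: le_normcD. Qed.
Lemma nmB x y : nm (x - y) = nm (y - x). Proof. by rewrite -nmN opprB. Qed.
Lemma nmX x n : nm (x ^+ n) = nm x ^+ n.
Proof. by elim: n => [|n IH]; rewrite ?expr0 ?nm1 // !exprS nmM IH. Qed.
Lemma nm_eq0 x : nm x = 0 -> x = 0. Proof. exact: Normc.eq0_normc. Qed.
Lemma nm_gt0 x : x != 0 -> 0 < nm x.
Proof. by move=> h; rewrite lt_neqAle nm_ge0 andbT eq_sym; apply: contra h => /eqP/nm_eq0->. Qed.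
Lemma nm_sum n u : nm (\sum_(k < n) u k) <= \sum_(k < n) nm (u k).
Proof.
elim: n => [|n IH]; first by rewrite !big_ord0 nm0.
by rewrite !big_ord_recr /= (le_trans (nmD _ _)) // lerD2r.
Qed.
Lemma norm_lt1 x : (`|x| < 1) = (nm x < 1).
Proof. by rewrite normE ltcR. Qed.

(* Wrapping the convergence statement in an inductive type keeps the filter
   inclusion it unfolds to from adding implicit arguments to every lemma. *)
Variant tends u l : Prop := Tends of u @ \oo --> l.

Lemma tends_nm u l :
  tends u l <-> forall e : R, 0 < e -> exists N, forall n, (N <= n)%N -> nm (u n - l) < e.
Proof.
split=> [[/cvgrPdist_lt h] e e0|h].
  have := h e%:C%C; rewrite ltcR => /(_ e0) [N _ hN].
  by exists N => n /hN /=; rewrite normE ltcR nmB.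
constructor; apply/cvgrPdist_lt => e; case: e => e e'; rewrite ltcE /= => /andP[/eqP-> e0].
have [N hN] := h e e0; exists N => // n /= /hN.
by rewrite normE nmB => h2; rewrite ltcE /= eqxx.
Qed.

Lemma tends_uniq u l l' : tends u l -> tends u l' -> l = l'.
Proof.
move=> /tends_nm h /tends_nm h'; apply/eqP; rewrite -subr_eq0; apply/negPn/negP => /nm_gt0 d.
have [N hN] := h _ (divr_gt0 d (ltr0n _ 2)); have [M hM] := h' _ (divr_gt0 d (ltr0n _ 2)).
have := hN _ (leq_maxl N M); have := hM _ (leq_maxr N M).
rewrite (nmB _ l); have := nmD (l - u (maxn N M)) (u (maxn N M) - l').
by rewrite addrA subrK; lra.
Qed.

Lemma tends_cst x : tends (fun=> x) x. Proof. by constructor; apply: cvg_cst. Qed.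
Lemma tendsD u v x y : tends u x -> tends v y -> tends (fun n => u n + v n) (x + y).
Proof. by move=> [h] [h']; constructor; exact: (cvgD h h'). Qed.
Lemma tendsB u v x y : tends u x -> tends v y -> tends (fun n => u n - v n) (x - y).
Proof. by move=> [h] [h']; constructor; exact: (cvgB h h'). Qed.
Lemma tendsM u v x y : tends u x -> tends v y -> tends (fun n => u n * v n) (x * y).
Proof. by move=> [h] [h']; constructor; exact: (cvgM h h'). Qed.
Lemma tendsV u x : x != 0 -> tends u x -> tends (fun n => (u n)^-1) x^-1.
Proof. by move=> hx [h]; constructor; exact: (cvgV hx h). Qed.

Lemma tends_shift u l k : tends u l -> tends (fun n => u (n + k)%N) l.
Proof.
by move=> /tends_nm h; apply/tends_nm => e /h[N hN]; exists N => n hn; apply: hN; lia.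
Qed.

Lemma tends_sub u l (f : nat -> nat) : (forall n, (n <= f n)%N) ->
  tends u l -> tends (fun n => u (f n)) l.
Proof.
move=> hf /tends_nm h; apply/tends_nm => e /h[N hN]; exists N => n hn; apply: hN.
exact: leq_trans hn (hf n).
Qed.

Lemma tends_subn u l k : tends u l -> tends (fun n => u (n - k)%N) l.
Proof.
by move=> /tends_nm h; apply/tends_nm => e /h[N hN]; exists (N + k)%N => n hn; apply: hN; lia.
Qed.

Lemma eq_tends u v l : (forall n, u n = v n) -> tends u l -> tends v l.
Proof. by move=> e; rewrite (_ : u = v) //; apply/funext. Qed.

Lemma tends_bounded u l : tends u l -> exists2 K, 0 <= K & forall n, nm (u n) <= K.
Proof.
move=> /tends_nm /(_ 1 ltr01)[N hN].
have s0 : 0 <= \sum_(k < N) nm (u k) by apply: sumr_ge0 => k _; apply: nm_ge0.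
exists (nm l + 1 + \sum_(k < N) nm (u k)) => [|n].
  by rewrite !addr_ge0 ?nm_ge0.
case: (leqP N n) => hn.
  have := hN _ hn; have := nmD (u n - l) l; rewrite subrK; lra.
rewrite (bigD1 (Ordinal hn)) //=.
have : 0 <= \sum_(i < N | i != Ordinal hn) nm (u i) by apply: sumr_ge0 => k _; apply: nm_ge0.
have := nm_ge0 l; lra.
Qed.

Lemma tends_nm_le u l K : tends u l -> (forall n, nm (u n) <= K) -> nm l <= K.
Proof.
move=> /tends_nm h hK; rewrite leNgt; apply/negP => hl.
have [N /(_ N (leqnn N))] := h (nm l - K) ltac:(by rewrite subr_gt0).
have := hK N; have := nmD (l - u N) (u N); rewrite subrK (nmB l); lra.
Qed.

Lemma tends_nm_ge u l K : tends u l -> (exists N, forall n, (N <= n)%N -> K <= nm (u n)) -> K <= nm l.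
Proof.
move=> /tends_nm h [M hM]; rewrite leNgt; apply/negP => hl.
have [N hN] := h (K - nm l) ltac:(by rewrite subr_gt0).
have := hN _ (leq_maxl N M); have := hM _ (leq_maxr N M).
have := nmD (u (maxn N M) - l) l; rewrite subrK; lra.
Qed.

Lemma geo_tail (r : R) m n : 0 <= r -> r < 1 ->
  \sum_(k < n) r ^+ (m + k) <= r ^+ m / (1 - r).
Proof.
move=> r0 r1; have d : 0 < 1 - r by rewrite subr_gt0.
suff -> : \sum_(k < n) r ^+ (m + k) = (r ^+ m - r ^+ (m + n)) / (1 - r).
  by rewrite ler_pM2r ?invr_gt0 // lerBlDr lerDl exprn_ge0.
elim: n => [|n IH]; first by rewrite big_ord0 addn0 subrr mul0r.
rewrite big_ord_recr /= IH addnS (exprS r (m + n)); field.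
by rewrite gt_eqF.
Qed.

Lemma geo_small (r e : R) K : 0 <= r -> r < 1 -> 0 < e -> exists N, K * r ^+ N < e.
Proof.
move=> r0 r1 e0.
have : (fun n => K * r ^+ n) @ \oo --> K * 0.
  by apply: cvgMr; apply: cvg_expr; rewrite ger0_norm.
rewrite mulr0 => /cvgrPdist_lt /(_ e e0)[N _ /(_ N (leqnn N))] /=.
rewrite sub0r normrN => h; exists N; exact: le_lt_trans (ler_norm _) h.
Qed.

Definition geo_bounded u := exists K r : R, [/\ 0 <= K, 0 <= r, r < 1 & forall k, nm (u k) <= K * r ^+ k].

(** Phrased as a difference tending to 0, so that the convergence of either sum can be deduced from
    that of the other. *)
Theorem tannery (f : nat -> nat -> C) (g : nat -> C) K r :
  0 <= K -> 0 <= r -> r < 1 -> (forall n k, nm (f n k) <= K * r ^+ k) ->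
  (forall k, tends (f ^~ k) (g k)) ->
  tends (fun n => \sum_(k < n) f n k - \sum_(k < n) g k) (0 : C).
Proof.
move=> K0 r0 r1 hf hg; apply/tends_nm => e e0.
have gK k : nm (g k) <= K * r ^+ k by apply: tends_nm_le (hg k) _.
have d : 0 < 1 - r by rewrite subr_gt0.
have [M hM] := geo_small (2 * K / (1 - r)) r0 r1 (divr_gt0 e0 (ltr0n _ 2)).
have head : tends (fun n => \sum_(k < M) (f n k - g k)) (0 : C).
  elim: M {hM} => [|M IH].
    by apply: (eq_tends (u := fun=> 0)) (tends_cst _) => n; rewrite big_ord0.
  apply: (eq_tends (fun n => esym (big_ord_recr _ _))) => /=.
  by have := tendsD IH (tendsB (hg M) (tends_cst (g M))); rewrite subrr addr0.
have [N hN] := (tends_nm _ _).1 head _ (divr_gt0 e0 (ltr0n _ 2)).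
exists (M + N)%N => n hn; rewrite subr0 -sumrB.
have -> : n = (M + (n - M))%N by lia.
rewrite big_split_ord /=; apply: le_lt_trans (nmD _ _) _.
rewrite (_ : (M + (n - M) = n)%N); last lia.
have := hN n ltac:(lia); rewrite subr0 => h1.
suff h2 : nm (\sum_(i < n - M) (f n (M + i)%N - g (M + i)%N)) < e / 2 by lra.
apply: le_lt_trans (nm_sum _ (fun i => f n (M + i)%N - g (M + i)%N)) _.
apply: le_lt_trans _ hM.
have : \sum_(i < n - M) nm (f n (M + i)%N - g (M + i)%N) <= 2 * K * \sum_(i < n - M) r ^+ (M + i).
  rewrite mulr_sumr; apply: ler_sum => k _; apply: le_trans (nmD _ _) _; rewrite nmN.
  by have := hf n (M + k)%N; have := gK (M + k)%N; lra.
move/le_trans; apply; rewrite (_ : 2 * K / (1 - r) * r ^+ M = 2 * K * (r ^+ M / (1 - r))).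
  by rewrite ler_wpM2l ?mulr_ge0 // geo_tail.
by rewrite mulrA mulrAC.
Qed.


Lemma tannery_tends (f : nat -> nat -> C) (g : nat -> C) K r l :
  0 <= K -> 0 <= r -> r < 1 -> (forall n k, nm (f n k) <= K * r ^+ k) ->
  (forall k, tends (f ^~ k) (g k)) ->
  tends (fun n => \sum_(k < n) f n k) l <-> tends (fun n => \sum_(k < n) g k) l.
Proof.
move=> K0 r0 r1 hf hg; have h := tannery K0 r0 r1 hf hg; split=> h'.
  have := tendsB h' h; rewrite subr0; apply: eq_tends => n /=.
  by rewrite opprB addrC subrK.
have := tendsD h h'; rewrite add0r; apply: eq_tends => n /=.
by rewrite subrK.
Qed.

Lemma real_geo_cvg (a : nat -> R) K r : 0 <= K -> 0 <= r -> r < 1 ->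
  (forall k, `|a k| <= K * r ^+ k) ->
  exists l : R, (fun n => \sum_(k < n) a k) @ \oo --> l.
Proof.
move=> K0 r0 r1 ha; exists (lim ((fun n => \sum_(k < n) a k) @ \oo)).
have -> : (fun n => \sum_(k < n) a k) = series a by apply/funext => n; rewrite seriesEord.
apply: normed_cvg; apply: (series_le_cvg _ _ ha) => [k|k|].
- exact: normr_ge0.
- by rewrite mulr_ge0 ?exprn_ge0.
- by apply: is_cvg_geometric_series; rewrite ger0_norm.
Qed.

Lemma geo_tends u : geo_bounded u -> exists l, tends (fun n => \sum_(k < n) u k) l.
Proof.
move=> [K [r [K0 r0 r1 hu]]].
have hRe x : `|complex.Re x| <= nm x.
  by case: x => a b; rewrite /nm /= -sqrtr_sqr ler_wsqrtr // lerDl sqr_ge0.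
have hIm x : `|complex.Im x| <= nm x.
  by case: x => a b; rewrite /nm /= -sqrtr_sqr ler_wsqrtr // lerDr sqr_ge0.
have [a ha] := real_geo_cvg K0 r0 r1 (fun k => le_trans (hRe _) (hu k)).
have [b hb] := real_geo_cvg K0 r0 r1 (fun k => le_trans (hIm _) (hu k)).
exists (Complex a b); apply/tends_nm => e e0.
have [N _ hN] := (cvgrPdist_lt _ _).1 ha _ (divr_gt0 e0 (ltr0n _ 2)).
have [M _ hM] := (cvgrPdist_lt _ _).1 hb _ (divr_gt0 e0 (ltr0n _ 2)).
exists (maxn N M) => n hn.
have h1 := hN n (leq_trans (leq_maxl _ _) hn); have h2 := hM n (leq_trans (leq_maxr _ _) hn).
have -> : \sum_(k < n) u k = Complex (\sum_(k < n) complex.Re (u k)) (\sum_(k < n) complex.Im (u k)).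
  elim: n {hn h1 h2} => [|n IH]; first by rewrite !big_ord0.
  by rewrite !big_ord_recr /= IH; case: (u n).
rewrite /= distrC in h1; rewrite /= distrC in h2.
set x := _ - a in h1; set y := _ - b in h2.
rewrite [X in nm X < _](_ : _ = (Complex x 0 : C) + (Complex 0 y : C)); last first.
  by apply/eqP; rewrite eq_complex /= addr0 add0r !eqxx.
apply: le_lt_trans (nmD _ _) _; rewrite /nm /= !expr0n /= addr0 add0r !sqrtr_sqr; lra.
Qed.

Lemma geo_tends0 u : geo_bounded u -> tends u (0 : C).
Proof.
move=> [K [r [K0 r0 r1 hu]]]; apply/tends_nm => e e0.
have [N hN] := geo_small K r0 r1 e0; exists N => n hn; rewrite subr0.
apply: le_lt_trans (hu n) (le_lt_trans _ hN).
by apply: ler_wpM2l => //; apply: ler_wiXn2l => //; apply: ltW.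
Qed.

Lemma poch_prod_le (x r : R) n : 0 <= x -> 0 <= r -> r < 1 ->
  \prod_(k < n) (1 + x * r ^+ k) <= expR (x / (1 - r)).
Proof.
move=> x0 r0 r1; apply: (@le_trans _ _ (expR (x * \sum_(k < n) r ^+ (0 + k)))).
  rewrite mulr_sumr; elim: n => [|n IH]; first by rewrite !big_ord0 expR0.
  rewrite !big_ord_recr /= expRD ler_pM ?expR_ge1Dx //.
    by apply: prodr_ge0 => k _; rewrite addr_ge0 ?mulr_ge0 ?exprn_ge0.
  by rewrite addr_ge0 ?mulr_ge0 ?exprn_ge0.
rewrite ler_expR ler_wpM2l //.
by have := geo_tail 0 n r0 r1; rewrite expr0 div1r.
Qed.

Lemma qpoch_bounded (a q : C) n : nm q < 1 -> nm (qpoch a q n) <= expR (nm a / (1 - nm q)).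
Proof.
move=> hq; apply: le_trans _ (poch_prod_le n (nm_ge0 a) (nm_ge0 q) hq).
elim: n => [|n IH]; first by rewrite /qpoch !big_ord0 nm1.
rewrite /qpoch !big_ord_recr /= nmM ler_pM ?nm_ge0 //.
by rewrite (le_trans (nmD _ _)) // nmN nm1 nmM nmX.
Qed.

Lemma qpochS (a q : C) n : qpoch a q n.+1 = qpoch a q n * (1 - a * q ^+ n).
Proof. exact: big_ord_recr. Qed.

(** The finite products are the partial sums of their differences -a q^k (a;q)_k, which decay
    geometrically because the finite products are bounded. *)
Lemma qpoch_tends (a q : C) : nm q < 1 -> tends (qpoch a q) (qpoch_inf a q).
Proof.
move=> hq; suff [l hl] : exists l, tends (qpoch a q) l.
  by constructor; case: hl => hl; apply: (cvgP _ hl).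
have gb : geo_bounded (fun n => qpoch a q n.+1 - qpoch a q n).
  exists (expR (nm a / (1 - nm q)) * nm a), (nm q); split=> //.
  - by rewrite mulr_ge0 ?expR_ge0 ?nm_ge0.
  - exact: nm_ge0.
  - move=> k; rewrite qpochS mulrBr mulr1 addrC addKr nmN !nmM nmX mulrA.
    by rewrite !ler_wpM2r ?exprn_ge0 ?nm_ge0 // qpoch_bounded.
have [l hl] := geo_tends gb; exists (1 + l).
have := tendsD (tends_cst 1) hl; apply: eq_tends => n /=.
rewrite -(big_mkord xpredT (fun k => qpoch a q k.+1 - qpoch a q k)) telescope_sumr //.
by rewrite [qpoch a q 0]big_ord0 addrC subrK.
Qed.

(** From an index M on, x = |a q^n| is at most 1/2, where (1 - x)(1 + 2x) >= 1. The tail product is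
    therefore bounded below by the inverse of a product of factors 1 + 2x, itself bounded by an
    exponential. *)
Lemma qpoch_inf_neq0 (a q : C) : nm q < 1 -> (forall n, 1 - a * q ^+ n != 0) ->
  qpoch_inf a q != 0.
Proof.
move=> hq ha.
have [M hM] := geo_small (nm a) (nm_ge0 q) hq (divr_gt0 ltr01 (ltr0n _ 2)).
have qn n : qpoch a q n != 0 by apply/prodf_neq0 => k _; apply: ha.
set B := expR (2 * (nm a * nm q ^+ M) / (1 - nm q)).
have B0 : 0 < B by apply: expR_gt0.
suff : nm (qpoch a q M) / B <= nm (qpoch_inf a q).
  move=> h; apply/negP => /eqP e; move: h; rewrite e nm0 leNgt.
  by rewrite divr_gt0 // nm_gt0.
apply: (tends_nm_ge (qpoch_tends a hq)); exists M => n hn.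
have -> : n = (M + (n - M))%N by lia.
rewrite [qpoch a q (M + _)](pochD a q M (n - M)) nmM.
rewrite ler_wpM2l ?nm_ge0 //.
set b := a * q ^+ M; have hb : nm b = nm a * nm q ^+ M by rewrite nmM nmX.
have b0 := nm_ge0 b.
have := poch_prod_le (n - M) (mulr_ge0 (ler0n _ 2) b0) (nm_ge0 q) hq.
rewrite hb -/B => hB.
have : 1 <= nm (poch b q (n - M)) * \prod_(k < n - M) (1 + 2 * nm b * nm q ^+ k).
  elim: (n - M)%N => [|m IH]; first by rewrite poch0 nm1 mul1r big_ord0.
  rewrite pochS big_ord_recr /= nmM mulrACA -[leLHS]mulr1 ler_pM //.
  set x := nm b * nm q ^+ m.
  have x0 : 0 <= x by rewrite mulr_ge0 ?exprn_ge0 ?nm_ge0.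
  have x1 : x <= 1 / 2.
    apply: le_trans (ltW hM); rewrite -hb ler_piMr //.
    by rewrite exprn_ile1 ?nm_ge0 // ltW.
  have : 1 - x <= nm (1 - b * q ^+ m).
    have := nmD (1 - b * q ^+ m) (b * q ^+ m); rewrite subrK nm1 nmM nmX -/x; lra.
  move=> h; apply: (@le_trans _ _ ((1 - x) * (1 + 2 * x))).
    nra.
  by rewrite -mulrA -/x ler_wpM2r // addr_ge0 // mulr_ge0.
move=> h; rewrite -[leLHS]mul1r ler_pdivrMr //; apply: le_trans h _.
by rewrite ler_wpM2l ?nm_ge0 // hb.
Qed.

Lemma qpochV_tends (a q : C) : nm q < 1 -> (forall n, 1 - a * q ^+ n != 0) ->
  tends (fun n => (qpoch a q n)^-1) (qpoch_inf a q)^-1.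
Proof. by move=> hq ha; apply: tendsV (qpoch_inf_neq0 hq ha) (qpoch_tends a hq). Qed.

Lemma qpochV_bounded (a q : C) : nm q < 1 -> (forall n, 1 - a * q ^+ n != 0) ->
  exists2 K, 0 <= K & forall n, nm (qpoch a q n)^-1 <= K.
Proof. by move=> hq ha; apply: tends_bounded (qpochV_tends hq ha). Qed.

Lemma one_sub_neq0 (x : C) : nm x < 1 -> 1 - x != 0.
Proof.
by move=> h; rewrite subr_eq0; apply/eqP => e; move: h; rewrite -e nm1 ltxx.
Qed.

Lemma nm_pow_lt1 (x : C) n : nm x < 1 -> nm (x ^+ n.+1) < 1.
Proof. by move=> h; rewrite nmX exprn_ilt1 ?nm_ge0. Qed.

End ComplexLimits.

(** * The limiting Bailey lemma *)

Section BaileyLimits.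
Variable R : realType.
Local Notation C := (Cplx R).
Implicit Types (t z l a b : C) (c u v : nat -> C).

Lemma tends_unshift u l : tends (fun n => u n.+1) l -> tends u l.
Proof.
move=> /tends_nm h; apply/tends_nm => e /h[N hN]; exists N.+1 => -[//|n].
by rewrite ltnS => /hN.
Qed.

Lemma tends_pred u l : tends u l -> tends (fun n => u n.-1) l.
Proof. by move=> h; apply: tends_unshift. Qed.

Lemma weighted_limit c (W : nat -> nat -> C) (g : nat -> C) B l :
  geo_bounded c -> (forall n k, nm (W n k) <= B) ->
  (forall k, tends (W ^~ k) (g k)) ->
  tends (fun n => \sum_(k < n) c k * W n k) l <->
  tends (fun n => \sum_(k < n) c k * g k) l.
Proof.
move=> [K [r [K0 r0 r1 hc]]] hW hg.
have B0 : 0 <= B by apply: le_trans (nm_ge0 _) (hW 0%N 0%N).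
apply: (@tannery_tends R (fun n k => c k * W n k) (fun k => c k * g k) (K * B) r l) => //; first exact: mulr_ge0.
  move=> n k; rewrite nmM mulrAC ler_pM ?nm_ge0 //.
by move=> k; apply: tendsM (tends_cst _) (hg k).
Qed.

Lemma geo_boundedM c u B : geo_bounded c -> (forall k, nm (u k) <= B) ->
  geo_bounded (fun k => c k * u k).
Proof.
move=> [K [r [K0 r0 r1 hc]]] hB; have B0 := le_trans (nm_ge0 _) (hB 0%N).
exists (K * B), r; split=> //; first exact: mulr_ge0.
by move=> k; rewrite nmM mulrAC ler_pM ?nm_ge0.
Qed.

(** Consecutive terms have ratio z r^m, which is below 1/2 from some N on; [K] takes care of the
    first terms. A large z is allowed, as occurs for q^(4-4i+c) in Euler's sum. *)
Lemma quadratic_geo (r z : R) : 0 <= r -> r < 1 -> 0 <= z ->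
  exists2 K, 0 <= K & forall m, r ^+ 'C(m, 2) * z ^+ m <= K * 2^-1 ^+ m.
Proof.
move=> r0 r1 z0; pose x m := r ^+ 'C(m, 2) * z ^+ m.
have x0 m : 0 <= x m by rewrite mulr_ge0 ?exprn_ge0.
have [N hN] := geo_small z r0 r1 (divr_gt0 ltr01 (ltr0n _ 2)).
have h2 m : (0 : R) < 2^-1 ^+ m by rewrite exprn_gt0 // invr_gt0.
have s0 m : 0 <= \sum_(k < m) x k / 2^-1 ^+ k.
  by apply: sumr_ge0 => k _; rewrite divr_ge0 // ltW.
exists (\sum_(k < N.+1) x k / 2^-1 ^+ k) => // m.
case: (leqP m N) => hm.
  rewrite -ler_pdivrMr // -/(x m) (bigD1 (Ordinal (_ : m < N.+1)%N)) //= lerDl.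
  by apply: sumr_ge0 => k _; rewrite divr_ge0 // ltW.
have [d ->] : exists d, m = (N + d)%N by exists (m - N)%N; lia.
elim: d => [|d IH].
  rewrite addn0 -ler_pdivrMr // -/(x N) big_ord_recr /= lerDr; exact: s0.
rewrite addnS binS bin1 exprD exprS (exprS _ (N + d)).
rewrite [leLHS](_ : _ = (r ^+ 'C(N + d, 2) * z ^+ (N + d)) * (z * r ^+ (N + d))); last by ring.
rewrite [leRHS]mulrCA [leRHS]mulrC ler_pM ?mulr_ge0 ?exprn_ge0 //.
rewrite -[leRHS]div1r; apply: le_trans _ (ltW hN).
by rewrite ler_wpM2l // ler_wiXn2l ?leq_addr // ltW.
Qed.

Lemma quadratic_geo_bounded t z : nm t < 1 -> geo_bounded (fun m => t ^+ 'C(m, 2) * z ^+ m).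
Proof.
move=> ht; have [K K0 hK] := quadratic_geo (nm_ge0 t) ht (nm_ge0 z).
exists K, (2^-1); split=> //.
- by rewrite invf_lt1 // ltr1n.
- by move=> k; rewrite nmM !nmX.
Qed.

Section Base.
Variable t : C.
Hypothesis ht : nm t < 1.

Lemma qpow_neq1 n : 1 - t ^+ n.+1 != 0.
Proof. by rewrite one_sub_neq0 // nm_pow_lt1. Qed.

Lemma qq_ok n : 1 - t * t ^+ n != 0.
Proof. by rewrite -exprS qpow_neq1. Qed.

Lemma qq_inf_neq0 : qpoch_inf t t != 0.
Proof. exact: qpoch_inf_neq0 ht qq_ok. Qed.

Lemma qqV_bounded : exists2 K, 0 <= K & forall n, nm (poch t t n)^-1 <= K.
Proof. exact: (qpochV_bounded ht qq_ok). Qed.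

Lemma poch_bounded a : exists2 K, 0 <= K & forall n, nm (poch a t n) <= K.
Proof. by apply: tends_bounded (qpoch_tends a ht). Qed.

Lemma qqV_tends : tends (fun n => (poch t t n)^-1) (qpoch_inf t t)^-1.
Proof. exact: (qpochV_tends ht qq_ok). Qed.

Lemma qpoch_inf_split a n : qpoch_inf a t = poch a t n * qpoch_inf (a * t ^+ n) t.
Proof.
apply: (tends_uniq (tends_shift n (qpoch_tends a ht))).
have := tendsM (tends_cst (poch a t n)) (qpoch_tends (a * t ^+ n) ht).
by apply: eq_tends => m; rewrite addnC; exact/esym/(pochD a t n m).
Qed.

(** Limit of the q-binomial theorem: for fixed k, [qb] of row n at k tends to the inverse of
    (t;t)_k. *)
Theorem euler_sum z :
  tends (fun n => \sum_(k < n) t ^+ 'C(k, 2) * z ^+ k / poch t t k) (qpoch_inf (- z) t).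
Proof.
have [K K0 hK] := qqV_bounded; have [B B0 hB] := poch_bounded t.
(* With the row [n.-1], a sum over k < n is exactly one complete instance of [q_binomial]. *)
pose W n k := qb t n.-1 k.
apply/(@weighted_limit (fun m => t ^+ 'C(m, 2) * z ^+ m) W (fun k => (poch t t k)^-1)
  (B * (K * K)) (qpoch_inf (- z) t)).
- exact: quadratic_geo_bounded.
- move=> n k; rewrite /W /qb; case: ifP => _; last by rewrite nm0 !mulr_ge0.
  by rewrite nmM invfM nmM !ler_pM ?mulr_ge0 ?nm_ge0.
- move=> k; apply: (tends_pred (u := fun n => qb t n k)).
  have h : tends (fun n => poch t t n * ((poch t t k)^-1 * (poch t t (n - k))^-1))
      (qpoch_inf t t * ((poch t t k)^-1 * (qpoch_inf t t)^-1)).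
    apply: tendsM (qpoch_tends _ ht) (tendsM (tends_cst _) _).
    exact: (tends_subn k qqV_tends).
  rewrite mulrCA divff ?qq_inf_neq0 // mulr1 in h.
  move/tends_nm: h => h; apply/tends_nm => e /h[N hN]; exists (maxn N k) => n.
  rewrite geq_max => /andP[h1 h2]; rewrite /qb h2 invfM; exact: hN.
- apply: tends_unshift; apply: eq_tends (qpoch_tends (- z) ht) => n.
  rewrite [LHS](_ : _ = poch (- z) t n) // -(q_binomial qpow_neq1).
  by apply: eq_bigr => k _; rewrite /W /= [RHS]mulrC mulrA.
Qed.

Definition theta_term (a b : C) r := if r is 0%N then 1 else t ^+ 'C(r, 2) * (a ^+ r + b ^+ r).

Lemma inv_qq_qq_bounded e : exists2 B, 0 <= B &
  forall n k, nm ((poch t t (n.-1 - k) * poch t t (n.-1 + k + e))^-1) <= B.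
Proof.
have [K K0 hK] := qqV_bounded; exists (K * K); first exact: mulr_ge0.
by move=> n k; rewrite invfM nmM ler_pM ?nm_ge0.
Qed.

Lemma inv_qq_qq_tends e k :
  tends (fun n => (poch t t (n.-1 - k) * poch t t (n.-1 + k + e))^-1)
        ((qpoch_inf t t)^-1 * (qpoch_inf t t)^-1).
Proof.
apply: (eq_tends (fun n => esym (invfM _ _))).
apply: (tends_pred (u := fun n => (poch t t (n - k))^-1 * (poch t t (n + k + e))^-1)).
apply: tendsM; first exact: (tends_subn k qqV_tends).
apply: (eq_tends (u := fun n => (poch t t (n + (k + e)))^-1)) => [n|].
  by rewrite addnA.
exact: (tends_shift (k + e) qqV_tends).
Qed.

(** Dividing [qbsum_thetaw] by (t;t)_(2n) gives weights 1/((t;t)_(n-r) (t;t)_(n+r)); in the limit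
    the theta series over (t;t)_oo^2 equals the two products over (t;t)_oo. *)
Theorem jacobi_triple a b : t != 0 -> nm a <= 1 -> nm b <= 1 -> a * b = t ->
  tends (fun n => \sum_(r < n) theta_term a b r)
    (qpoch_inf (- a) t * qpoch_inf (- b) t * qpoch_inf t t).
Proof.
move=> t0 ha hb hab; have nz := qq_inf_neq0.
have gb : geo_bounded (theta_term a b).
  (* As C(r+1,2) >= r, the term of index r+1 is at most 2 |t|^r; dividing by |t| turns this into a
     multiple of |t|^(r+1). *)
  have nt := nm_gt0 t0; exists (2 / nm t), (nm t); split=> //.
  - by rewrite divr_ge0 ?nm_ge0.
  - exact: nm_ge0.
  - case=> [|r]; rewrite /theta_term.
      rewrite nm1 expr0 mulr1 ler_pdivlMr //; move: ht; lra.
    rewrite nmM mulrC -mulrA ler_pM ?nm_ge0 //.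
      apply: le_trans (nmD _ _) _; rewrite !nmX.
      have := exprn_ile1 r.+1 (nm_ge0 a) ha; have := exprn_ile1 r.+1 (nm_ge0 b) hb; lra.
    rewrite nmX exprS mulKf ?gt_eqF // ler_wiXn2l ?nm_ge0 1?ltW //.
    by rewrite binS bin1 leq_addl.
have [B B0 hB] := inv_qq_qq_bounded 0.
have [l hl] := geo_tends gb.
have h1 := tendsM hl (tends_cst ((qpoch_inf t t)^-1 * (qpoch_inf t t)^-1)).
have h2 : tends (fun n => \sum_(k < n) theta_term a b k * ((qpoch_inf t t)^-1 * (qpoch_inf t t)^-1))
    (l * ((qpoch_inf t t)^-1 * (qpoch_inf t t)^-1)).
  by apply: eq_tends h1 => n; rewrite mulr_suml.
have h3 := (weighted_limit (l * ((qpoch_inf t t)^-1 * (qpoch_inf t t)^-1)) gb hB (inv_qq_qq_tends 0)).2 h2.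
have h4 : tends (fun n => poch (- a) t n.-1 * poch (- b) t n.-1 * (poch t t (n.-1 + n.-1))^-1)
   (qpoch_inf (- a) t * qpoch_inf (- b) t * (qpoch_inf t t)^-1).
  apply: (tends_pred (u := fun n => poch (- a) t n * poch (- b) t n * (poch t t (n + n))^-1)).
  apply: tendsM (tendsM (qpoch_tends _ ht) (qpoch_tends _ ht)) _.
  by apply: (tends_sub (f := fun n => (n + n)%N) _ qqV_tends) => n; apply: leq_addr.
suff e : l * ((qpoch_inf t t)^-1 * (qpoch_inf t t)^-1)
    = qpoch_inf (- a) t * qpoch_inf (- b) t * (qpoch_inf t t)^-1.
  rewrite -[X in tends _ X](_ : l = _) //.
  rewrite (_ : l = l * ((qpoch_inf t t)^-1 * (qpoch_inf t t)^-1) * (qpoch_inf t t * qpoch_inf t t)).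
    by rewrite e; field.
  by field.
apply: tends_uniq (tends_shift 1 h3) _; apply: eq_tends (tends_shift 1 h4) => n.
rewrite addn1 /= -(qbsum_thetaw qpow_neq1 hab) -(qbsum_fold0 qpow_neq1).
apply: eq_bigr => r _ /=; congr (_ / _).
case: (r : nat) => [|k] //=; first by rewrite expr0 mulr1.
by rewrite mulrDr.
Qed.

(** The two sides of [bailey_lemma] tend to S/(t;t)_oo, with S the sum sought, and to T/(t;t)_oo^2.
    The weight decays like |y|^k, so bounded alpha and beta give the majorants. *)
Theorem bailey_limit e b y (alpha beta : nat -> C) T :
  nm y < 1 -> b * y = t ^+ e.+1 ->
  (forall n, \sum_(r < n.+1) alpha r / (poch t t (n - r) * poch t t (n + r + e)) = beta n) ->
  (exists K, forall r, nm (alpha r) <= K) -> (exists K, forall n, nm (beta n) <= K) ->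
  tends (fun n => \sum_(r < n) alpha r * bailey_weight t b y r * qpoch_inf (- (y * t ^+ r)) t) T ->
  tends (fun n => \sum_(k < n) bailey_weight t b y k * beta k) (T / qpoch_inf t t).
Proof.
move=> hy hby hbeta [Ka hKa] [Kb hKb] hT; have nz := qq_inf_neq0.
have gW : geo_bounded (bailey_weight t b y).
  have [K K0 hK] := poch_bounded (- b); exists K, (nm y); split=> //.
    exact: nm_ge0.
  move=> k; rewrite /bailey_weight !nmM !nmX -[leRHS]mulr1.
  by rewrite !ler_pM ?mulr_ge0 ?exprn_ge0 ?nm_ge0 // exprn_ile1 ?nm_ge0 // ltW.
have gWb := geo_boundedM gW hKb.
have gWa : geo_bounded (fun r => alpha r * bailey_weight t b y r).
  by have [K [r [? ? ? h]]] := geo_boundedM gW hKa; exists K, r; split=> // k; rewrite mulrC.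
have [S hS] := geo_tends gWb; have [K K0 hK] := qqV_bounded.
have h1 : tends (fun n => \sum_(k < n) bailey_weight t b y k * beta k * (poch t t (n.-1 - k))^-1)
    (S * (qpoch_inf t t)^-1).
  apply/(weighted_limit (W := fun n k => (poch t t (n.-1 - k))^-1) (g := fun=> (qpoch_inf t t)^-1)
    (B := K) _ gWb).
  - by [].
  - move=> k; exact: (tends_pred (tends_subn k qqV_tends)).
  - by apply: eq_tends (tendsM hS (tends_cst (qpoch_inf t t)^-1)) => n; rewrite mulr_suml.
have [B B0 hB] := inv_qq_qq_bounded e.
have h2 : tends (fun n => \sum_(r < n) alpha r * bailey_weight t b y r *
    (poch (- (y * t ^+ r)) t (n.-1 - r) * (poch t t (n.-1 - r) * poch t t (n.-1 + r + e))^-1))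
    (T * ((qpoch_inf t t)^-1 * (qpoch_inf t t)^-1)).
  apply/(weighted_limit (W := fun n r => poch (- (y * t ^+ r)) t (n.-1 - r) *
     (poch t t (n.-1 - r) * poch t t (n.-1 + r + e))^-1)
    (g := fun r => qpoch_inf (- (y * t ^+ r)) t * ((qpoch_inf t t)^-1 * (qpoch_inf t t)^-1))
    (B := expR (1 / (1 - nm t)) * B) _ gWa).
  - move=> n k; rewrite nmM ler_pM ?nm_ge0 //.
    apply: le_trans (qpoch_bounded _ _ ht) _; rewrite ler_expR ler_wpM2r //.
      by rewrite invr_ge0 subr_ge0 ltW.
    by rewrite nmN nmM nmX mulr_ile1 ?exprn_ge0 ?nm_ge0 ?exprn_ile1 ?nm_ge0 // ltW.
  - move=> k; apply: tendsM _ (inv_qq_qq_tends e k).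
    exact: (tends_pred (tends_subn k (qpoch_tends _ ht))).
  - apply: eq_tends (tendsM hT (tends_cst ((qpoch_inf t t)^-1 * (qpoch_inf t t)^-1))) => n.
    by rewrite mulr_suml; apply: eq_bigr => r _; rewrite !mulrA.
suff e12 : S * (qpoch_inf t t)^-1 = T * ((qpoch_inf t t)^-1 * (qpoch_inf t t)^-1).
  rewrite (_ : T / qpoch_inf t t = S) //; apply: (mulIf (invr_neq0 nz)).
  by rewrite e12 mulrA.
apply: tends_uniq (tends_shift 1 h1) _; apply: eq_tends (tends_shift 1 h2) => n.
rewrite addn1 /=.
transitivity (\sum_(r < n.+1) alpha r * bailey_weight t b y r *
     poch (- (y * t ^+ r)) t (n - r) / (poch t t (n - r) * poch t t (n + r + e))).
  by apply: eq_bigr => r _; rewrite !mulrA.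
rewrite -(bailey_lemma qpow_neq1 alpha n hby).
by apply: eq_bigr => k _; rewrite hbeta.
Qed.

(** For y = b the product (-b;t)_r (-b t^r;t)_oo is (-b;t)_oo for every r and leaves the sum. *)
Corollary bailey_limit_same e b (alpha beta : nat -> C) T :
  nm b < 1 -> b * b = t ^+ e.+1 ->
  (forall n, \sum_(r < n.+1) alpha r / (poch t t (n - r) * poch t t (n + r + e)) = beta n) ->
  (exists K, forall r, nm (alpha r) <= K) -> (exists K, forall n, nm (beta n) <= K) ->
  tends (fun n => \sum_(r < n) alpha r * (b ^+ r * t ^+ 'C(r, 2))) T ->
  tends (fun n => \sum_(k < n) bailey_weight t b b k * beta k)
        (T * qpoch_inf (- b) t / qpoch_inf t t).
Proof.
move=> hb hbb hbeta hKa hKb hT; apply: (bailey_limit hb hbb hbeta hKa hKb).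
apply: eq_tends (tendsM hT (tends_cst (qpoch_inf (- b) t))) => n.
rewrite mulr_suml; apply: eq_bigr => r _.
by rewrite (qpoch_inf_split (- b) r) /bailey_weight mulNr; ring.
Qed.

(** For y = b t the product (-b;t)_r (-b t^(r+1);t)_oo lacks exactly the factor 1 + b t^r of
    (-b;t)_oo; hence the pair is required to contain that factor. *)
Corollary bailey_limit_step e b (alpha beta : nat -> C) T :
  nm (b * t) < 1 -> b * (b * t) = t ^+ e.+1 ->
  (forall n, \sum_(r < n.+1) (alpha r * (1 + b * t ^+ r))
      / (poch t t (n - r) * poch t t (n + r + e)) = beta n) ->
  (exists K, forall r, nm (alpha r * (1 + b * t ^+ r)) <= K) -> (exists K, forall n, nm (beta n) <= K) ->
  tends (fun n => \sum_(r < n) alpha r * ((b * t) ^+ r * t ^+ 'C(r, 2))) T ->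
  tends (fun n => \sum_(k < n) bailey_weight t b (b * t) k * beta k)
        (T * qpoch_inf (- b) t / qpoch_inf t t).
Proof.
move=> hb hbb hbeta hKa hKb hT; apply: (bailey_limit hb hbb hbeta hKa hKb).
apply: eq_tends (tendsM hT (tends_cst (qpoch_inf (- b) t))) => n.
rewrite mulr_suml; apply: eq_bigr => r _.
rewrite (_ : b * t * t ^+ r = b * t ^+ r.+1); last by rewrite exprS mulrA.
by rewrite (qpoch_inf_split (- b) r.+1) /bailey_weight pochS !mulNr opprK; ring.
Qed.

End Base.
End BaileyLimits.

(** * Single sums of Rogers-Ramanujan type *)

Section SingleSums.
Variable R : realType.
Local Notation C := (Cplx R).
Implicit Types (t z l a b h s : C) (c u v : nat -> C).

Lemma bin2Z n : 2 * ('C(n, 2))%:Z = n%:Z * (n%:Z - 1).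
Proof.
elim: n => [|n IH] //; rewrite binS bin1.
have -> : n.+1%:Z = n%:Z + 1 by lia.
have -> : ('C(n, 2) + n)%N%:Z = ('C(n, 2))%:Z + n%:Z by lia.
by rewrite mulrDr IH; ring.
Qed.

Lemma nm_spow_le1 h (a b : int) : nm h <= 1 -> 0 <= b -> nm (spow h a b) <= 1.
Proof.
move=> hh; case: b => // b _; rewrite /spow nmM -exprnP nmX.
have -> : nm ((-1 : C) ^ a) = 1.
  by case: a => n; rewrite ?NegzE -?exprnP ?exprnN ?nmV nmX nmN nm1 expr1n ?invr1.
by rewrite mul1r exprn_ile1 ?nm_ge0.
Qed.

Lemma tends_pairs u T : geo_bounded u ->
  tends (fun n => \sum_(k < n) (u (k + k)%N + u (k + k).+1)) T ->
  tends (fun n => \sum_(k < n) u k) T.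
Proof.
move=> /geo_tends[l hl] hT; rewrite -[T](_ : l = T) //.
apply: tends_uniq (tends_sub (f := fun n => (n + n)%N) (fun n => leq_addr n n) hl) _.
apply: eq_tends hT => n; elim: n => [|n IH]; first by rewrite !big_ord0.
by rewrite addSn addnS !big_ord_recr /= IH addrA.
Qed.

(** Joins r with -r-1, to match [fold1]. The partial sums differ from those of [jacobi_triple] by
    the single term p^C(n,2) b^n, which tends to 0. *)
Lemma jacobi_triple_unfold p a b : nm p < 1 -> p != 0 -> nm a <= 1 -> nm b <= 1 -> a * b = p ->
  tends (fun n => \sum_(r < n) (p ^+ 'C(r, 2) * a ^+ r + p ^+ 'C(r.+1, 2) * b ^+ r.+1))
    (qpoch_inf (- a) p * qpoch_inf (- b) p * qpoch_inf p p).
Proof.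
move=> hp p0 ha hb hab.
have h1 := jacobi_triple hp p0 ha hb hab.
have h2 := geo_tends0 (quadratic_geo_bounded b hp).
have := tendsD h1 h2; rewrite addr0 => h3.
apply: tends_unshift; apply: eq_tends (tends_shift 1 h3) => n.
rewrite addn1; elim: n => [|n IH].
  by rewrite !big_ord1 /theta_term /= !expr0 mulr1.
by rewrite [RHS]big_ord_recr /= -IH [in LHS]big_ord_recr /=; ring.
Qed.

Lemma theta_combine (P e A B U V X Y : C) : A * P = U * X * Y -> B * P = V * X * Y ->
  P * (e * A + e * B) = (U + V) * (e * X * Y).
Proof.
move=> F1 F2; transitivity (e * (A * P + B * P)); first by ring.
by rewrite F1 F2; ring.
Qed.

Lemma theta_combine_fold (P Q c A B E X Y Z : C) :
  A * P * c = E * X * Y -> B * Q * c = - (E * X * Y * Z) ->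
  c * (P * A + Q * B) = E * (1 - Z) * (X * Y).
Proof.
move=> F1 F2; transitivity (A * P * c + B * Q * c); first by ring.
by rewrite F1 F2; ring.
Qed.

(** * Single sums from the pentagonal pairs, for both square roots [s] of the base *)

Section Pentagonal.
Variables (h s eps : C).
Hypotheses (h0 : h != 0) (hh : nm h < 1) (heps : eps ^+ 2 = 1) (hs : s = eps * h ^+ 2).
Local Notation x := (h ^+ 2).
Local Notation t := (h ^+ 4).

Let ht : nm t < 1. Proof. exact: nm_pow_lt1. Qed.
Let hx : nm x < 1. Proof. exact: nm_pow_lt1. Qed.
Let neps : nm eps = 1.
Proof.
have : nm eps ^+ 2 = 1 by rewrite -nmX heps nm1.
move/eqP; rewrite sqrf_eq1 => /orP[/eqP//|/eqP e].
by have := nm_ge0 eps; rewrite e oppr_ge0 ler10.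
Qed.
Let hsn : nm s < 1. Proof. by rewrite hs nmM neps mul1r. Qed.
Let hst : s * s = t.
Proof. by rewrite hs -!expr2 exprMn heps mul1r -exprM. Qed.
Let hp : nm (x ^+ 5) < 1. Proof. exact: nm_pow_lt1. Qed.
Let p0 : x ^+ 5 != 0. Proof. by rewrite !expf_neq0. Qed.

Let beta_bounded (P : nat -> C) (f : nat -> nat) (B : R) : (forall n, nm (P n) <= B) ->
  exists K, forall n, nm (P n / poch t t (f n)) <= K.
Proof.
move=> hP; have [K K0 hK] := qqV_bounded ht; exists (B * K) => n.
by rewrite nmM ler_pM ?nm_ge0.
Qed.

Let signX k r : (- (eps * x ^+ k)) ^+ r = eps ^+ r * spow h r (2 * k * r)%N%:Z.
Proof.
rewrite (exprNn (eps * x ^+ k)) exprMn /spow -!exprnP -!exprM; ring.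
Qed.

Let xpX k : (x ^+ 5) ^+ k = h ^+ (10 * k).
Proof. by rewrite -!exprM mulnA. Qed.

Let epsx_le1 k : nm (- (eps * x ^+ k.+1)) <= 1.
Proof. by rewrite nmN nmM neps mul1r ltW // nm_pow_lt1. Qed.

(** Up to sign, s^r t^C(r,2) is h^(2r^2); added to the exponent 3r^2 + r of [pent] it gives 5r^2 +
    r, a theta series of base h^10. *)
Lemma pentagonal_sum0 :
  tends (fun n => \sum_(k < n) bailey_weight t s s k * (poch x t k / poch t t (k + k)))
   (qpoch_inf (eps * x ^+ 3) (x ^+ 5) * qpoch_inf (eps * x ^+ 2) (x ^+ 5)
      * qpoch_inf (x ^+ 5) (x ^+ 5) * qpoch_inf (- s) t / qpoch_inf t t).
Proof.
have [B B0 hB] := poch_bounded ht x.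
apply: (@bailey_limit_same R t ht 0 s (fold0 (pent h))
  (fun k => poch x t k / poch t t (k + k))) => //.
- move=> n; rewrite (qbsum_fold0 (qpow_neq1 ht)).
  by have [-> _] := qbsum_pent (qpow_neq1 ht) h0 (erefl t) n.
- exists 2 => -[|r].
    by rewrite [fold0 _ _](_ : _ = 1) ?nm1 ?ler1n //= /pent /spow !mulr1.
  rewrite /fold0.
  apply: le_trans (nmD _ _) _; rewrite -[2]/(1 + 1) lerD //.
    by apply: nm_spow_le1; [exact: ltW | nia].
  by apply: nm_spow_le1; [exact: ltW | nia].
- exact: beta_bounded hB.
have e : - (eps * x ^+ 3) * - (eps * x ^+ 2) = x ^+ 5.
  by rewrite mulrNN mulrACA -expr2 heps mul1r -exprD.
have := jacobi_triple hp p0 (epsx_le1 2) (epsx_le1 1) e; rewrite !opprK.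
apply: eq_tends => n; apply: eq_bigr => r _.
case: (r : nat) => [|k]; first by rewrite /= !expr0 /pent /spow !mulr1.
rewrite /theta_term /fold0; set m := k.+1.
have E1 : (- (eps * x ^+ 3)) ^+ m = eps ^+ m * spow h m (6 * m%:Z).
  rewrite signX; congr (_ * spow _ _ _); lia.
have E2 : (- (eps * x ^+ 2)) ^+ m = eps ^+ m * spow h m (4 * m%:Z).
  rewrite signX; congr (_ * spow _ _ _); lia.
have Es : s ^+ m = eps ^+ m * h ^+ (2 * m) by rewrite hs exprMn -exprM.
have Ep := xpX 'C(m, 2).
have Et : t ^+ 'C(m, 2) = h ^+ (4 * 'C(m, 2)) by rewrite -!exprM.
have hb := bin2Z m.
have F1 : spow h m (6 * m%:Z) * h ^+ (10 * 'C(m, 2)) = pent h m * h ^+ (2 * m) * h ^+ (4 * 'C(m, 2)).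
  by rewrite !spowM //; apply: (@eq_spow _ h 0); [ring | lia].
have F2 : spow h m (4 * m%:Z) * h ^+ (10 * 'C(m, 2)) = pent h (- m%:Z) * h ^+ (2 * m) * h ^+ (4 * 'C(m, 2)).
  by rewrite !spowM //; apply: (@eq_spow _ h m%:Z); [ring | lia].
rewrite E1 E2 Es Ep Et.
exact: theta_combine F1 F2.
Qed.




Let hst' : s * (s * t) = t ^+ 2.
Proof. by rewrite mulrA hst expr2. Qed.
Let hstn : nm (s * t) < 1.
Proof. by rewrite nmM mulr_ilt1 ?nm_ge0. Qed.
Let hs2 : s * s = x * x.
Proof. by rewrite hst -!exprD. Qed.

(** Folding the reflected weight gives pent(-r) (1 - s^2 t^(2r)). This difference of squares yields
    the factor 1 + s t^r wanted by [bailey_limit_step] for either sign of s. *)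
Lemma pentagonal_sum1 :
  tends (fun n => \sum_(k < n) bailey_weight t s (s * t) k *
      ((1 + x * t ^+ k) * poch x t k.+1 / poch t t (k + k).+1))
   (qpoch_inf (eps * x ^+ 4) (x ^+ 5) * qpoch_inf (eps * x) (x ^+ 5)
      * qpoch_inf (x ^+ 5) (x ^+ 5) * qpoch_inf (- s) t / qpoch_inf t t).
Proof.
have [B B0 hB] := poch_bounded ht x.
pose alpha r := pent h (- r%:Z) * (1 - s * t ^+ r).
have halpha r : alpha r * (1 + s * t ^+ r) = fold1 (fun r => pent h (- r)) r.
  rewrite /alpha /fold1 -mulrA -subr_sqr expr1n exprMn expr2 hs2 -expr2 mulrBr mulr1.
  rewrite -!exprM -exprD spowM // spowN.
  by congr (_ + _); apply: (@eq_spow _ h (- r%:Z)); ring.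
have nalpha r : nm (fold1 (fun r => pent h (- r)) r) <= 2.
  apply: le_trans (nmD _ _) _; rewrite -[2]/(1 + 1) lerD //.
    by apply: nm_spow_le1; [exact: ltW | nia].
  by apply: nm_spow_le1; [exact: ltW | nia].
apply: (@bailey_limit_step R t ht 1 s alpha
  (fun k => (1 + x * t ^+ k) * poch x t k.+1 / poch t t (k + k).+1)) => //.
- move=> n; rewrite -(qbsum_pentN (qpow_neq1 ht) h0 (erefl t)).
  under eq_bigr do rewrite halpha.
  rewrite (qbsum_fold1 (qpow_neq1 ht)); congr (_ / _).
  by apply: eq_qbsum => j _; congr (pent _ _); rewrite opprB.
- by exists 2 => r; rewrite halpha.
- apply: (@beta_bounded _ _ (2 * B)) => n; rewrite nmM ler_pM ?nm_ge0 //.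
  apply: le_trans (nmD _ _) _; rewrite nm1 -[2]/(1 + 1) lerD // nmM.
  rewrite mulr_ile1 ?nm_ge0 ?(ltW hx) //.
  by rewrite nmX exprn_ile1 ?nm_ge0 // ltW.
have e : - (eps * x ^+ 4) * - (eps * x) = x ^+ 5.
  by rewrite mulrNN mulrACA -expr2 heps mul1r -exprSr.
have := jacobi_triple_unfold hp p0 (epsx_le1 3) (epsx_le1 0) e; rewrite !opprK.
apply: eq_tends => n; apply: eq_bigr => r _; set m := nat_of_ord r.
have E1 : (- (eps * x ^+ 4)) ^+ m = eps ^+ m * spow h m (8 * m%:Z).
  rewrite signX; congr (_ * spow _ _ _); lia.
have E2 : (- (eps * x)) ^+ m.+1 = eps ^+ m.+1 * spow h m.+1 (2 * m.+1%:Z).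
  rewrite -{1}[x]expr1  signX; congr (_ * spow _ _ _); lia.
have Es : (s * t) ^+ m = eps ^+ m * h ^+ (6 * m).
  by rewrite hs -mulrA exprMn -exprD -exprM.
have Ep k := xpX 'C(k, 2).
have Et : t ^+ 'C(m, 2) = h ^+ (4 * 'C(m, 2)) by rewrite -!exprM.
have Em : s * t ^+ m = eps * h ^+ (4 * m + 2) by rewrite hs exprD -exprM; ring.
have hb := bin2Z m; have hb1 := bin2Z m.+1.
have F1 : spow h m (8 * m%:Z) * h ^+ (10 * 'C(m, 2)) = pent h (- m%:Z) * h ^+ (6 * m) * h ^+ (4 * 'C(m, 2)).
  by rewrite !spowM //; apply: (@eq_spow _ h m%:Z); [ring | lia].
have F2 : spow h m.+1 (2 * m.+1%:Z) * h ^+ (10 * 'C(m.+1, 2)) =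
    - (pent h (- m%:Z) * h ^+ (6 * m) * h ^+ (4 * 'C(m, 2)) * h ^+ (4 * m + 2)).
  have e1 : m.+1%:Z = m%:Z + 1 by lia.
  rewrite e1 in hb1 *.
  by rewrite !spowM // spowN; apply: (@eq_spow _ h m%:Z); [ring | lia].
rewrite /alpha E1 E2 Es !Ep Et Em.
have G1 : eps ^+ m * spow h m (8 * m%:Z) * h ^+ (10 * 'C(m, 2)) * 1 =
   pent h (- m%:Z) * (eps ^+ m * h ^+ (6 * m)) * h ^+ (4 * 'C(m, 2)).
  rewrite mulr1 -mulrA F1.
  by move: (eps ^+ m) (pent h _) (h ^+ (6 * m)) (h ^+ (4 * 'C(m, 2))) => *; ring.
have G2 : eps ^+ m.+1 * spow h m.+1 (2 * m.+1%:Z) * h ^+ (10 * 'C(m.+1, 2)) * 1 =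
   - (pent h (- m%:Z) * (eps ^+ m * h ^+ (6 * m)) * h ^+ (4 * 'C(m, 2)) * (eps * h ^+ (4 * m + 2))).
  rewrite mulr1 -mulrA F2 mulrN; congr (- _); rewrite exprSr.
  by move: (eps ^+ m) (pent h _) (h ^+ (6 * m)) (h ^+ (4 * 'C(m, 2))) (h ^+ _) => *; ring.
by rewrite -[LHS]mul1r; exact: theta_combine_fold G1 G2.
Qed.

(** Folding the unreflected weight gives pent(r) (1 - h^2 t^r), whose second factor is 1 + s t^r
    precisely for s = -h^2. *)
Lemma pentagonal_sum2 : eps = -1 ->
  tends (fun n => \sum_(k < n) bailey_weight t s (s * t) k * (poch x t k.+1 / poch t t (k + k).+1))
   (2^-1 * (qpoch_inf (- x ^+ 5) (x ^+ 5) * qpoch_inf (- 1) (x ^+ 5) * qpoch_inf (x ^+ 5) (x ^+ 5))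
      * qpoch_inf (- s) t / qpoch_inf t t).
Proof.
move=> he; have sx : s = - x by rewrite hs he mulN1r.
have [B B0 hB] := poch_bounded ht x.
have halpha r : pent h r%:Z * (1 + s * t ^+ r) = fold1 (pent h) r.
  rewrite /fold1 sx mulNr mulrBr mulr1 -exprM -exprD spowM // spowN.
  by congr (_ + _); apply: (@eq_spow _ h (r%:Z + 1)); ring.
apply: (@bailey_limit_step R t ht 1 s (fun r => pent h r%:Z)
  (fun k => poch x t k.+1 / poch t t (k + k).+1)) => //.
- move=> n; have [_ <-] := qbsum_pent (qpow_neq1 ht) h0 (erefl t) n.
  under eq_bigr do rewrite halpha.
  by rewrite (qbsum_fold1 (qpow_neq1 ht)).
- exists 2 => r; rewrite halpha.
  apply: le_trans (nmD _ _) _; rewrite -[2]/(1 + 1) lerD //.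
    by apply: nm_spow_le1; [exact: ltW | nia].
  by apply: nm_spow_le1; [exact: ltW | nia].
- exact: (beta_bounded (fun k => (k + k).+1) (fun n => hB n.+1)).
(* With b = 1 the two halves of each joined term coincide, which explains the factor 1/2. *)
have := jacobi_triple_unfold (a := x ^+ 5) (b := 1) hp p0.
rewrite nm1 mulr1 => /(_ (ltW hp) (lexx _) (erefl _)) h1.
have := tendsM (tends_cst 2^-1) h1.
apply: eq_tends => n; rewrite mulr_sumr; apply: eq_bigr => r _; set m := nat_of_ord r.
have Es : (s * t) ^+ m = (-1) ^+ m * h ^+ (6 * m).
  by rewrite hs he -mulrA exprMn -exprD -exprM.
have Et : t ^+ 'C(m, 2) = h ^+ (4 * 'C(m, 2)) by rewrite -!exprM.
have hb := bin2Z m.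
have F1 : h ^+ (10 * 'C(m.+1, 2)) = pent h m * ((-1) ^+ m * h ^+ (6 * m) * h ^+ (4 * 'C(m, 2))).
  transitivity ((-1) ^+ m * (-1) ^+ m * (h ^ (m%:Z * (3 * m%:Z + 1)) * h ^+ (6 * m) * h ^+ (4 * 'C(m, 2)))).
    rewrite -exprMn mulrNN mulr1 expr1n mul1r !exprnP -!expfzDr //; congr (_ ^ _).
    by rewrite binS bin1; lia.
  by rewrite /pent /spow -exprnP; ring.
rewrite Es Et -F1 expr1n mulr1 -exprD !xpX binS bin1.
by field.
Qed.

End Pentagonal.

(** * Single sums from the pairs supported on even indices *)

Section EvenSums.
Variable t : C.
Hypotheses (t0 : t != 0) (ht : nm t < 1).
Local Notation p := (t ^+ 10).

Let hp : nm p < 1. Proof. exact: nm_pow_lt1. Qed.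
Let p0 : p != 0. Proof. by rewrite expf_neq0. Qed.

Let nt : nm t <= 1. Proof. exact: ltW. Qed.

Lemma evenw_double k : evenw t (k + k)%N%:Z = spow t k (3 * k%:Z ^+ 2 + k%:Z).
Proof. by rewrite -evenw_even; congr (evenw _ _); lia. Qed.

Lemma evenw_le1 r : nm (evenw t r) <= 1.
Proof.
have [k [->|->]] := parity_int r; last by rewrite evenw_odd nm0.
by rewrite evenw_even nm_spow_le1 // ; nia.
Qed.

Let beta_bounded (P : nat -> C) (f : nat -> nat) (B : R) : (forall n, nm (P n) <= B) ->
  exists K, forall n, nm (P n / poch t t (f n)) <= K.
Proof.
move=> hP; have [K K0 hK] := qqV_bounded ht; exists (B * K) => n.
by rewrite nmM ler_pM ?nm_ge0.
Qed.

Let weight_geo alpha K : (forall r, nm (alpha r) <= K) ->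
  geo_bounded (fun r => alpha r * (t ^+ r * t ^+ 'C(r, 2))).
Proof.
move=> hK; have [K' [r [? ? ? h]]] := geo_boundedM (quadratic_geo_bounded t ht) hK.
by exists K', r; split=> // k; apply: le_trans (h k); rewrite mulrC (mulrC (t ^+ k)).
Qed.

Let signX k m : (- t ^+ k) ^+ m = spow t m (k * m)%N%:Z.
Proof. by rewrite exprNn -exprM /spow -!exprnP. Qed.

Let pX m : p ^+ m = t ^+ (10 * m). Proof. by rewrite -exprM. Qed.

(** At each r one of the two folded weights vanishes: w(r) survives for even r, w(-r-1) for odd r.
    Consecutive indices therefore supply the two halves of a theta series of base t^10. *)
Lemma even_sum1 :
  tends (fun n => \sum_(k < n) bailey_weight t t t k * (poch (- t) t k / poch t t (k + k).+1))
   (qpoch_inf (t ^+ 7) p * qpoch_inf (t ^+ 3) p * qpoch_inf p p * qpoch_inf (- t) t / qpoch_inf t t).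
Proof.
have [B B0 hB] := poch_bounded ht (- t).
have nalpha r : nm (fold1 (evenw t) r) <= 2.
  by apply: le_trans (nmD _ _) _; rewrite -[2]/(1 + 1) lerD ?evenw_le1.
apply: (@bailey_limit_same R t ht 1 t (fold1 (evenw t))
  (fun k => poch (- t) t k / poch t t (k + k).+1)) => //.
- move=> n; rewrite (qbsum_fold1 (qpow_neq1 ht)).
  by have [_ ->] := qbsum_evenw (qpow_neq1 ht) t0 n.
- by exists 2.
- exact: (beta_bounded (fun k => (k + k).+1) hB).
apply: (tends_pairs (weight_geo nalpha)).
have := jacobi_triple_unfold (a := - t ^+ 7) (b := - t ^+ 3) hp p0.
rewrite !nmN !opprK mulrNN -exprD.
move=> /(_ (ltW (nm_pow_lt1 _ ht)) (ltW (nm_pow_lt1 _ ht)) (erefl _)).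
apply: eq_tends => n; apply: eq_bigr => r _; set m := nat_of_ord r.
have hb := bin2Z m; have hb1 := bin2Z m.+1.
have hb2 := bin2Z (m + m); have hb3 := bin2Z (m + m).+1.
have e1 : m.+1%:Z = m%:Z + 1 by lia.
have e2 : (m + m)%N%:Z = m%:Z + m%:Z by lia.
have e3 : (m + m).+1%:Z = m%:Z + m%:Z + 1 by lia.
rewrite !e1 in hb1; rewrite !e2 in hb2; rewrite !e3 in hb3.
rewrite /fold1 evenw_double (_ : - (m + m)%N%:Z - 1 = 2 * (- m%:Z - 1) + 1); last lia.
rewrite evenw_odd addr0 (_ : (m + m).+1%:Z = 2 * m%:Z + 1); last lia.
rewrite evenw_odd add0r (_ : - (2 * m%:Z + 1) - 1 = 2 * (- m%:Z - 1)); last lia.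
rewrite evenw_even !signX !pX ![t ^+ (10 * _) * _]mulrC !mulrA !spowM //.
congr (_ + _).
  by apply: (@eq_spow _ t 0); [ring | lia].
by apply: (@eq_spow _ t (m%:Z + 1)); lia.
Qed.

Lemma even_sum0 :
  tends (fun n => \sum_(k < n) bailey_weight t 1 t k * (poch (- t) t k / poch t t (k + k)))
   (2^-1 * (qpoch_inf (t ^+ 5) p * qpoch_inf (t ^+ 5) p * qpoch_inf p p) * qpoch_inf (- 1) t / qpoch_inf t t).
Proof.
have [B B0 hB] := poch_bounded ht (- t).
(* For b = 1 the factor 1 + t^r is 2 at r = 0, hence the value 1/2; for r > 0 it joins w(-r) to w(r)
   = t^r w(-r). *)
pose alpha r := if r is 0%N then 2^-1 else evenw t (- r%:Z).
have halpha r : alpha r * (1 + 1 * t ^+ r) = fold0 (evenw t) r.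
  rewrite mul1r /alpha /fold0; case: r => [|r].
    by rewrite expr0 /evenw /= /spow !mulr1 -[1 + 1]/(2%:R) mulVf // pnatr_eq0.
  have [k [e|e]] := parity_int r.+1%:Z; last first.
    rewrite e (_ : - (2 * k + 1) = 2 * (- k - 1) + 1); last ring.
    by rewrite !evenw_odd mul0r addr0.
  rewrite e (_ : - (2 * k) = 2 * - k); last ring.
  rewrite !evenw_even mulrDr mulr1 addrC spowM // e; congr (_ + _).
  by apply: (@eq_spow _ t (- k)); ring.
have nalpha r : nm (alpha r) <= 1.
  rewrite /alpha; case: r => [|r]; last exact: evenw_le1.
  rewrite nmV -[leRHS]invr1 lef_pV2 ?posrE ?nm_gt0 ?ltr01 ?pnatr_eq0 //.
  have : (1 : R)%:C%C <= (nm (2 : C))%:C%C by rewrite -normE normr_nat ler1n.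
  by rewrite lecR.
have nalpha2 r : nm (fold0 (evenw t) r) <= 2.
  rewrite /fold0; case: r => [|r]; first by apply: le_trans (evenw_le1 _) _; rewrite ler1n.
  by apply: le_trans (nmD _ _) _; rewrite -[2]/(1 + 1) lerD ?evenw_le1.
have h1t : (1 : C) * t = t by rewrite mul1r.
have := @bailey_limit_step R t ht 0 1 alpha (fun k => poch (- t) t k / poch t t (k + k)).
rewrite h1t; apply=> //.
- move=> n; under eq_bigr do rewrite halpha.
  rewrite (qbsum_fold0 (qpow_neq1 ht)).
  by have [-> _] := qbsum_evenw (qpow_neq1 ht) t0 n.
- by exists 2 => r; rewrite halpha.
- exact: (beta_bounded (fun k => (k + k)%N) hB).
apply: (tends_pairs (weight_geo nalpha)).
have := jacobi_triple (a := - t ^+ 5) (b := - t ^+ 5) hp p0.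
rewrite !nmN !opprK mulrNN -exprD.
move=> /(_ (ltW (nm_pow_lt1 _ ht)) (ltW (nm_pow_lt1 _ ht)) (erefl _)) h1.
have := tendsM (tends_cst 2^-1) h1.
apply: eq_tends => n; rewrite mulr_sumr; apply: eq_bigr => r _; set m := nat_of_ord r.
have -> : alpha (m + m).+1 = 0.
  by rewrite /alpha (_ : - _ = 2 * (- m%:Z - 1) + 1) ?evenw_odd //; lia.
rewrite mul0r addr0.
case: m => [|k]; first by rewrite /alpha /= !expr0 !mulr1.
rewrite /theta_term; set m := k.+1.
have -> : alpha (m + m)%N = evenw t (2 * - m%:Z).
  by rewrite /alpha addSn; congr (evenw _ _); lia.
have hb := bin2Z m; have hb2 := bin2Z (m + m).
have e2 : (m + m)%N%:Z = m%:Z + m%:Z by lia.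
rewrite !e2 in hb2.
rewrite evenw_even !signX !pX mulrA -mulr2n [_ * t ^+ (10 * _)]mulrC -mulr_natl.
rewrite [LHS](_ : _ = spow t m (5 * m)%N * t ^+ (10 * 'C(m, 2))); last first.
  by field.
rewrite mulrA !spowM //; apply: (@eq_spow _ t m%:Z); lia.
Qed.

(** For odd r the folded shifted weight is w(r-1) (1 - t^(2r)), and 1 + t^r splits off. The factor 1
    - t^k makes the term k = 0 vanish, so that the sum effectively starts at 1. *)
Lemma even_sum_shift :
  tends (fun n => \sum_(k < n) bailey_weight t 1 t k * ((1 - t ^+ k) * poch (- t) t k / poch t t (k + k)))
   (t * (qpoch_inf (t ^+ 9) p * qpoch_inf t p * qpoch_inf p p) * qpoch_inf (- 1) t / qpoch_inf t t).
Proof.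
have [B B0 hB] := poch_bounded ht (- t).
pose w r := evenw t (r - 1).
pose alpha r := evenw t (r%:Z - 1) * (1 - t ^+ r).
have halpha r : alpha r * (1 + 1 * t ^+ r) = fold0 w r.
  rewrite mul1r /alpha /fold0 /w -mulrA -subr_sqr expr1n; case: r => [|r].
    by rewrite expr0 expr1n subrr mulr0 (_ : 0 - 1 = 2 * (- 1) + 1) // evenw_odd.
  have [k [e|e]] := parity_int r.+1%:Z.
    rewrite e (_ : - (2 * k) - 1 = 2 * (- k - 1) + 1); last ring.
    rewrite (_ : 2 * k - 1 = 2 * (k - 1) + 1); last ring.
    by rewrite !evenw_odd mul0r addr0.
  rewrite e (_ : - (2 * k + 1) - 1 = 2 * (- k - 1)); last ring.
  rewrite addrK !evenw_even mulrBr mulr1 -exprM spowM // spowN; congr (_ + _).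
  rewrite (_ : (r.+1 * 2)%N%:Z = 2 * (2 * k + 1)); last lia.
  by apply: (@eq_spow _ t (k + 1)); ring.
have nalpha r : nm (alpha r) <= 2.
  rewrite nmM -[2]mul1r ler_pM ?nm_ge0 ?evenw_le1 //.
  apply: le_trans (nmD _ _) _; rewrite nmN nm1 nmX -[2]/(1 + 1) lerD //.
  by rewrite exprn_ile1 ?nm_ge0.
have nalpha2 r : nm (fold0 w r) <= 2.
  rewrite /fold0; case: r => [|r]; first by apply: le_trans (evenw_le1 _) _; rewrite ler1n.
  by apply: le_trans (nmD _ _) _; rewrite -[2]/(1 + 1) lerD ?evenw_le1.
have h1t : (1 : C) * t = t by rewrite mul1r.
have := @bailey_limit_step R t ht 0 1 alpha
  (fun k => (1 - t ^+ k) * poch (- t) t k / poch t t (k + k)).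
rewrite h1t; apply=> //.
- move=> n; under eq_bigr do rewrite halpha.
  rewrite (qbsum_fold0 (qpow_neq1 ht)).
  by rewrite -(qbsum_evenw_shift (qpow_neq1 ht) t0 n).
- by exists 2 => r; rewrite halpha.
- apply: (@beta_bounded _ _ (2 * B)) => n; rewrite nmM ler_pM ?nm_ge0 //.
  apply: le_trans (nmD _ _) _; rewrite nmN nm1 nmX -[2]/(1 + 1) lerD //.
  by rewrite exprn_ile1 ?nm_ge0.
apply: (tends_pairs (weight_geo nalpha)).
have := jacobi_triple_unfold (a := - t ^+ 9) (b := - t ^+ 1) hp p0.
rewrite !nmN !opprK mulrNN -exprD.
move=> /(_ (ltW (nm_pow_lt1 _ ht)) (ltW (nm_pow_lt1 _ ht)) (erefl _)) h1.
have := tendsM (tends_cst t) h1; rewrite expr1.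
apply: eq_tends => n; rewrite mulr_sumr; apply: eq_bigr => r _; set m := nat_of_ord r.
have -> : alpha (m + m)%N = 0.
  by rewrite /alpha (_ : _ - 1 = 2 * (m%:Z - 1) + 1) ?evenw_odd ?mul0r //; lia.
rewrite mul0r add0r /alpha (_ : (m + m).+1%:Z - 1 = 2 * m%:Z); last lia.
have hb := bin2Z m; have hb1 := bin2Z m.+1; have hb3 := bin2Z (m + m).+1.
have e1 : m.+1%:Z = m%:Z + 1 by lia.
have e3 : (m + m).+1%:Z = m%:Z + m%:Z + 1 by lia.
rewrite !e1 in hb1; rewrite !e3 in hb3.
rewrite -[X in (- X) ^+ m.+1]expr1 evenw_even !signX !pX.
set e := 3 * m%:Z ^+ 2 + m%:Z; set M := (m + m).+1.
have F1 : spow t m (9 * m)%N * t ^+ (10 * 'C(m, 2)) * t ^+ 1 = spow t m e * t ^+ M * t ^+ 'C(M, 2).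
  by rewrite !spowM //; apply: (@eq_spow _ t 0); rewrite /e /M; [ring | lia].
have F2 : spow t m.+1 (1 * m.+1)%N * t ^+ (10 * 'C(m.+1, 2)) * t ^+ 1 =
    - (spow t m e * t ^+ M * t ^+ 'C(M, 2) * t ^+ M).
  by rewrite !spowM // spowN; apply: (@eq_spow _ t 0); rewrite /e /M; [lia | lia].
rewrite expr1 in F1 F2.
exact: theta_combine_fold F1 F2.
Qed.

End EvenSums.
End SingleSums.

(** * Identities between infinite products *)

Section ProductMonomials.
Variable R : realType.
Local Notation C := (Cplx R).

Lemma tends_prod (I : Type) (s : seq I) (u : I -> nat -> C) (l : I -> C) :
  (forall i, tends (u i) (l i)) -> tends (fun n => \prod_(i <- s) u i n) (\prod_(i <- s) l i).
Proof.
move=> h; elim: s => [|i s IH].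
  by rewrite big_nil; apply: eq_tends (tends_cst 1) => n; rewrite big_nil.
by rewrite big_cons; apply: eq_tends (tendsM (h i) IH) => n; rewrite big_cons.
Qed.

Lemma qpoch_inf_dissect (a p : C) k : nm p < 1 ->
  qpoch_inf a p = \prod_(i <- iota 0 k.+1) qpoch_inf (a * p ^+ i) (p ^+ k.+1).
Proof.
move=> hp.
have h1 := tends_sub (f := fun n => (k.+1 * n)%N) (fun n => leq_pmull n (ltn0Sn k)) (qpoch_tends a hp).
apply: (tends_uniq h1).
have := tends_prod (iota 0 k.+1) (fun i => qpoch_tends (a * p ^+ i) (nm_pow_lt1 k hp)).
apply: eq_tends => n; elim: n => [|n IH].
  by rewrite muln0 [RHS]big_ord0 big1 // => i _; exact: big_ord0.
rewrite mulnS addnC [RHS](pochD a p) -[poch a p (k.+1 * n)]IH.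
rewrite [poch _ p k.+1](_ : _ = \prod_(i <- iota 0 k.+1) (1 - a * p ^+ i * (p ^+ k.+1) ^+ n)).
  by rewrite -big_split /=; apply: eq_bigr => i _; rewrite qpochS.
rewrite /poch -(big_mkord xpredT (fun i => 1 - a * p ^+ (k.+1 * n) * p ^+ i)) /index_iota subn0.
by apply: eq_bigr => i _; rewrite exprM mulrAC.
Qed.

Lemma qpoch_inf_opp (a p : C) : nm p < 1 -> (forall n, 1 - a * p ^+ n != 0) ->
  qpoch_inf (- a) p = qpoch_inf (a ^+ 2) (p ^+ 2) / qpoch_inf a p.
Proof.
move=> hp ha; apply: (canRL (mulfK (qpoch_inf_neq0 hp ha))).
apply: (tends_uniq (tendsM (qpoch_tends (- a) hp) (qpoch_tends a hp))).
by apply: eq_tends (qpoch_tends (a ^+ 2) (nm_pow_lt1 1 hp)) => n; rewrite mulrC -[LHS](poch_sqr a p n).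
Qed.

Variable q : C.
Hypothesis hq : nm q < 1.

Definition qprod a m := qpoch_inf (q ^+ a) (q ^+ m).

Lemma J_qprod m : J m q = qprod m m. Proof. by []. Qed.

Lemma J2_qprod r m : J2 r m q = qprod r m * (qprod (m - r) m * qprod m m).
Proof. by rewrite /J2 /qpochs_inf !big_cons big_nil mulr1. Qed.

Lemma qprod_base_neq1 a m n : 1 - q ^+ a.+1 * (q ^+ m) ^+ n != 0.
Proof. by rewrite -exprM -exprD addSn qpow_neq1. Qed.

Lemma qprod_neq0 a m : qprod a.+1 m.+1 != 0.
Proof. exact: qpoch_inf_neq0 (nm_pow_lt1 _ hq) (qprod_base_neq1 _ _). Qed.

Lemma qprod_opp a m : qpoch_inf (- q ^+ a.+1) (q ^+ m.+1) = qprod (2 * a.+1) (2 * m.+1) / qprod a.+1 m.+1.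
Proof.
rewrite qpoch_inf_opp; last exact: qprod_base_neq1.
  by rewrite -!exprM /qprod ![(2 * _)%N]mulnC.
exact: nm_pow_lt1.
Qed.

(* [atoms s] is the product of (q^n; q^80)_oo over the list [s] of (n - 1). *)
Definition atoms (s : seq nat) := \prod_(n <- s) qprod n.+1 80.

(** All moduli involved divide 80, so each product is described by two lists of residues; an
    identity then follows once explicit lists of numbers are permutations of each other, which is
    decided by computation. *)
Definition is_ratio (x : C) (n d : seq nat) := x = atoms n / atoms d.

Lemma atoms_cat s1 s2 : atoms (s1 ++ s2) = atoms s1 * atoms s2.
Proof. exact: big_cat. Qed.

Lemma atoms_neq0 s : atoms s != 0.
Proof. by rewrite /atoms prodf_seq_neq0; apply/allP => n _; exact: qprod_neq0. Qed.

Lemma ratioM x y n d n' d' : is_ratio x n d -> is_ratio y n' d' -> is_ratio (x * y) (n ++ n') (d ++ d').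
Proof.
by move=> -> ->; rewrite /is_ratio !atoms_cat; field; rewrite !atoms_neq0.
Qed.

Lemma ratioV x n d : is_ratio x n d -> is_ratio x^-1 d n.
Proof. by move=> ->; rewrite /is_ratio invf_div. Qed.

Lemma ratioX x n d k : is_ratio x n d -> is_ratio (x ^+ k) (flatten (nseq k n)) (flatten (nseq k d)).
Proof.
move=> h; elim: k => [|k IH]; last by rewrite exprS; apply: ratioM.
by rewrite /is_ratio /atoms big_nil expr0 divr1.
Qed.

Lemma ratio_qprod a m : (0 < a)%N -> (0 < m)%N -> (m * (80 %/ m) == 80)%N ->
  is_ratio (qprod a m) [seq (a.-1 + m * j)%N | j <- iota 0 (80 %/ m)] [::].
Proof.
case: a => // a _; case: m => // m _ /eqP; case: (80 %/ m.+1)%N => [|k] e.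
  by rewrite muln0 in e.
rewrite /is_ratio /atoms big_nil divr1 big_map /qprod.
rewrite (qpoch_inf_dissect _ k (nm_pow_lt1 m hq)).
by apply: eq_bigr => j _; rewrite -(exprM q m.+1 k.+1) e -exprM -exprD addSn.
Qed.

Lemma ratio_J m : (0 < m)%N -> (m * (80 %/ m) == 80)%N ->
  is_ratio (J m q) [seq (m.-1 + m * j)%N | j <- iota 0 (80 %/ m)] [::].
Proof. by move=> m0 hm; rewrite J_qprod; apply: ratio_qprod. Qed.

Lemma ratio_J2 r m : (0 < r)%N -> (r < m)%N -> (m * (80 %/ m) == 80)%N ->
  is_ratio (J2 r m q)
    ([seq (r.-1 + m * j)%N | j <- iota 0 (80 %/ m)] ++
     ([seq ((m - r).-1 + m * j)%N | j <- iota 0 (80 %/ m)] ++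
      [seq (m.-1 + m * j)%N | j <- iota 0 (80 %/ m)])) [::].
Proof.
move=> r0 rm hm; rewrite J2_qprod.
have m0 : (0 < m)%N by apply: leq_ltn_trans rm.
have mr : (0 < m - r)%N by rewrite subn_gt0.
exact: (ratioM (ratio_qprod r0 m0 hm) (ratioM (ratio_qprod mr m0 hm) (ratio_qprod m0 m0 hm))).
Qed.

Lemma ratio_eq x y n d n' d' : is_ratio x n d -> is_ratio y n' d' ->
  perm_eq (n ++ d') (n' ++ d) -> x = y.
Proof.
move=> -> -> h; apply/eqP; rewrite eqr_div ?atoms_neq0 // -!atoms_cat.
by rewrite /atoms (perm_big _ h).
Qed.

(** The product (-q^a;q^m)_oo for positive a and m, in a form that the tactic [ratio] can
    decompose. *)
Definition nqprod a m := qprod (2 * a) (2 * m) / qprod a m.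

End ProductMonomials.

Ltac ratio hq := lazymatch goal with
  | |- is_ratio _ (_ * _) _ _ => refine (ratioM hq _ _); ratio hq
  | |- is_ratio _ (_ ^-1) _ _ => refine (ratioV _); ratio hq
  | |- is_ratio _ (_ ^+ _) _ _ => refine (ratioX hq _ _); ratio hq
  | |- is_ratio _ (J2 _ _ _) _ _ => refine (ratio_J2 hq _ _ _); by []
  | |- is_ratio _ (J _ _) _ _ => refine (ratio_J hq _ _); by []
  | |- is_ratio _ (qprod _ _ _) _ _ => refine (ratio_qprod hq _ _ _); by []
  end.
Ltac ratio_eq hq := rewrite /nqprod;
  refine (ratio_eq hq _ _ _); [ratio hq | ratio hq | by vm_compute].

Section ProductIdentities.
Variable R : realType.
Local Notation C := (Cplx R).
Variable q : C.
Hypothesis hq : nm q < 1.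
Local Notation P := (qprod q).
Local Notation M := (nqprod q).

Lemma product_id1 :
  M 4 4 * (P 3 5 * P 2 5 * P 5 5 * M 1 2 / P 2 2)
  = J2 2 8 q * J 10 q ^+ 2 * J2 2 20 q / (J 2 q * J 20 q * J2 1 10 q * J2 4 20 q).
Proof. ratio_eq hq. Qed.

(** The quotient J_40^5 / (q^20;q^40)_oo stands for J_40^(11/2) / J_{20,40}^(1/2); see
    [half_power_ratio]. *)
Lemma product_id3 :
  M 4 4 * (P 4 5 * P 1 5 * P 5 5 * M 1 2 / P 2 2)
  = J 40 q ^+ 5 / P 20 40 * (J2 6 40 q * J2 10 40 q * J2 14 40 q
   / (J2 3 40 q * J2 4 40 q * J2 7 40 q * J2 8 40 q
                 * J2 12 40 q ^+ 2 * J2 13 40 q * J2 17 40 q)).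
Proof. ratio_eq hq. Qed.

Lemma product_id2_even :
  M 4 8 ^+ 2 * ((P 12 40 * M 32 40) * (M 8 40 * P 28 40) * (M 20 40 * P 40 40) * M 4 8 / P 8 8)
  = J 80 q ^+ 11 * J2 8 80 q * J2 24 80 q ^+ 2 * J2 40 80 q ^+ 2
           / (J2 4 80 q ^+ 3 * J2 12 80 q ^+ 2 * J2 20 80 q ^+ 4
              * J2 28 80 q ^+ 2 * J2 32 80 q ^+ 2 * J2 36 80 q ^+ 3).
Proof. ratio_eq hq. Qed.

Lemma product_id2_odd :
  M 8 8 ^+ 2 * (P 56 80 * P 24 80 * P 80 80 * M 8 8 / P 8 8)
  = J 80 q ^+ 11
            / (J2 8 80 q ^+ 4 * J2 16 80 q * J2 24 80 q ^+ 3
               * J2 32 80 q * J2 40 80 q ^+ 2).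
Proof. ratio_eq hq. Qed.

Lemma product_id4_even :
  M 8 8 ^+ 2 * (P 40 80 * P 40 80 * P 80 80 * M 8 8 / P 8 8)
  = J 80 q ^+ 11
              / (J2 8 80 q ^+ 4 * J2 16 80 q * J2 24 80 q ^+ 4
                 * J2 32 80 q * J2 40 80 q).
Proof. ratio_eq hq. Qed.

Lemma product_id4_odd :
  M 4 8 ^+ 2 * ((P 20 40 * M 40 40) * (M 40 40 * P 20 40) * (M 20 40 * P 40 40) * M 4 8 / P 8 8)
  = J 80 q ^+ 11 * J2 8 80 q ^+ 2 * J2 24 80 q ^+ 2 * J2 40 80 q
            / (J2 4 80 q ^+ 3 * J2 12 80 q ^+ 3 * J2 16 80 q
               * J2 20 80 q ^+ 2 * J2 28 80 q ^+ 3 * J2 32 80 q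
               * J2 36 80 q ^+ 3).
Proof. ratio_eq hq. Qed.

Lemma product_id5_even :
  M 4 8 ^+ 2 * ((M 16 40 * P 36 40) * (P 4 40 * M 24 40) * (M 20 40 * P 40 40) * M 4 8 / P 8 8)
  = J2 8 80 q ^+ 2 * J 80 q ^+ 11 * J2 24 80 q * J2 40 80 q ^+ 2
           / (J2 4 80 q ^+ 2 * J2 12 80 q ^+ 3 * J2 16 80 q ^+ 2
              * J2 20 80 q ^+ 4 * J2 28 80 q ^+ 3 * J2 36 80 q ^+ 2).
Proof. ratio_eq hq. Qed.

Lemma product_id5_odd :
  M 8 8 ^+ 2 * (P 72 80 * P 8 80 * P 80 80 * M 8 8 / P 8 8)
  = J 80 q ^+ 11
            / (J2 8 80 q ^+ 3 * J2 16 80 q * J2 24 80 q ^+ 4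
               * J2 32 80 q * J2 40 80 q ^+ 2).
Proof. ratio_eq hq. Qed.

Lemma qprod_opp_nqprod a m : (0 < a)%N -> (0 < m)%N -> qpoch_inf (- q ^+ a) (q ^+ m) = M a m.
Proof. by case: a => // a _; case: m => // m _; rewrite qprod_opp. Qed.

(* The base [- q ^+ m] is split into its even and odd parts. *)
Lemma qpoch_inf_opp_base (z : C) m : (0 < m)%N ->
  qpoch_inf z (- q ^+ m) = qpoch_inf z (q ^+ (2 * m)) * qpoch_inf (- (z * q ^+ m)) (q ^+ (2 * m)).
Proof.
case: m => // m _; have hm : nm (- q ^+ m.+1) < 1 by rewrite nmN nm_pow_lt1.
rewrite (qpoch_inf_dissect _ 1 hm) big_cons big_seq1 expr0 mulr1 expr1 mulrN.
by rewrite sqrrN -exprM mulnC.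
Qed.

End ProductIdentities.

(** * Half-integer powers *)

Section HalfPowers.
Variable R : realType.
Local Notation C := (Cplx R).
Implicit Types (q x : C).

(* The Taylor coefficients of (1 - x)^(1/2). *)
Definition sqrt_coef (j : nat) : R := \prod_(i < j) ((i%:R - 2^-1) / i.+1%:R).

Lemma sqrt_coefS j : j.+1%:R * sqrt_coef j.+1 = (j%:R - 2^-1) * sqrt_coef j.
Proof. by rewrite /sqrt_coef big_ord_recr /=; field. Qed.

Lemma sqrt_coef_le1 j : `|sqrt_coef j| <= 1.
Proof.
elim: j => [|j IH]; first by rewrite /sqrt_coef big_ord0 normr1.
rewrite /sqrt_coef big_ord_recr /= normrM mulr_ile1 // normrM normfV.
rewrite ler_pdivrMr ?normr_gt0 // mul1r [leRHS]ger0_norm // ler_norml.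
have : (0 : R) <= j%:R by []. rewrite -natr1; lra.
Qed.

(** The square f of the series satisfies (1 - x) f' = -f. On coefficients, the symmetry of the
    convolution and [sqrt_coefS] give (m+1) d(m+1) = (m-1) d(m), which vanishes at m = 1 and kills
    every later coefficient. *)
Lemma sqrt_coef_conv n : \sum_(i < n.+1) sqrt_coef i * sqrt_coef (n - i)%N =
  if n is 0%N then 1 else if n is 1%N then -1 else 0.
Proof.
pose d n := \sum_(i < n.+1) sqrt_coef i * sqrt_coef (n - i)%N.
have sym m : m%:R * d m = 2 * \sum_(i < m.+1) i%:R * sqrt_coef i * sqrt_coef (m - i)%N.
  have e : \sum_(i < m.+1) i%:R * sqrt_coef i * sqrt_coef (m - i)%N =
      \sum_(i < m.+1) (m - i)%:R * sqrt_coef i * sqrt_coef (m - i)%N.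
    rewrite (reindex_inj rev_ord_inj); apply: eq_bigr => i _ /=; rewrite subSS.
    by rewrite subKn ?leq_ord // mulrAC.
  rewrite -[2]/(1 + 1) mulrDl mul1r {2}e -big_split /= /d mulr_sumr; apply: eq_bigr => i _.
  by rewrite natrB ?leq_ord //; ring.
have rec m : m.+1%:R * d m.+1 = (m%:R - 1) * d m.
  rewrite sym big_ord_recl mul0r mul0r add0r mulrBl sym mul1r /d.
  rewrite !mulr_sumr -sumrB; apply: eq_bigr => i _ /=.
  by rewrite /bump leq0n add1n subSS sqrt_coefS; field.
have d0 : d 0%N = 1 by rewrite /d big_ord1 /sqrt_coef big_ord0 mulr1.
have d1 : d 1%N = -1 by have := rec 0%N; rewrite d0 mul1r sub0r mulr1.
rewrite -/(d n); case: n => [|[|n]] //; elim: n => [|n IH].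
  by have := rec 1%N; rewrite subrr mul0r => /eqP; rewrite mulf_eq0 pnatr_eq0 /= => /eqP.
by have := rec n.+2; rewrite IH mulr0 => /eqP; rewrite mulf_eq0 pnatr_eq0 /= => /eqP.
Qed.

Lemma nm_real (a : R) : nm (a%:C%C : C) = `|a|.
Proof. by rewrite /nm /= expr0n /= addr0 sqrtr_sqr. Qed.

Local Notation b j := ((sqrt_coef j)%:C%C : C).

Lemma nm_coef_le1 j : nm (b j) <= 1.
Proof. by rewrite nm_real sqrt_coef_le1. Qed.

(** Defined by its series instead of [sqrtC], because the branch sought has to be a power series. *)
Definition sqrt1m x : C := lim ((fun n => \sum_(k < n) b k * x ^+ k) @ \oo).

Lemma geo_bounded_pow (c : nat -> C) K x : nm x < 1 -> (forall k, nm (c k) <= K) ->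
  geo_bounded (fun k => c k * x ^+ k).
Proof.
move=> hx hc; have K0 := le_trans (nm_ge0 _) (hc 0%N).
exists K, (nm x); split=> //; first exact: nm_ge0.
by move=> k; rewrite nmM nmX ler_wpM2r ?exprn_ge0 ?nm_ge0.
Qed.

Lemma sqrt1m_tends x : nm x < 1 -> tends (fun n => \sum_(k < n) b k * x ^+ k) (sqrt1m x).
Proof.
move=> hx; have [l hl] := geo_tends (geo_bounded_pow hx nm_coef_le1).
by constructor; case: hl => hl; apply: (cvgP _ hl).
Qed.

Lemma cauchy_product (a c : nat -> C) A B : geo_bounded a ->
  tends (fun n => \sum_(k < n) a k) A -> tends (fun n => \sum_(k < n) c k) B ->
  tends (fun n => \sum_(k < n) \sum_(i < k.+1) a i * c (k - i)%N) (A * B).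
Proof.
move=> ga hA hB; have [K K0 hK] := tends_bounded hB.
have h : tends (fun n => \sum_(i < n) a i * \sum_(j < n - i) c j) (A * B).
  apply/(weighted_limit (W := fun n i => \sum_(j < n - i) c j) (g := fun=> B) (B := K)) => //.
    by move=> i; apply: (tends_subn i hB).
  by apply: eq_tends (tendsM hA (tends_cst B)) => n; rewrite mulr_suml.
apply: eq_tends h => n.
elim: n => [|n IH]; first by rewrite !big_ord0.
rewrite [RHS]big_ord_recr /= -IH !big_ord_recr /= subSnn big_ord1 subnn addrA; congr (_ + _).
rewrite -big_split /=; apply: eq_bigr => i _.
by rewrite -mulrDr subSn ?big_ord_recr //= ltnW.
Qed.

Lemma sqrt1m_sqr x : nm x < 1 -> sqrt1m x ^+ 2 = 1 - x.
Proof.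
move=> hx; have h := sqrt1m_tends hx.
have g := geo_bounded_pow hx nm_coef_le1.
apply: (tends_uniq (tends_shift 2 (cauchy_product (c := fun k => b k * x ^+ k) g h h))).
apply: (eq_tends (u := fun=> 1 - x)) (tends_cst _) => n.
have e k : \sum_(i < k.+1) b i * x ^+ i * (b (k - i)%N * x ^+ (k - i)) =
   (if k is 0%N then 1 else if k is 1%N then -1 else 0)%:C%C * x ^+ k.
  rewrite -sqrt_coef_conv rmorph_sum /= mulr_suml; apply: eq_bigr => i _.
  by rewrite mulrACA -exprD subnKC ?leq_ord // rmorphM.
transitivity (\sum_(k < n.+2) (if nat_of_ord k is 0%N then 1
   else if nat_of_ord k is 1%N then -1 else 0 : R)%:C%C * x ^+ k).
  rewrite big_ord_recl big_ord_recl big1 => [|i _]; last by rewrite /= mul0r.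
  by rewrite /= expr0 expr1 addr0 mulr1 rmorphN rmorph1 mulN1r.
by rewrite addn2; apply: eq_bigr => k _; rewrite -e.
Qed.

Section HalfProduct.
Variable m : nat -> nat.
Hypothesis hm : forall n, (n < m n)%N.

(* Coefficient of q^k in the product of (1 - q^(m i))^(1/2) over i < n. *)
Fixpoint half_coef (n k : nat) : C := if n is n'.+1 then
  \sum_(j < k.+1 | (m n' * j <= k)%N) b j * half_coef n' (k - m n' * j)%N else (k == 0%N)%:R.

Lemma half_coef0 k : half_coef 0 k = (k == 0%N)%:R. Proof. by []. Qed.

Lemma half_coefS n k : half_coef n.+1 k =
  \sum_(j < k.+1 | (m n * j <= k)%N) b j * half_coef n (k - m n * j)%N.
Proof. by []. Qed.

(** As m(n) > n, multiplying by the factor of index n changes no coefficient of degree at most n.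
    The diagonal [half_coef k k] is thus the coefficient of the infinite product. *)
Lemma half_coef_stable n k : (k <= n)%N -> half_coef n k = half_coef k k.
Proof.
elim: n => [|n IH]; first by rewrite leqn0 => /eqP->.
rewrite leq_eqVlt => /orP[/eqP-> //|]; rewrite ltnS => hk.
rewrite -(IH hk) half_coefS big_mkcond big_ord_recl muln0 leq0n subn0 big1 => [|j _].
  by rewrite [LHS]addr0 /sqrt_coef big_ord0 mul1r.
by rewrite /= /bump leq0n add1n ifF //; apply/negbTE; rewrite -ltnNge; have := hm n; nia.
Qed.

(** The coefficients of (1 - x)^(1/2) have modulus at most 1, so each factor is dominated by 1/(1 -
    x); moreover r^(m(n)) <= r^(n+1). *)
Lemma half_coef_norm_sum (r : R) n N : 0 <= r -> r < 1 ->
  \sum_(k < N) nm (half_coef n k) * r ^+ k <= \prod_(i < n) (1 - r ^+ i.+1)^-1.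
Proof.
move=> r0 r1; elim: n => [|n IH].
  rewrite big_ord0; case: N => [|N]; first by rewrite big_ord0.
  rewrite big_ord_recl half_coef0 nm1 expr0 mulr1 big1 ?addr0 // => i _.
  by rewrite half_coef0 -[_%:R]/(0 : C) nm0 mul0r.
pose F k := nm (half_coef n k) * r ^+ k.
have F0 k : 0 <= F k by rewrite mulr_ge0 ?nm_ge0 ?exprn_ge0.
have step (k : 'I_N) : nm (half_coef n.+1 k) * r ^+ k <=
    \sum_(j < N | (m n * j <= k)%N) r ^+ (m n * j) * F (k - m n * j)%N.
  rewrite /= (big_ord_widen_cond N (fun j => (m n * j <= k)%N)
    (fun j => b j * half_coef n (k - m n * j)%N)) //.
  rewrite [X in nm X](eq_bigl (fun j : 'I_N => (m n * j <= k)%N)); last first.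
    by move=> j /=; apply/andb_idr => h; have := hm n; nia.
  apply: (@le_trans _ _ (\sum_(j < N | (m n * j <= k)%N) nm (half_coef n (k - m n * j)%N) * r ^+ k)).
    rewrite -mulr_suml ler_wpM2r ?exprn_ge0 //.
    elim/big_ind2: _ => [|x1 x2 y1 y2 h1 h2|j _]; first by rewrite nm0.
      by apply: le_trans (nmD _ _) (lerD h1 h2).
    by rewrite nmM ler_piMl ?nm_ge0 ?nm_coef_le1.
  apply: ler_sum => j hj; rewrite /F mulrCA -exprD subnKC //.
apply: le_trans (ler_sum _ (fun k _ => step k)) _.
rewrite (exchange_big_dep xpredT) //= big_ord_recr /= mulrC.
have hr : r ^+ m n <= r ^+ n.+1 by apply: ler_wiXn2l; rewrite // ltW.
have hrn : r ^+ n.+1 < 1 by rewrite exprn_ilt1.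
have S0 : 0 <= \sum_(k < N) F k by apply: sumr_ge0.
apply: (@le_trans _ _ (\sum_(j < N) (r ^+ n.+1) ^+ j * \sum_(k < N) F k)).
  apply: ler_sum => j _; rewrite -mulr_sumr ler_pM ?exprn_ge0 ?sumr_ge0 //.
    by rewrite exprM lerXn2r ?nnegrE ?exprn_ge0.
  case: (leqP (m n * j) N) => hN; last first.
    rewrite big1 // => k; have := ltn_ord k; lia.
  rewrite -(big_geq_mkord _ N xpredT (fun k => F (k - m n * j)%N)).
  rewrite -{1}[(m n * j)%N]add0n big_addn big_mkord.
  rewrite (eq_bigr (fun k : 'I_(N - m n * j) => F k)); last by move=> k _; rewrite addnK.
  rewrite (big_ord_widen N F (leq_subr _ _)) [leRHS](bigID (fun k : 'I_N => (k < N - m n * j)%N)) /=.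
  by rewrite lerDl sumr_ge0.
rewrite -mulr_suml ler_pM ?sumr_ge0 // => [j _|]; first by rewrite exprn_ge0 ?exprn_ge0.
have := geo_tail 0 N (exprn_ge0 n.+1 r0) hrn; rewrite expr0 div1r.
by under eq_bigr do rewrite add0n.
Qed.

Lemma half_coef_bounded (r : R) : 0 <= r -> r < 1 ->
  exists2 K, 0 <= K & forall n k, nm (half_coef n k) * r ^+ k <= K.
Proof.
move=> r0 r1; have d : 0 < 1 - r by rewrite subr_gt0.
(* Each 1/(1 - r^(n+1)) is at most 1 + r^n/(1 - r), and [poch_prod_le] bounds the product of these
   independently of n. *)
exists (expR ((1 - r)^-1 / (1 - r))) => [|n k]; first exact: expR_ge0.
apply: (@le_trans _ _ (\sum_(i < k.+1) nm (half_coef n i) * r ^+ i)).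
  rewrite big_ord_recr /= lerDr sumr_ge0 // => i _.
  by rewrite mulr_ge0 ?nm_ge0 ?exprn_ge0.
apply: le_trans (half_coef_norm_sum _ _ r0 r1) _.
apply: le_trans _ (poch_prod_le n (_ : 0 <= (1 - r)^-1) r0 r1); last by rewrite invr_ge0 ltW.
elim: n => [|n IH]; first by rewrite !big_ord0.
have hr : r ^+ n.+1 <= r by rewrite exprS ler_piMr // exprn_ile1 // ltW.
have d' : 0 < 1 - r ^+ n.+1 by rewrite subr_gt0 (le_lt_trans hr).
rewrite !big_ord_recr /= ler_pM ?invr_ge0 ?(ltW d') //.
  by rewrite prodr_ge0 // => i _; rewrite invr_ge0 subr_ge0 exprn_ile1 // ltW.
rewrite -[leLHS]mul1r ler_pdivrMr //.
have h1 : 1 <= (1 - r)^-1 by rewrite invf_ge1 // gerBl.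
have h2 : r ^+ n.+1 <= r ^+ n by rewrite exprS ler_piMl ?exprn_ge0 // ltW.
set u := (1 - r)^-1; set v := r ^+ n; set w := r ^+ n.+1.
have uw : u * (1 - w) >= 1.
  have u1 : u * (1 - r) = 1 by rewrite /u mulVf ?lt0r_neq0.
  have u0 : 0 <= u by rewrite /u invr_ge0 ltW.
  have rw0 : 0 <= r - w by rewrite subr_ge0.
  have := mulr_ge0 u0 rw0; nra.
have v0 : 0 <= v by rewrite exprn_ge0.
have := ler_wpM2l v0 uw; rewrite mulr1 => h3.
have h4 : w <= v := h2; move: h3 h4 uw; clearbody u v w; lra.
Qed.

Lemma half_coef_geo q : nm q < 1 ->
  exists K r, [/\ 0 <= K, 0 <= r, r < 1 & forall n k, nm (half_coef n k * q ^+ k) <= K * r ^+ k].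
Proof.
(* Boundedness at a radius strictly between |q| and 1 becomes geometric decay at q. *)
move=> hq; pose r' := (1 + nm q) / 2; have q0 := nm_ge0 q.
have r0 : 0 < r' by rewrite /r'; lra.
have r1 : r' < 1 by rewrite /r'; lra.
have [K K0 hK] := half_coef_bounded (ltW r0) r1.
exists K, (nm q / r'); split=> //.
- by rewrite divr_ge0 // ltW.
- rewrite ltr_pdivrMr // mul1r /r'; lra.
- move=> n k; rewrite nmM nmX expr_div_n mulrA ler_pdivlMr ?exprn_gt0 //.
  by rewrite mulrAC ler_wpM2r ?exprn_ge0.
Qed.

Definition half_product q n := \prod_(i < n) sqrt1m (q ^+ m i).

Lemma half_coef_tends q n : nm q < 1 ->
  tends (fun N => \sum_(k < N) half_coef n k * q ^+ k) (half_product q n).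
Proof.
move=> hq; elim: n => [|n IH].
  rewrite /half_product big_ord0; apply: tends_unshift.
  apply: (eq_tends (u := fun=> 1)) (tends_cst _) => N.
  by rewrite big_ord_recl half_coef0 mul1r expr0 big1 ?addr0 // => i _; rewrite mul0r.
rewrite /half_product big_ord_recr /= -/(half_product q n) mulrC.
have [M hM] : exists M, m n = M.+1 by case: (m n) (hm n) => // M _; exists M.
have hqm : nm (q ^+ m n) < 1 by rewrite hM nm_pow_lt1.
have [K K0 hK] := tends_bounded IH.
have h : tends (fun N => \sum_(j < N) b j * (q ^+ m n) ^+ j *
    \sum_(k < N - m n * j) half_coef n k * q ^+ k) (sqrt1m (q ^+ m n) * half_product q n).
  apply/(weighted_limit (W := fun N j => \sum_(k < N - m n * j) half_coef n k * q ^+ k)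
    (g := fun=> half_product q n) (B := K) _ (geo_bounded_pow hqm nm_coef_le1)) => //.
    by move=> j; apply: (tends_subn (m n * j) IH).
  by apply: eq_tends (tendsM (sqrt1m_tends hqm) (tends_cst (half_product q n))) => N; rewrite mulr_suml.
apply: eq_tends h => N.
transitivity (\sum_(k < N) \sum_(j < N | (m n * j <= k)%N)
   b j * (q ^+ m n) ^+ j * (half_coef n (k - m n * j)%N * q ^+ (k - m n * j))); last first.
  apply: eq_bigr => k _; rewrite /= mulr_suml.
  rewrite (big_ord_widen_cond N (fun j => (m n * j <= k)%N)
    (fun j => b j * half_coef n (k - m n * j)%N * q ^+ k)) //.
  apply: eq_big => [j|j hj].
    by apply/esym/andb_idr => h; have := hm n; nia.
  by rewrite mulrACA -exprM -exprD subnKC.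
rewrite [RHS](exchange_big_dep xpredT) //=; apply: eq_bigr => j _.
rewrite -mulr_sumr; congr (_ * _).
case: (leqP (m n * j) N) => hN; last first.
  rewrite (_ : (N - m n * j)%N = 0%N) ?big_ord0; last lia.
  by rewrite big1 // => k; have := ltn_ord k; lia.
rewrite -(big_geq_mkord _ N xpredT (fun k => half_coef n (k - m n * j)%N * q ^+ (k - m n * j))).
rewrite -[X in \sum_(X <= _ < _) _]add0n big_addn big_mkord.
by apply: eq_bigr => k _; rewrite addnK.
Qed.

(** The first n coefficients of the n-th partial product are already final, so it differs from the
    truncated series by a tail of size K r^n / (1 - r), with [K] and [r] independent of n. *)
Theorem half_product_series q : nm q < 1 -> exists G,
  tends (fun n => \sum_(k < n) half_coef k k * q ^+ k) G /\ tends (half_product q) G.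
Proof.
move=> hq; have [K [r [K0 r0 r1 hK]]] := half_coef_geo hq.
have [G hG] : exists G, tends (fun n => \sum_(k < n) half_coef k k * q ^+ k) G.
  by apply: (geo_tends (u := fun k => half_coef k k * q ^+ k)); exists K, r; split.
exists G; split=> //.
have d : 0 < 1 - r by rewrite subr_gt0.
suff h : tends (fun n => half_product q n - \sum_(k < n) half_coef k k * q ^+ k) 0.
  by have := tendsD h hG; rewrite add0r; apply: eq_tends => n; rewrite subrK.
apply: geo_tends0; exists (K / (1 - r)), r; split=> //; first by rewrite divr_ge0 // ltW.
move=> n.
have h := tendsB (tends_shift n (half_coef_tends n hq)) (tends_cst (\sum_(k < n) half_coef k k * q ^+ k)).
apply: (tends_nm_le h) => N; rewrite addnC big_split_ord /=.
rewrite (eq_bigr (fun k : 'I_n => half_coef k k * q ^+ k)); last first.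
  by move=> k _; rewrite half_coef_stable // ltnW.
rewrite addrAC subrr add0r; apply: le_trans (nm_sum _ (fun k => half_coef n (n + k)%N * q ^+ (n + k))) _.
apply: (@le_trans _ _ (K * \sum_(k < N) r ^+ (n + k))).
  by rewrite mulr_sumr; apply: ler_sum => k _.
by rewrite mulrAC -mulrA ler_wpM2l // geo_tail.
Qed.

End HalfProduct.

Lemma half_power_exists (F : C -> C) n (m : nat -> nat) : (forall i, (i < m i)%N) ->
  (forall q, nm q < 1 -> forall G, tends (half_product m q) G -> G ^+ 2 = F q ^+ n) ->
  exists2 g, is_half_power F n g & forall q, nm q < 1 -> tends (half_product m q) (g q).
Proof.
move=> hm hF.
have /choice[g hg] : forall q, exists G, nm q < 1 ->
   tends (fun n => \sum_(k < n) half_coef m k k * q ^+ k) G /\ tends (half_product m q) G.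
  move=> q; case: (ltP (nm q) 1) => hq; last by exists 0.
  by have [G hG] := half_product_series hm hq; exists G.
exists g => [|q hq]; last by have [] := hg q hq.
split=> [q|]; first by rewrite norm_lt1 => hq; apply: hF => //; have [] := hg q hq.
exists (fun k => half_coef m k k); split=> // q; rewrite norm_lt1 => /hg[[h] _].
by rewrite (_ : series _ = (fun n => \sum_(k < n) half_coef m k k * q ^+ k)) //;
  apply/funext => N; rewrite seriesEord.
Qed.

(** Close to 0 the leading term d(n) x^n dominates; convergence at 1/2 bounds the other coefficients
    by K 2^k. *)
Lemma power_series_nonzero (d : nat -> C) (D : C -> C) n :
  (forall x, nm x < 1 -> tends (fun N => \sum_(k < N) d k * x ^+ k) (D x)) ->
  (forall k, (k < n)%N -> d k = 0) -> d n != 0 ->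
  exists2 rho : R, 0 < rho & forall x, 0 < nm x -> nm x < rho -> D x != 0.
Proof.
move=> hD hd dn.
have [K K0 hK] : exists2 K, 0 <= K & forall k, nm (d k) * 2^-1 ^+ k <= K.
  have h2 : nm ((2^-1 : R)%:C%C : C) = 2^-1 by rewrite nm_real ger0_norm // invr_ge0.
  have /hD h : nm ((2^-1 : R)%:C%C : C) < 1 by rewrite h2 invf_lt1 // ltr1n.
  have [K K0 hK] := tends_bounded h; exists (K + K) => [|k]; first by rewrite addr_ge0.
  have := hK k.+1; rewrite big_ord_recr /= => h1; have h3 := hK k.
  rewrite -h2 -nmX -nmM.
  set S := \sum_(k0 < k) _ in h1 h3; set T := _ * _ in h1 *.
  have := nmD (S + T) (- S); rewrite addrC addKr nmN; lra.
(* For |x| < 1/4 the tail K (2|x|)^(n+1) / (1 - 2|x|) is at most 2 K (2|x|)^(n+1) = L |x|^(n+1). *)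
pose L := K * 2 ^+ n.+2.
have dn0 := nm_gt0 dn; have L0 : 0 <= L by rewrite mulr_ge0 ?exprn_ge0.
exists (Num.min 4^-1 (nm (d n) / (L + 1))).
  by rewrite lt_min invr_gt0 ltr0n /= divr_gt0 // ltr_wpDl.
move=> x x0; rewrite lt_min => /andP[x4 xd].
have x1 : nm x < 1 by apply: lt_le_trans x4 _; rewrite invf_le1 ?ler1n ?ltr0n.
apply/negP => /eqP Dx.
have h := tendsB (tends_shift n.+1 (hD x x1)) (tends_cst (d n * x ^+ n)).
have : nm (D x - d n * x ^+ n) <= L * nm x ^+ n.+1.
  apply: (tends_nm_le h) => N; rewrite addnC big_split_ord big_ord_recr /= big1 => [|k _]; last first.
    by rewrite hd ?mul0r.
  rewrite add0r addrAC subrr add0r; apply: le_trans (nm_sum _ (fun k => d (n.+1 + k)%N * x ^+ (n.+1 + k))) _.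
  have x2 : 0 <= 2 * nm x by rewrite mulr_ge0 ?nm_ge0.
  have x3 : 2 * nm x < 1 by lra.
  apply: (@le_trans _ _ (K * \sum_(k < N) (2 * nm x) ^+ (n.+1 + k))).
    rewrite mulr_sumr; apply: ler_sum => k _.
    rewrite nmM nmX exprMn mulrA ler_wpM2r ?exprn_ge0 ?nm_ge0 //.
    by rewrite -ler_pdivrMr ?exprn_gt0 // -exprVn.
  apply: le_trans (ler_wpM2l K0 (geo_tail n.+1 N x2 x3)) _.
  rewrite /L -mulrA ler_wpM2l // exprMn (exprS _ n.+1).
  rewrite ler_pdivrMr ?subr_gt0 //.
  have y0 : 0 <= 2 ^+ n.+1 * nm x ^+ n.+1 by rewrite mulr_ge0 ?exprn_ge0 ?nm_ge0.
  rewrite [leRHS](_ : _ = 2 * (2 ^+ n.+1 * nm x ^+ n.+1) * (1 - 2 * nm x)); last by ring.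
  have z0 : 0 <= 1 - 4 * nm x by lra.
  have := mulr_ge0 y0 z0; lra.
rewrite Dx sub0r nmN nmM nmX exprS mulrA ler_pM2r ?exprn_gt0 // => h1.
have : nm (d n) < nm (d n).
  apply: le_lt_trans h1 _; rewrite ltr_pdivlMr in xd; last by rewrite ltr_wpDl.
  apply: le_lt_trans _ xd; rewrite mulrC ler_wpM2l ?nm_ge0 // lerDl //.
by rewrite ltxx.
Qed.

(** Both squares agree, so (g - g')(g + g') = 0. The series of g + g' has constant term 2; if g - g'
    had a nonzero coefficient, both factors would be nonzero at a common small point. *)
Lemma half_power_uniq (F : C -> C) n g g' q : is_half_power F n g -> is_half_power F n g' ->
  nm q < 1 -> g q = g' q.
Proof.
move=> [sg [a [a0 ha]]] [sg' [c [c0 hc]]] hq.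
have toT (e : nat -> C) f : (forall q, `|q| < 1 -> series (fun k => e k * q ^+ k) @ \oo --> f q) ->
    forall x, nm x < 1 -> tends (fun N => \sum_(k < N) e k * x ^+ k) (f x).
  move=> h x; rewrite -norm_lt1 => /h h'; constructor.
  by rewrite (_ : (fun N => _) = series (fun k => e k * x ^+ k)) //; apply/funext => N; rewrite seriesEord.
have {}ha := toT _ _ ha; have {}hc := toT _ _ hc.
have hD x : nm x < 1 -> tends (fun N => \sum_(k < N) (a k - c k) * x ^+ k) (g x - g' x).
  move=> hx; apply: eq_tends (tendsB (ha x hx) (hc x hx)) => N.
  by rewrite -sumrB; apply: eq_bigr => k _; rewrite mulrBl.
have hE x : nm x < 1 -> tends (fun N => \sum_(k < N) (a k + c k) * x ^+ k) (g x + g' x).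
  move=> hx; apply: eq_tends (tendsD (ha x hx) (hc x hx)) => N.
  by rewrite -big_split /=; apply: eq_bigr => k _; rewrite mulrDl.
suff eac : forall k, a k = c k.
  by apply: (tends_uniq (ha q hq)); apply: eq_tends (hc q hq) => N; apply: eq_bigr => k _; rewrite eac.
apply: contrapT => /existsNP[k0 hk0].
have ex : exists k, a k != c k by exists k0; apply/eqP.
case: (ex_minnP ex) => k ak kmin.
have [r1 r10 h1] : exists2 rho : R, 0 < rho & forall x, 0 < nm x -> nm x < rho -> g x - g' x != 0.
  apply: (power_series_nonzero (d := fun k => a k - c k) (n := k)) => //.
    by move=> i hi; apply/eqP; rewrite subr_eq0; apply/negPn/negP => /kmin; rewrite leqNgt hi.
  by rewrite subr_eq0.
have [r2 r20 h2] : exists2 rho : R, 0 < rho & forall x, 0 < nm x -> nm x < rho -> g x + g' x != 0.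
  apply: (power_series_nonzero (d := fun k => a k + c k) (n := 0%N)) => //.
  by rewrite a0 c0 -[1 + 1]/(2%:R) pnatr_eq0.
pose rho := Num.min 1 (Num.min r1 r2).
have rho0 : 0 < rho by rewrite !lt_min ltr01 r10.
pose x : C := (rho / 2)%:C%C.
have nx : nm x = rho / 2 by rewrite nm_real ger0_norm // divr_ge0 // ltW.
have x0 : 0 < nm x by rewrite nx divr_gt0.
have : nm x < rho by rewrite nx ltr_pdivrMr // ltr_pMr // ltr1n.
rewrite !lt_min => /and3P[x1 xr1 xr2].
have := mulf_neq0 (h1 x x0 xr1) (h2 x x0 xr2).
by rewrite -subr_sqr sg ?sg' ?norm_lt1 // subrr eqxx.
Qed.

Lemma half_powerE (F : C -> C) n (m : nat -> nat) : (forall i, (i < m i)%N) ->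
  (forall q, nm q < 1 -> forall G, tends (half_product m q) G -> G ^+ 2 = F q ^+ n) ->
  forall q, nm q < 1 -> tends (half_product m q) (half_power F n q).
Proof.
move=> hm hF q hq; have [g hg gt] := half_power_exists hm hF.
have h : is_half_power F n (half_power F n).
  by apply: (xgetPex (P := [set g | is_half_power F n g]) (fun=> 0)); exists g.
by rewrite -(half_power_uniq hg h hq); apply: gt.
Qed.

End HalfPowers.

Section HalfPowerRatio.
Variable R : realType.
Local Notation C := (Cplx R).
Variable q : C.
Hypothesis hq : nm q < 1.

(* J_40^(11/2) is the eleventh power of the product of (1 - q^(mS i))^(1/2), and
   J_{20,40}^(1/2) = (q^20; q^40) J_40^(1/2); [m11] and [m21] list these factors one
   at a time, as [half_powerE] requires. *)
Let mS i := (40 * i.+1)%N.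
Let mT i := (40 * i + 20)%N.
Let m11 i := (40 * (i %/ 11).+1)%N.
Let m21 i := if (i %% 3)%N == 2%N then (40 * (i %/ 3).+1)%N else (40 * (i %/ 3) + 20)%N.

Let hS i : (i < mS i)%N. Proof. rewrite /mS; lia. Qed.
Let hT i : (i < mT i)%N. Proof. rewrite /mT; lia. Qed.
Let h11 i : (i < m11 i)%N. Proof. rewrite /m11; lia. Qed.
Let h21 i : (i < m21 i)%N. Proof. rewrite /m21; case: ifP => _; lia. Qed.

Let half_productS m (x : C) n : half_product m x n.+1 = half_product m x n * sqrt1m (x ^+ m n).
Proof. exact: big_ord_recr. Qed.

Let half_product0 m (x : C) : half_product m x 0 = 1.
Proof. exact: big_ord0. Qed.

Let half11_step (x : C) n k : (k <= 11)%N ->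
  half_product m11 x (11 * n + k) = half_product m11 x (11 * n) * sqrt1m (x ^+ mS n) ^+ k.
Proof.
elim: k => [|k IH] hk; first by rewrite addn0 expr0 mulr1.
rewrite addnS half_productS IH ?(ltnW hk) // exprSr mulrA; congr (_ * sqrt1m (x ^+ _)).
by rewrite /m11 /mS (_ : ((11 * n + k) %/ 11)%N = n) //; lia.
Qed.

Let half11 (x : C) n : half_product m11 x (11 * n) = half_product mS x n ^+ 11.
Proof.
elim: n => [|n IH]; first by rewrite muln0 !half_product0 expr1n.
rewrite mulnS addnC half11_step // IH -exprMn; congr (_ ^+ _).
by rewrite half_productS.
Qed.

Let half21 (x : C) n : half_product m21 x (3 * n) = half_product mT x n ^+ 2 * half_product mS x n.
Proof.
elim: n => [|n IH]; first by rewrite muln0 !half_product0 expr1n mulr1.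
have e0 : m21 (3 * n) = mT n by rewrite /m21 /mT; case: ifP; lia.
have e1 : m21 (3 * n).+1 = mT n by rewrite /m21 /mT; case: ifP; lia.
have e2 : m21 (3 * n).+2 = mS n by rewrite /m21 /mS; case: ifP; lia.
rewrite mulnS addnC !addnS addn0 !half_productS IH e0 e1 e2.
move: (half_product mT x n) (half_product mS x n) (sqrt1m (x ^+ mT n)) (sqrt1m (x ^+ mS n)) => *.
by ring.
Qed.

Let half_sqr m (x : C) n : nm x < 1 -> (forall i, (i < m i)%N) ->
  half_product m x n ^+ 2 = \prod_(i < n) (1 - x ^+ m i).
Proof.
move=> hx hm; rewrite /half_product -prodrXl; apply: eq_bigr => i _.
by rewrite sqrt1m_sqr //; have := hm i; case: (m i) => // k _; apply: nm_pow_lt1.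
Qed.

Let limS (x : C) : nm x < 1 -> exists2 S, tends (half_product mS x) S & S ^+ 2 = J 40 x.
Proof.
move=> hx; have [S [_ hS']] := half_product_series hS hx; exists S => //.
rewrite expr2; apply: (tends_uniq (tendsM hS' hS')).
apply: eq_tends (qpoch_tends (x ^+ 40) (nm_pow_lt1 39 hx)) => n.
rewrite -expr2 half_sqr //; apply: eq_bigr => i _.
by rewrite -exprS -exprM.
Qed.

Let limT (x : C) : nm x < 1 -> exists2 T, tends (half_product mT x) T & T ^+ 2 = qprod x 20 40.
Proof.
move=> hx; have [T [_ hT']] := half_product_series hT hx; exists T => //.
rewrite expr2; apply: (tends_uniq (tendsM hT' hT')).
apply: eq_tends (qpoch_tends (x ^+ 20) (nm_pow_lt1 39 hx)) => n.
rewrite -expr2 half_sqr //; apply: eq_bigr => i _.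
by rewrite -exprM -exprD /mT addnC.
Qed.

Let lim11 (x S : C) G : tends (half_product mS x) S -> tends (half_product m11 x) G -> G = S ^+ 11.
Proof.
move=> h1 h2; apply: (tends_uniq (tends_sub (f := fun n => (11 * n)%N) _ h2)) => [n|]; first lia.
have hX k : tends (fun n => half_product mS x n ^+ k) (S ^+ k).
  elim: k => [|k IH]; first exact: tends_cst.
  rewrite exprS; apply: eq_tends (tendsM h1 IH) => n; by rewrite exprS.
by apply: eq_tends (hX 11%N) => n; rewrite half11.
Qed.

Let lim21 (x S T : C) G : tends (half_product mS x) S -> tends (half_product mT x) T ->
  tends (half_product m21 x) G -> G = T ^+ 2 * S.
Proof.
move=> h1 h2 h3; apply: (tends_uniq (tends_sub (f := fun n => (3 * n)%N) _ h3)) => [n|]; first lia.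
rewrite expr2; apply: eq_tends (tendsM (tendsM h2 h2) h1) => n.
by rewrite half21 expr2.
Qed.

(** With S^2 = J_40 and T^2 = (q^20;q^40)_oo the two powers are S^11 and T^2 S, and the quotient
    S^10 / T^2 no longer depends on the choice of roots. *)
Lemma half_power_ratio :
  half_power (@J R 40) 11 q / half_power (@J2 R 20 40) 1 q = J 40 q ^+ 5 / qprod q 20 40.
Proof.
have [S hS1 S2] := limS hq; have [T hT1 T2] := limT hq.
have e1 : half_power (@J R 40) 11 q = S ^+ 11.
  apply: (lim11 hS1); apply: half_powerE h11 _ _ hq => x hx G hG.
  have [S' hS' eS'] := limS hx.
  by rewrite (lim11 hS' hG) -eS' exprAC.
have e2 : half_power (@J2 R 20 40) 1 q = T ^+ 2 * S.
  apply: (lim21 hS1 hT1); apply: half_powerE h21 _ _ hq => x hx G hG.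
  have [S' hS' eS'] := limS hx; have [T' hT' eT'] := limT hx.
  rewrite (lim21 hS' hT' hG) expr1 J2_qprod exprMn -/(J 40 x) eT' expr2 -mulrA.
  by rewrite -J_qprod -eS'.
have S0 : S != 0.
  by have := qprod_neq0 hq 39 39; rewrite -J_qprod -S2 sqrf_eq0.
have T0 : T != 0 by have := qprod_neq0 hq 19 39; rewrite -T2 sqrf_eq0.
rewrite e1 e2 -S2 -T2 -exprM.
move: S T S0 T0 {hS1 S2 hT1 T2 e1 e2} => S T S0 T0; field.
by rewrite S0 T0.
Qed.

End HalfPowerRatio.

(** * Unconditional sums over triples, by exhaustion with boxes *)

Section UnconditionalSums.
Variable R : realType.
Local Notation C := (Cplx R).
Local Notation idx := (nat * nat * nat)%type.

Definition box N : seq idx :=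
  [seq (x, k) | x <- [seq (i, j) | i <- iota 0 N, j <- iota 0 N], k <- iota 0 N].

Lemma mem_box N i j k : ((i, j, k) \in box N) = [&& (i < N)%N, (j < N)%N & (k < N)%N].
Proof.
apply/allpairsP/idP => [[[x k'] /= [/allpairsP[[i' j'] /= [hi hj ->]] hk [-> -> ->]]]|].
  by move: hi hj hk; rewrite !mem_iota !add0n !leq0n /= => -> -> ->.
move=> /and3P[hi hj hk]; exists ((i, j), k); split=> //=.
  by apply/allpairsP; exists (i, j); rewrite /= !mem_iota.
by rewrite mem_iota.
Qed.

Lemma box_uniq N : uniq (box N).
Proof.
apply: allpairs_uniq; rewrite ?iota_uniq //; last by move=> [? ?] [? ?] _ _ [-> ->].
by apply: allpairs_uniq; rewrite ?iota_uniq // => -[? ?] [? ?] _ _ [-> ->].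
Qed.

Lemma sum_box (V : nmodType) N (f : idx -> V) :
  \sum_(x <- box N) f x = \sum_(i < N) \sum_(j < N) \sum_(k < N)
    f (nat_of_ord i, nat_of_ord j, nat_of_ord k).
Proof.
rewrite /box !big_allpairs -[in iota 0 N](subn0 N) big_mkord; apply: eq_bigr => i _.
by rewrite big_mkord; apply: eq_bigr => j _; rewrite big_mkord.
Qed.

Lemma box_cover (A : seq idx) : exists M, forall N, (M <= N)%N -> {subset A <= box N}.
Proof.
exists (\sum_(x <- A) (x.1.1 + x.1.2 + x.2).+1)%N => N hN [[i j] k] hx.
have : (i + j + k < N)%N.
  apply: leq_trans hN; rewrite (perm_big _ (perm_to_rem hx)) big_cons /=; lia.
by rewrite mem_box; lia.
Qed.

Lemma sum_subset (V : zmodType) (f : idx -> V) (s1 s2 : seq idx) : uniq s1 -> uniq s2 ->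
  {subset s1 <= s2} ->
  \sum_(x <- s2) f x = \sum_(x <- s1) f x + \sum_(x <- s2 | x \notin s1) f x.
Proof.
move=> u1 u2 s12; rewrite (bigID (mem s1)) /=; congr (_ + _).
rewrite -big_filter; apply: perm_big; apply: uniq_perm => //; first exact: filter_uniq.
by move=> x; rewrite mem_filter; apply/andb_idr => /s12.
Qed.

Lemma has_sumP (f : idx -> C) s :
  (forall e : R, 0 < e -> exists s0 : seq idx, forall A : seq idx, uniq A ->
     {subset s0 <= A} -> nm (s - \sum_(x <- A) f x) < e) -> has_sum f s.
Proof.
move=> h; have FF : Filter (@totally idx) by case: (@totally_filter idx).
apply/(@cvgrPdist_lt _ _ _ _ FF) => e; case: e => e e'; rewrite ltcE /= => /andP[/eqP-> e0].
have [s0 h0] := h e e0; exists [fset x in s0]%fset => // A /= hA.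
have -> : partial_sum f A = \sum_(x <- A) f x by rewrite /partial_sum big_seq_fsetE.
rewrite normE ltcE /= eqxx /=; apply: h0; first exact: fset_uniq.
by move=> x hx; apply: (fsubsetP hA); rewrite inE.
Qed.

Lemma has_sum_finite (f : idx -> C) (P : pred idx) N : (forall x, f x = (P x)%:R) ->
  (forall x, P x -> x \in box N) -> has_sum f (count P (box N))%:R.
Proof.
move=> hf hP; apply: has_sumP => e e0; exists (box N) => A uA sA.
have -> : \sum_(x <- A) f x = (count P A)%:R.
  by rewrite -sum1_count natr_sum [RHS]big_mkcond; apply: eq_bigr => x _; rewrite hf; case: (P x).
rewrite (_ : count P A = count P (box N)) ?subrr ?nm0 //.
rewrite -!size_filter; apply: perm_size; apply: uniq_perm; rewrite ?filter_uniq ?box_uniq //.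
move=> x; rewrite !mem_filter; case hx: (P x) => //=.
by rewrite (hP x hx) sA // hP.
Qed.

(** Tannery identifies the limit over boxes with the iterated sum, and the summable majorant K
    r^(i+j+k) controls any finite set containing a large box. The bound on [g] proved here is handed
    to the last premise, since splitting by parity requires it. *)
Theorem has_sum_iterated (f : idx -> C) (g : nat -> C) (K r : R) s :
  0 <= K -> 0 <= r -> r < 1 -> (forall i j k, nm (f (i, j, k)) <= K * r ^+ (i + j + k)) ->
  (forall i, tends (fun N => \sum_(j < N) \sum_(k < N) f (i, nat_of_ord j, nat_of_ord k)) (g i)) ->
  (geo_bounded g -> tends (fun N => \sum_(i < N) g i) s) -> has_sum f s.
Proof.
move=> K0 r0 r1 hf hg hs.
have d : 0 < 1 - r by rewrite subr_gt0.
pose G N := \sum_(i < N) r ^+ i.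
have G0 N : 0 <= G N by apply: sumr_ge0 => i _; rewrite exprn_ge0.
have Gle N : G N <= (1 - r)^-1.
  have := geo_tail 0 N r0 r1; rewrite expr0 div1r; apply: le_trans.
  by apply: ler_sum => i _; rewrite add0n.
have fb n i : nm (\sum_(j < n) \sum_(k < n) f (i, nat_of_ord j, nat_of_ord k)) <= K * ((1 - r)^-1 * (1 - r)^-1) * r ^+ i.
  apply: (@le_trans _ _ (\sum_(j < n) \sum_(k < n) K * r ^+ (i + j + k))).
    apply: le_trans (nm_sum _ (fun j => \sum_(k < n) f (i, j, nat_of_ord k))) _; apply: ler_sum => j _.
    by apply: le_trans (nm_sum _ (fun k => f (i, nat_of_ord j, k))) _; apply: ler_sum => k _.
  rewrite (_ : \sum_(j < n) _ = K * (G n * G n) * r ^+ i); last first.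
    rewrite /G big_distrlr /= mulr_sumr mulr_suml; apply: eq_bigr => j _.
    by rewrite mulr_sumr mulr_suml; apply: eq_bigr => k _; rewrite !exprD; ring.
  by rewrite ler_wpM2r ?exprn_ge0 // ler_wpM2l // ler_pM.
have K'0 : 0 <= K * ((1 - r)^-1 * (1 - r)^-1) by rewrite !mulr_ge0 ?invr_ge0 // ltW.
have gg : geo_bounded g.
  by exists (K * ((1 - r)^-1 * (1 - r)^-1)), r; split=> // i; apply: tends_nm_le (hg i) _ => n.
have hbox : tends (fun N => \sum_(x <- box N) f x) s.
  have := (tannery_tends s K'0 r0 r1 fb hg).2 (hs gg).
  by apply: eq_tends => N; rewrite sum_box.
pose B N := \sum_(x <- box N) K * r ^+ (x.1.1 + x.1.2 + x.2).
have BE N : B N = K * (G N * G N * G N).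
  rewrite /B sum_box /G big_distrlr /= mulr_suml mulr_sumr; apply: eq_bigr => i _.
  rewrite mulr_suml mulr_sumr; apply: eq_bigr => j _.
  by rewrite !mulr_sumr; apply: eq_bigr => k _; rewrite !exprD.
have [Gl hGl] := real_geo_cvg (a := fun i => r ^+ i) ler01 r0 r1
  (fun i => ltac:(by rewrite mul1r ger0_norm ?exprn_ge0)).
have hB : B @ \oo --> K * (Gl * Gl * Gl).
  rewrite (_ : B = fun N => K * (G N * G N * G N)); last by apply/funext => N; rewrite BE.
  by apply: cvgMr; apply: cvgM => //; apply: cvgM.
apply: has_sumP => e e0.
have e2 : 0 < e / 2 by rewrite divr_gt0.
(* What [A] misses of a larger box is bounded by the difference of two box sums of the majorant,
   each within e/4 of the limit. *)
have e4 : 0 < e / 4 by rewrite divr_gt0.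
have [N1 h1] := (tends_nm _ _).1 hbox _ e2.
have [N2 _ h2] := (cvgrPdist_lt _ _).1 hB _ e4.
exists (box N2) => A uA sA.
have [M hM] := box_cover A.
pose N := maxn M (maxn N1 N2).
have AN : {subset A <= box N} by apply: hM; rewrite leq_maxl.
have [N1N N2N] : (N1 <= N)%N /\ (N2 <= N)%N by rewrite !leq_max !leqnn !orbT.
have hb1 := h1 N N1N; have hb2 := h2 N N2N; have hb3 := h2 N2 (leqnn N2).
have sf := sum_subset f uA (box_uniq N) AN.
have sB := sum_subset (fun x => K * r ^+ (x.1.1 + x.1.2 + x.2)) uA (box_uniq N) AN.
have sB2 := sum_subset (fun x => K * r ^+ (x.1.1 + x.1.2 + x.2)) (box_uniq N2) uA sA.
have t0 : 0 <= \sum_(x <- A | x \notin box N2) K * r ^+ (x.1.1 + x.1.2 + x.2).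
  by apply: sumr_ge0 => x _; rewrite mulr_ge0 ?exprn_ge0.
rewrite -/(B N) in sB; rewrite -/(B N2) in sB2.
have tail : nm (\sum_(x <- box N | x \notin A) f x) <= \sum_(x <- box N | x \notin A) K * r ^+ (x.1.1 + x.1.2 + x.2).
  elim/big_ind2: _ => [|x1 x2 y1 y2 u1 u2|[[i j] k] _]; first by rewrite nm0.
    by apply: le_trans (nmD _ _) (lerD u1 u2).
  exact: hf.
have -> : s - \sum_(x <- A) f x = (s - \sum_(x <- box N) f x) + \sum_(x <- box N | x \notin A) f x.
  by rewrite sf; ring.
apply: le_lt_trans (nmD _ _) _; rewrite nmB.
move: hb2 hb3; rewrite /= !ltr_distl => /andP[? ?] /andP[? ?]; lra.
Qed.

End UnconditionalSums.

(** * The triple sums *)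

(** The quadratic part is i^2 + (i-2j)^2 + (i-2k)^2. Completing squares after subtracting 4j +
    (i+j+k) gives the three squares below, the last two scaled by 16, and a minimum above -6. *)
Lemma expo_lower (b c d : int) i j k : 0 <= b -> -4 <= c -> 0 <= d ->
  (i + j + k)%N%:Z <= expo b c d i j k + 6.
Proof.
move=> hb hc hd.
have hbi : 0 <= b * i%:Z by rewrite mulr_ge0.
have hcj : -4 * j%:Z <= c * j%:Z by rewrite ler_wpM2r.
have hdk : 0 <= d * k%:Z by rewrite mulr_ge0.
have := sqr_ge0 (i%:Z - 2); have := sqr_ge0 (4 * (i%:Z - 2 * j%:Z) + 5).
have := sqr_ge0 (4 * (i%:Z - 2 * k%:Z) + 1).
rewrite /expo; lia.
Qed.

(** The term -4j is absorbed by 2i through (i-2j+1)^2 = (i-2j)^2 + 2i - 4j + 1, where i^2 pays for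
    the 1 if i > 0; for i = 0 one uses 4j(j-1) >= 0. *)
Lemma expo_ge0 (b c d : int) i j k : 0 <= d -> (2 <= b /\ -4 <= c) \/ (0 <= b /\ 0 <= c) ->
  0 <= expo b c d i j k.
Proof.
move=> hd hbc.
have hdk : 0 <= d * k%:Z by rewrite mulr_ge0.
have h1 := sqr_ge0 (i%:Z - 2 * k%:Z).
case: hbc => [[hb hc]|[hb hc]]; last first.
  have hbi : 0 <= b * i%:Z by rewrite mulr_ge0.
  have hcj : 0 <= c * j%:Z by rewrite mulr_ge0.
  have := sqr_ge0 (i%:Z - 2 * j%:Z); have := sqr_ge0 i%:Z; rewrite /expo; lia.
have hbi : 2 * i%:Z <= b * i%:Z by rewrite ler_wpM2r.
have hcj : -4 * j%:Z <= c * j%:Z by rewrite ler_wpM2r.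
case: i h1 hbi => [|i] h1 hbi.
  have : 0 <= j%:Z * (j%:Z - 1) by case: (j) => // j'; rewrite mulr_ge0 //; lia.
  rewrite /expo; lia.
have := sqr_ge0 (i.+1%:Z - 2 * j%:Z + 1).
have : 0 <= (i.+1%:Z - 1) * (i.+1%:Z + 1) by rewrite mulr_ge0 //; lia.
rewrite /expo; lia.
Qed.

Section TripleSums.
Variable R : realType.
Local Notation C := (Cplx R).
Variable q : C.
Hypotheses (hq : nm q < 1) (q0 : q != 0).
Local Notation t := (q ^+ 8).
Local Notation M := (nqprod q).
Local Notation P := (qprod q).

Let ht : nm t < 1. Proof. exact: nm_pow_lt1. Qed.

Definition eprod b (n : int) : C := qpoch_inf (- (q ^ n)) (q ^+ b).

Lemma eprod_nat b a : (0 < a)%N -> (0 < b)%N -> eprod b a%:Z = M a b.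
Proof. by move=> a0 b0; rewrite /eprod -exprnP qprod_opp_nqprod. Qed.

Lemma eprod_step b n : eprod b.+1 (n - b.+1%:Z) = q ^ (n - b.+1%:Z) * (1 + q ^ (b.+1%:Z - n)) * eprod b.+1 n.
Proof.
rewrite /eprod (qpoch_inf_split (nm_pow_lt1 b hq) _ 1) pochS poch0 mul1r expr0 mulr1 expr1.
rewrite opprK mulNr (_ : q ^ (n - b.+1%:Z) * q ^+ b.+1 = q ^ n); last first.
  by rewrite exprnP -expfzDr // subrK.
rewrite mulrDr mulr1 -expfzDr // (_ : n - b.+1%:Z + (b.+1%:Z - n) = 0) ?expr0z; last by ring.
by rewrite [_ + 1]addrC.
Qed.

(** Each of the m additional factors is 1 + q^(-e) = q^(-e) (1 + q^e). This moves the dependence on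
    m into a power of q and a finite product. *)
Lemma eprod_shift b n m : eprod b.+1 (n - (b.+1 * m)%N%:Z) =
  q ^ (n * m%:Z - (b.+1 * 'C(m.+1, 2))%N%:Z) * poch (- q ^ (b.+1%:Z - n)) (q ^+ b.+1) m * eprod b.+1 n.
Proof.
elim: m => [|m IH]; first by rewrite !muln0 mulr0 !subr0 poch0 expr0z !mul1r.
rewrite (_ : n - (b.+1 * m.+1)%N%:Z = n - (b.+1 * m)%N%:Z - b.+1%:Z); last by lia.
rewrite eprod_step IH pochS (_ : - q ^ (b.+1%:Z - n) * (q ^+ b.+1) ^+ m =
   - q ^ (b.+1%:Z - (n - (b.+1 * m)%N%:Z))); last first.
  rewrite mulNr -exprM exprnP -expfzDr //; congr (- q ^ _); lia.
rewrite opprK (_ : q ^ (n * m.+1%:Z - (b.+1 * 'C(m.+2, 2))%N%:Z) =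
  q ^ (n - (b.+1 * m)%N%:Z - b.+1%:Z) * q ^ (n * m%:Z - (b.+1 * 'C(m.+1, 2))%N%:Z)); last first.
  rewrite -expfzDr //; congr (q ^ _); rewrite (binS m.+1) bin1; lia.
by move: (q ^ _) (q ^ _) (q ^ _) (poch _ _ _) (eprod _ _) => *; ring.
Qed.

(** The first factor 1 + q^0 is the origin of the constants 2 and 4 in the theorem. *)
Lemma eprod0 b : eprod b.+1 0 = 2 * M b.+1 b.+1.
Proof.
rewrite -eprod_nat // /eprod (qpoch_inf_split (nm_pow_lt1 b hq) _ 1) pochS poch0 mul1r expr0.
by rewrite !expr0z mulr1 expr1 opprK mulN1r -exprnP.
Qed.

(** For fixed i the exponent separates: 4j^2 - 4ij + cj = 8 C(j,2) + (4-4i+c) j, and likewise in k.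
    The double sum is a product of two Euler sums. *)
Lemma inner_euler (b c d : int) i :
  tends (fun N => \sum_(j < N) \sum_(k < N) summand q b c d (i, nat_of_ord j, nat_of_ord k))
   (q ^ (3 * i%:Z ^+ 2 + b * i%:Z) / poch t t i * (eprod 8 (4 - 4 * i%:Z + c) * eprod 8 (4 - 4 * i%:Z + d))).
Proof.
have e z := euler_sum ht (q ^ z).
apply: eq_tends (tendsM (tends_cst _) (tendsM (e _) (e _))) => N.
rewrite big_distrlr /= mulr_sumr; apply: eq_bigr => j _.
rewrite mulr_sumr; apply: eq_bigr => k _.
rewrite /summand -!/(poch t t _).
have -> : q ^ expo b c d i j k = q ^ (3 * i%:Z ^+ 2 + b * i%:Z) *
   (t ^+ 'C(j, 2) * (q ^ (4 - 4 * i%:Z + c)) ^+ j) * (t ^+ 'C(k, 2) * (q ^ (4 - 4 * i%:Z + d)) ^+ k).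
  rewrite -!exprM !exprnP !exprz_exp -!expfzDr //; congr (q ^ _).
  have hj := bin2Z j; have hk := bin2Z k.
  rewrite /expo (_ : (8 * 'C(j, 2))%N%:Z = 4 * (2 * ('C(j, 2))%:Z)); last lia.
  rewrite (_ : (8 * 'C(k, 2))%N%:Z = 4 * (2 * ('C(k, 2))%:Z)); last lia.
  by rewrite hj hk; ring.
rewrite !invfM; move: (q ^ _) (t ^+ 'C(j, 2)) (t ^+ 'C(k, 2)) (_ ^+ j) (_ ^+ k) => *.
by ring.
Qed.

Lemma summand_bound (b c d : int) : 0 <= b -> -4 <= c -> 0 <= d ->
  (forall i j k, 0 <= expo b c d i j k) ->
  exists K r : R, [/\ 0 <= K, 0 <= r, r < 1 &
    forall i j k, nm (summand q b c d (i, j, k)) <= K * r ^+ (i + j + k)].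
Proof.
move=> hb hc hd he; have [B B0 hB] := qqV_bounded ht.
have nq0 := nm_gt0 q0.
exists (B * B * B / nm q ^+ 6), (nm q); split=> //.
- by rewrite divr_ge0 ?mulr_ge0 ?exprn_ge0 // ltW.
- exact: ltW.
move=> i j k; have := he i j k.
have le := expo_lower i j k hb hc hd.
rewrite /summand -!/(poch t t _); move: le; case: (expo b c d i j k) => // m le _.
have hX : nm q ^+ m <= nm q ^+ (i + j + k) / nm q ^+ 6.
  rewrite ler_pdivlMr ?exprn_gt0 // -exprD ler_wiXn2l ?nm_ge0 ?ltW //; lia.
have -> : nm (q ^ m%:Z / (poch t t i * poch t t j * poch t t k)) =
    nm q ^+ m * (nm (poch t t i)^-1 * nm (poch t t j)^-1 * nm (poch t t k)^-1).
  by rewrite !invfM !nmM -exprnP nmX.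
rewrite [leRHS](_ : _ = nm q ^+ (i + j + k) / nm q ^+ 6 * (B * B * B)).
  have B3 : nm (poch t t i)^-1 * nm (poch t t j)^-1 * nm (poch t t k)^-1 <= B * B * B.
    by apply: ler_pM => //; rewrite ?mulr_ge0 ?nm_ge0 //; apply: ler_pM; rewrite ?nm_ge0.
  by apply: ler_pM; rewrite ?mulr_ge0 ?nm_ge0 ?exprn_ge0 ?nm_ge0.
by move: (B * B * B) (nm q ^+ 6)^-1 (nm q ^+ (i + j + k)) => u v w; ring.
Qed.


Let nm_sqrtC_lt1 x : nm x < 1 -> nm (sqrtC x : C) < 1.
Proof.
move=> hx; rewrite -(expr_lt1 (n := 2)) ?nm_ge0 // -nmX.
by rewrite (_ : sqrtC x ^+ 2 = x) // sqrtCK.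
Qed.

Lemma pentagonal_root x : x != 0 -> nm x < 1 ->
  exists h : C, [/\ h != 0, nm h < 1, h ^+ 2 = x & h ^+ 4 = x ^+ 2].
Proof.
move=> x0 hx; have hh : sqrtC x ^+ 2 = x by rewrite sqrtCK.
exists (sqrtC x); split=> //; first by rewrite sqrtC_eq0.
  exact: nm_sqrtC_lt1.
by rewrite (exprM _ 2 2) hh.
Qed.


Lemma cancel_ratio (X Y A D w : C) : A != 0 -> Y * X = A -> X * w * (Y / (A * D)) = w / D.
Proof.
move=> A0 e; rewrite invfM (_ : X * w * (Y * (A^-1 * D^-1)) = Y * X * A^-1 * (w / D)); last by ring.
by rewrite e divff // mul1r.
Qed.

Let poch_neq0 a b n : poch (q ^+ a.+1) (q ^+ b) n != 0.
Proof. by apply/prodf_neq0 => j _; exact: qprod_base_neq1. Qed.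

(** [pentagonal_sum0] at h^2 = q. Here (q;q^2)_i (-q;q^2)_i = (q^2;q^4)_i cancels half of
    (q^2;q^2)_(2i), which leaves (q^4;q^4)_i. *)
Lemma sum_mod5_0 : tends (fun n => \sum_(i < n) q ^+ (i * i) / poch (q ^+ 4) (q ^+ 4) i)
  (P 3 5 * P 2 5 * P 5 5 * M 1 2 / P 2 2).
Proof.
have [h [h0 hh h2 h4]] := pentagonal_root q0 hq.
have := pentagonal_sum0 h0 hh (expr1n _ 2) (esym (mul1r (h ^+ 2))).
rewrite h2 h4 !mul1r -(qprod_opp_nqprod hq (a := 1)) // expr1.
apply: eq_tends => n; apply: eq_bigr => i _.
have pd := poch_double (q ^+ 2) (q ^+ 2) i; rewrite -exprM -exprD -addnn in pd.
have ps := poch_sqr q (q ^+ 2) i; rewrite -exprM in ps.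
rewrite pd /bailey_weight -(mulrA (poch _ _ _)) cancel_ratio ?poch_neq0 //.
rewrite -exprM -exprD; congr (q ^+ _ / _); have := bin2Z i; lia.
Qed.

Lemma sum_mod5_1 : tends (fun n => \sum_(i < n) q ^+ (i * i + 2 * i) / poch (q ^+ 4) (q ^+ 4) i)
  (P 4 5 * P 1 5 * P 5 5 * M 1 2 / P 2 2).
Proof.
have [h [h0 hh h2 h4]] := pentagonal_root q0 hq.
have := pentagonal_sum1 h0 hh (expr1n _ 2) (esym (mul1r (h ^+ 2))).
rewrite h2 h4 !mul1r -(qprod_opp_nqprod hq (a := 1)) // /qprod expr1.
apply: eq_tends => n; apply: eq_bigr => i _.
have pd := poch_double (q ^+ 2) (q ^+ 2) i; rewrite -exprM -exprD -addnn in pd.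
have ps := poch_sqr q (q ^+ 2) i; rewrite -exprM in ps.
have e1 : q ^+ 2 * (q ^+ 2) ^+ (i + i) = (q * (q ^+ 2) ^+ i) ^+ 2.
  by rewrite exprD; move: ((q ^+ 2) ^+ i) => y; ring.
have := qprod_base_neq1 hq 1 2 (i + i); rewrite e1 => n0.
rewrite !pochS pd e1 /bailey_weight.
rewrite [q * q ^+ 2 in X in X ^+ i](_ : _ = q ^+ 3) -?exprS //.
move: n0; set y := q * (q ^+ 2) ^+ i => n0.
have ps' : (1 + y) * (poch q (q ^+ 2) i * (1 - y)) * poch (- q) (q ^+ 2) i =
    poch (q ^+ 2) (q ^+ 4) i * (1 - y ^+ 2).
  by rewrite -ps; ring.
rewrite [_ * _ * (1 - y ^+ 2)]mulrAC -(mulrA (poch _ _ _)) cancel_ratio ?mulf_neq0 ?poch_neq0 //.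
rewrite -!exprM -exprD; congr (q ^+ _ / _); have := bin2Z i; lia.
Qed.

(** With h^2 = -q^4 and s = q^4, the numerator (h^2;t)_i of the pair and the factor (-s;t)_i of the
    weight are both (-q^4;q^8)_i, as the parity halves require. *)
Let qopp_root : exists h : C, [/\ h != 0, nm h < 1, h ^+ 2 = - q ^+ 4 & h ^+ 4 = t].
Proof.
have [|| h [h0 hh h2 h4]] := pentagonal_root (x := - q ^+ 4).
- by rewrite oppr_eq0 expf_neq0.
- by rewrite nmN nm_pow_lt1.
by exists h; split=> //; rewrite h4 sqrrN -exprM.
Qed.

Let opp_base_pos a m : (0 < a)%N -> (0 < m)%N ->
  qpoch_inf (q ^+ a) (- q ^+ m) = P a (2 * m) * M (a + m) (2 * m).
Proof.
move=> a0 m0; rewrite (qpoch_inf_opp_base hq _ m0) -exprD.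
have am : (0 < a + m)%N by rewrite addn_gt0 a0.
have m2 : (0 < 2 * m)%N by rewrite muln_gt0.
by rewrite (qprod_opp_nqprod hq am m2).
Qed.

Let opp_base_neg a m : (0 < a)%N -> (0 < m)%N ->
  qpoch_inf (- q ^+ a) (- q ^+ m) = M a (2 * m) * P (a + m) (2 * m).
Proof.
move=> a0 m0; rewrite (qpoch_inf_opp_base hq _ m0) mulNr opprK -exprD.
by rewrite (qprod_opp_nqprod hq) ?muln_gt0.
Qed.

Let sqrN1 : (-1 : C) ^+ 2 = 1. Proof. by rewrite sqrrN expr1n. Qed.
Let q4E : q ^+ 4 = -1 * - q ^+ 4. Proof. by rewrite mulN1r opprK. Qed.

Let powN k : (- q ^+ 4) ^+ k = (-1) ^+ k * q ^+ (4 * k).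
Proof. by rewrite (exprNn (q ^+ 4)) -exprM. Qed.

Lemma sum_2_even : tends (fun n => \sum_(i < n) q ^+ (4 * (i * i)) *
     (poch (- q ^+ 4) t i ^+ 2 / poch t t (i + i)))
  ((P 12 40 * M 32 40) * (M 8 40 * P 28 40) * (M 20 40 * P 40 40) * M 4 8 / P 8 8).
Proof.
have [h [h0 hh h2 h4]] := qopp_root.
have := pentagonal_sum0 (s := q ^+ 4) h0 hh sqrN1; rewrite h2 h4 => /(_ q4E).
rewrite (_ : -1 * (- q ^+ 4) ^+ 3 = q ^+ 12); last by rewrite powN; ring.
rewrite (_ : -1 * (- q ^+ 4) ^+ 2 = - q ^+ 8); last by rewrite powN; ring.
rewrite (_ : (- q ^+ 4) ^+ 5 = - q ^+ 20); last by rewrite powN; ring.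
rewrite opp_base_pos // !opp_base_neg // (qprod_opp_nqprod hq) //.
apply: eq_tends => n; apply: eq_bigr => i _.
rewrite (_ : (4 * (i * i) = 4 * i + 8 * 'C(i, 2))%N); last by have := bin2Z i; lia.
rewrite exprD !exprM /bailey_weight.
by move: (poch _ _ _) (_ ^-1) (_ ^+ i) (_ ^+ 'C(i, 2)) => *; ring.
Qed.

Lemma sum_5_even : tends (fun n => \sum_(i < n) q ^+ (4 * (i * i) + 8 * i) *
     (poch (- q ^+ 4) t i ^+ 2 / poch t t (i + i)))
  ((M 16 40 * P 36 40) * (P 4 40 * M 24 40) * (M 20 40 * P 40 40) * M 4 8 / P 8 8).
Proof.
have [h [h0 hh h2 h4]] := qopp_root.
have := pentagonal_sum1 (s := q ^+ 4) h0 hh sqrN1; rewrite h2 h4 => /(_ q4E).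
rewrite (_ : -1 * (- q ^+ 4) ^+ 4 = - q ^+ 16); last by rewrite powN; ring.
rewrite -q4E.
rewrite (_ : (- q ^+ 4) ^+ 5 = - q ^+ 20); last by rewrite powN; ring.
rewrite opp_base_pos // !opp_base_neg // (qprod_opp_nqprod hq) //.
apply: eq_tends => n; apply: eq_bigr => i _.
rewrite (_ : (4 * (i * i) + 8 * i = 12 * i + 8 * 'C(i, 2))%N); last by have := bin2Z i; lia.
have e1 : t * t ^+ (i + i) = (q ^+ 4 * t ^+ i) ^+ 2.
  by rewrite exprD; move: (t ^+ i) => y; ring.
have := qprod_base_neq1 hq 7 8 (i + i); rewrite e1 => n0.
rewrite exprD !exprM /bailey_weight !pochS e1 mulNr opprK.
rewrite (_ : q ^+ 4 * t = q ^+ 12); last by rewrite -exprD.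
move: n0; set y := q ^+ 4 * t ^+ i => n0.
have := qq_neq0 (qpow_neq1 ht) (i + i).
clearbody y.
by move: (poch t t _) (poch (- q ^+ 4) t i) (_ ^+ i) (_ ^+ 'C(i, 2)) => z1 z2 z3 z4 z10; field; rewrite z10 n0.
Qed.

Lemma sum_4_odd : tends (fun n => \sum_(i < n) q ^+ (4 * (i * i) + 8 * i) *
     (poch (- q ^+ 4) t i * poch (- q ^+ 4) t i.+1 / poch t t (i + i).+1))
  ((P 20 40 * M 40 40) * (M 40 40 * P 20 40) * (M 20 40 * P 40 40) * M 4 8 / P 8 8).
Proof.
have [h [h0 hh h2 h4]] := qopp_root.
have := pentagonal_sum2 (s := q ^+ 4) h0 hh sqrN1; rewrite h2 h4 => /(_ q4E erefl).
rewrite (_ : (- q ^+ 4) ^+ 5 = - q ^+ 20); last by rewrite powN; ring.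
rewrite opprK opp_base_pos // opp_base_neg // (qprod_opp_nqprod hq) //.
(* (-1;-q^20)_oo splits into (-1;q^40)_oo and (q^20;q^40)_oo; the 2 contained in the former cancels
   the 1/2. *)
rewrite (qpoch_inf_opp_base hq (-1) (m := 20)) // mulN1r opprK.
have -> : qpoch_inf (-1) (q ^+ (2 * 20)) = 2 * M 40 40 by rewrite -eprod0 /eprod expr0z.
rewrite [2^-1 * _](_ : _ = P 20 40 * M 40 40 * (M 40 40 * P 20 40) * (M 20 40 * P 40 40)).
  apply: eq_tends => n; apply: eq_bigr => i _.
  rewrite (_ : (4 * (i * i) + 8 * i = 12 * i + 8 * 'C(i, 2))%N); last by have := bin2Z i; lia.
  rewrite exprD !exprM /bailey_weight -exprD.
  by move: (poch _ _ i) (poch _ _ i.+1) (_ ^-1) (_ ^+ i) (_ ^+ 'C(i, 2)) => *; ring.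
rewrite [qpoch_inf (q ^+ 20) _](_ : _ = P 20 40) //.
by move: (P 20 40) (M 40 40) (M 20 40) (P 40 40) => *; field.
Qed.

Let tX k : t ^+ k = q ^+ (8 * k). Proof. by rewrite -exprM. Qed.

Lemma sum_2_odd : tends (fun n => \sum_(i < n) t ^+ 'C(i.+1, 2) *
     (poch (- t) t i ^+ 2 / poch t t (i + i).+1))
  (P 56 80 * P 24 80 * P 80 80 * M 8 8 / P 8 8).
Proof.
have := even_sum1 (expf_neq0 8 q0) ht; rewrite !tX (qprod_opp_nqprod hq) //.
apply: eq_tends => n; apply: eq_bigr => i _; rewrite binS bin1 exprD /bailey_weight.
by move: (poch _ _ _) (_ ^-1) (_ ^+ i) (_ ^+ 'C(i, 2)) => *; ring.
Qed.

Let qpoch_m1 : qpoch_inf (-1) t = 2 * M 8 8.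
Proof. by rewrite -eprod0 /eprod expr0z. Qed.

Lemma sum_4_even : tends (fun n => \sum_(i < n) t ^+ 'C(i.+1, 2) *
     (poch (- t) t i * poch (-1) t i / poch t t (i + i)))
  (P 40 80 * P 40 80 * P 80 80 * M 8 8 / P 8 8).
Proof.
have := even_sum0 (expf_neq0 8 q0) ht; rewrite !tX qpoch_m1.
rewrite [2^-1 * _ * _](_ : _ = P 40 80 * P 40 80 * P 80 80 * M 8 8).
  apply: eq_tends => n; apply: eq_bigr => i _; rewrite binS bin1 exprD /bailey_weight.
  by move: (poch _ _ _) (poch _ _ _) (_ ^-1) (_ ^+ i) (_ ^+ 'C(i, 2)) => *; ring.
rewrite -!/(P _ _).
by move: (P 40 80) (M 8 8) (P 80 80) => *; field.
Qed.

Lemma sum_5_odd : tends (fun n => \sum_(i < n) q ^+ (4 * (i * i) + 12 * i) *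
     (poch (- t) t i ^+ 2 / poch t t (i + i).+1))
  (P 72 80 * P 8 80 * P 80 80 * M 8 8 / P 8 8).
Proof.
have h := even_sum_shift (expf_neq0 8 q0) ht; rewrite !tX qpoch_m1 in h.
(* The term of index 0 vanishes, hence the shift. In the others 2 comes from (-1;t)_(i+1) = 2
   (-t;t)_i, and t from the weight at i+1. *)
have := tendsM (tends_cst (2 * t)^-1) (tends_shift 1 h).
have nt : t != 0 by rewrite expf_neq0.
rewrite [_^-1 * _](_ : _ = P 72 80 * P 8 80 * P 80 80 * M 8 8 / P 8 8); last first.
  have e a m : qpoch_inf (q ^+ a) (q ^+ m) = P a m by [].
  rewrite !e -[P (8 * 9) _]/(P 72 80) -[P 8 (8 * 10)]/(P 8 80) -[P (8 * 10) _]/(P 80 80).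
  have := qprod_neq0 hq 7 7.
  by move: (P 72 80) (M 8 8) (P 8 80) (P 8 8) (P 80 80) => ? ? ? z ? z0; field; rewrite z0 q0.
apply: eq_tends => n; rewrite addn1 big_ord_recl expr0 subrr !mul0r mulr0 add0r mulr_sumr.
apply: eq_bigr => i _; rewrite lift0.
rewrite /bailey_weight pochSl mulN1r opprK (_ : (i.+1 + i.+1 = (i + i).+2)%N); last lia.
rewrite !(pochS _ _ (i + i).+1) (pochS (- t)) -!exprS mulNr -exprS opprK.
have e2 : t ^+ (i + i).+2 = (t ^+ i.+1) ^+ 2 by rewrite -[RHS]exprM; congr (_ ^+ _); lia.
have := qpow_neq1 ht (i + i).+1; rewrite e2 => n1.
rewrite -(mulrA _ (t ^+ i.+1)).
have -> : t ^+ i.+1 * t ^+ 'C(i.+1, 2) = t * q ^+ (4 * (i * i) + 12 * i).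
  by rewrite !tX -!exprD; congr (_ ^+ _); have := bin2Z i.+1; lia.
have := qq_neq0 (qpow_neq1 ht) (i + i).+1.
move: n1; set y := t ^+ i.+1 => n1; clearbody y.
by move: (poch t t _) (poch (- t) t _) (q ^+ (_ + _)) => z1 z2 z3 z10; field; rewrite ?z10 ?q0 ?n1 ?nt.
Qed.

Lemma eprod_pair n : eprod 8 n * eprod 8 (n + 4) = eprod 4 n.
Proof.
have h := qpoch_inf_dissect (- q ^ n) 1 (nm_pow_lt1 3 hq).
rewrite big_cons big_seq1 in h.
have e1 : - q ^ n * (q ^+ 4) ^+ 0 = - q ^ n by rewrite expr0 mulr1.
have e2 : - q ^ n * (q ^+ 4) ^+ 1 = - q ^ (n + 4) by rewrite expr1 mulNr exprnP -expfzDr.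
have e3 : (q ^+ 4) ^+ 2 = t by rewrite -exprM.
by rewrite e1 e2 e3 in h; rewrite /eprod h.
Qed.

(* The triple sum after the sums over j and k are carried out by Euler's identity. *)
Definition outer_term (b c d : int) i :=
  q ^ (3 * i%:Z ^+ 2 + b * i%:Z) / poch t t i * (eprod 8 (4 - 4 * i%:Z + c) * eprod 8 (4 - 4 * i%:Z + d)).

Let combine_13 (A z T u v m : C) : u != 0 -> v != 0 -> A * z = T ->
  A / (u * v) * (z * v * (2 * m)) = 2 * m * (T / u).
Proof. by move=> u0 v0 <-; field; rewrite u0 v0. Qed.

(** The finite product (-q^4;q^4)_i released by [eprod_shift] cancels against (q^8;q^8)_i =
    (q^4;q^4)_i (-q^4;q^4)_i. *)
Lemma outer_term_13 b i : outer_term b (-4) 0 i =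
  2 * M 4 4 * (q ^ (i%:Z ^+ 2 + (b - 2) * i%:Z) / poch (q ^+ 4) (q ^+ 4) i).
Proof.
rewrite /outer_term (_ : 4 - 4 * i%:Z + 0 = 4 - 4 * i%:Z + -4 + 4); last by ring.
rewrite eprod_pair (_ : 4 - 4 * i%:Z + -4 = 0 - (4 * i)%N%:Z); last by lia.
rewrite (eprod_shift 3) eprod0 subr0.
have ps := poch_sqr (q ^+ 4) (q ^+ 4) i; rewrite -!exprM in ps.
have n2 : poch t t i != 0 := poch_neq0 7 8 i.
rewrite -ps -[q ^ 4%:Z]/(q ^+ 4); apply: combine_13.
- exact: (poch_neq0 3 4 i).
- by move: n2; rewrite -ps mulf_eq0 negb_or => /andP[].
- rewrite -expfzDr //; congr (q ^ _); have := bin2Z i.+1; lia.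
Qed.

Let combine_00 (A z T u v m : C) : A * (z * z) = T ->
  A / u * (z * v * m * (z * v * m)) = m ^+ 2 * (T * (v ^+ 2 / u)).
Proof. by move=> <-; ring. Qed.

Let combine_4 (A y z T u v w m n : C) : A * (y * z) = T ->
  A / u * (y * v * m * (z * w * n)) = m * n * (T * (v * w / u)).
Proof. by move=> <-; ring. Qed.

Lemma outer_term_even b m : outer_term b 0 0 (m + m) =
  M 4 8 ^+ 2 * (q ^ (4 * m%:Z ^+ 2 + 2 * b * m%:Z) * (poch (- q ^+ 4) t m ^+ 2 / poch t t (m + m))).
Proof.
rewrite /outer_term (_ : 4 - 4 * (m + m)%N%:Z + 0 = 4%:Z - (8 * m)%N%:Z); last by lia.
rewrite (eprod_shift 7) (eprod_nat (b := 8) (a := 4)) // -[q ^ (8%:Z - 4%:Z)]/(q ^+ 4).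
by apply: combine_00; rewrite -!expfzDr //; congr (q ^ _); have := bin2Z m.+1; lia.
Qed.

Lemma outer_term_odd b m : outer_term b 0 0 (m + m).+1 =
  4 * M 8 8 ^+ 2 * (q ^ (4 * m%:Z ^+ 2 + 4 * m%:Z + 3 + b * (2 * m%:Z + 1)) *
    (poch (- t) t m ^+ 2 / poch t t (m + m).+1)).
Proof.
rewrite /outer_term (_ : 4 - 4 * (m + m).+1%:Z + 0 = 0 - (8 * m)%N%:Z); last by lia.
rewrite (eprod_shift 7) eprod0 -[q ^ (8%:Z - 0)]/(q ^+ 8).
rewrite (_ : 4 * M 8 8 ^+ 2 = (2 * M 8 8) ^+ 2); last by move: (M 8 8) => u; ring.
by apply: combine_00; rewrite -!expfzDr //; congr (q ^ _); have := bin2Z m.+1; lia.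
Qed.

(** The exponents -4i and 8-4i are one step of the base apart, which is why two different finite
    products appear instead of a square. *)
Lemma outer_term_4_even m : outer_term 2 (-4) 4 (m + m) =
  2 * M 8 8 ^+ 2 * (q ^ (4 * m%:Z ^+ 2 + 4 * m%:Z) * (poch (- t) t m * poch (-1) t m / poch t t (m + m))).
Proof.
rewrite /outer_term (_ : 4 - 4 * (m + m)%N%:Z + -4 = 0 - (8 * m)%N%:Z); last by lia.
rewrite (_ : 4 - 4 * (m + m)%N%:Z + 4 = 8%:Z - (8 * m)%N%:Z); last by lia.
rewrite !(eprod_shift 7) eprod0 (eprod_nat (b := 8) (a := 8)) //.
rewrite -[q ^ (8%:Z - 0)]/(q ^+ 8) -[q ^ (8%:Z - 8%:Z)]/(1 : C).
rewrite (expr2 (M 8 8)) [2 * (_ * _)]mulrA.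
by apply: combine_4; rewrite -!expfzDr //; congr (q ^ _); have := bin2Z m.+1; lia.
Qed.

Lemma outer_term_4_odd m : outer_term 2 (-4) 4 (m + m).+1 =
  M 4 8 * M 4 8 * (q ^ (4 * m%:Z ^+ 2 + 8 * m%:Z + 1) *
    (poch (- q ^+ 4) t m.+1 * poch (- q ^+ 4) t m / poch t t (m + m).+1)).
Proof.
rewrite /outer_term (_ : 4 - 4 * (m + m).+1%:Z + -4 = 4%:Z - (8 * m.+1)%N%:Z); last by lia.
rewrite (_ : 4 - 4 * (m + m).+1%:Z + 4 = 4%:Z - (8 * m)%N%:Z); last by lia.
rewrite !(eprod_shift 7) (eprod_nat (b := 8) (a := 4)) // -[q ^ (8%:Z - 4%:Z)]/(q ^+ 4).
apply: combine_4; rewrite -!expfzDr //; congr (q ^ _).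
by have := bin2Z m.+1; have := bin2Z m.+2; lia.
Qed.

Lemma has_sum_outer (b c d : int) s : 0 <= d -> (2 <= b /\ -4 <= c) \/ (0 <= b /\ 0 <= c) ->
  (geo_bounded (outer_term b c d) -> tends (fun n => \sum_(i < n) outer_term b c d i) s) ->
  has_sum (summand q b c d) s.
Proof.
move=> hd hbc hs.
have hb : 0 <= b by case: hbc => -[h _] //; apply: le_trans h.
have hc : -4 <= c by case: hbc => -[_ h] //; apply: le_trans h.
have [K [r [K0 r0 r1 hK]]] := summand_bound hb hc hd (fun i j k => expo_ge0 i j k hd hbc).
exact: (has_sum_iterated K0 r0 r1 hK (inner_euler b c d) hs).
Qed.

Lemma tends_outer_parity (b c d : int) (u v : C) (e o : nat -> C) (E O : C) :
  (forall m, outer_term b c d (m + m) = u * e m) ->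
  (forall m, outer_term b c d (m + m).+1 = v * o m) ->
  tends (fun n => \sum_(i < n) e i) E -> tends (fun n => \sum_(i < n) o i) O ->
  geo_bounded (outer_term b c d) ->
  tends (fun n => \sum_(i < n) outer_term b c d i) (u * E + v * O).
Proof.
move=> he ho hE hO gb; apply: (tends_pairs gb).
apply: eq_tends (tendsD (tendsM (tends_cst u) hE) (tendsM (tends_cst v) hO)) => n.
by rewrite !mulr_sumr -big_split /=; apply: eq_bigr => m _; rewrite he ho.
Qed.

Lemma has_sum_1 : has_sum (summand q 2 (-4) 0)
  (2 * (J2 2 8 q * J 10 q ^+ 2 * J2 2 20 q / (J 2 q * J 20 q * J2 1 10 q * J2 4 20 q))).
Proof.
apply: has_sum_outer => //; first by left.
move=> _; rewrite -(product_id1 hq) mulrA.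
apply: eq_tends (tendsM (tends_cst (2 * M 4 4)) sum_mod5_0) => n.
rewrite mulr_sumr; apply: eq_bigr => i _; rewrite outer_term_13 exprnP.
congr (_ * (q ^ _ / _)); lia.
Qed.

Lemma has_sum_3 : has_sum (summand q 4 (-4) 0)
        (2 * (half_power (@J R 40) 11 q
              * J2 6 40 q * J2 10 40 q * J2 14 40 q
              / (J2 3 40 q * J2 4 40 q * J2 7 40 q * J2 8 40 q
                 * J2 12 40 q ^+ 2 * J2 13 40 q * J2 17 40 q
                 * half_power (@J2 R 20 40) 1 q))).
Proof.
have rearrange (H a b c X K : C) : H * a * b * c / (X * K) = H / K * (a * b * c / X).
  by rewrite invfM; ring.
rewrite rearrange (half_power_ratio hq) -(product_id3 hq) mulrA.
apply: has_sum_outer => //; first by left.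
move=> _; apply: eq_tends (tendsM (tends_cst (2 * M 4 4)) sum_mod5_1) => n.
rewrite mulr_sumr; apply: eq_bigr => i _; rewrite outer_term_13 exprnP.
congr (_ * (q ^ _ / _)); lia.
Qed.

Lemma has_sum_2 : has_sum (summand q 0 0 0)
        (J 80 q ^+ 11 * J2 8 80 q * J2 24 80 q ^+ 2 * J2 40 80 q ^+ 2
           / (J2 4 80 q ^+ 3 * J2 12 80 q ^+ 2 * J2 20 80 q ^+ 4
              * J2 28 80 q ^+ 2 * J2 32 80 q ^+ 2 * J2 36 80 q ^+ 3)
         + 4 * q ^+ 3 *
           (J 80 q ^+ 11
            / (J2 8 80 q ^+ 4 * J2 16 80 q * J2 24 80 q ^+ 3
               * J2 32 80 q * J2 40 80 q ^+ 2))).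
Proof.
rewrite -(product_id2_even hq) -(product_id2_odd hq) [4 * q ^+ 3 * _]mulrA.
apply: has_sum_outer => //; first by right.
apply: (tends_outer_parity
  (e := fun i => q ^+ (4 * (i * i)) * (poch (- q ^+ 4) t i ^+ 2 / poch t t (i + i)))
  (o := fun i => t ^+ 'C(i.+1, 2) * (poch (- t) t i ^+ 2 / poch t t (i + i).+1))
  _ _ sum_2_even sum_2_odd) => m.
  rewrite outer_term_even; congr (_ * (_ * _)); rewrite (exprnP q); congr (q ^ _); lia.
rewrite outer_term_odd tX [4 * q ^+ 3 * _]mulrAC -[RHS]mulrA [X in _ = _ * X]mulrA -exprD.
by congr (_ * (_ * _)); rewrite (exprnP q); congr (q ^ _); have := bin2Z m.+1; lia.
Qed.

Lemma has_sum_4 : has_sum (summand q 2 (-4) 4)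
        (2 * (J 80 q ^+ 11
              / (J2 8 80 q ^+ 4 * J2 16 80 q * J2 24 80 q ^+ 4
                 * J2 32 80 q * J2 40 80 q))
         + q *
           (J 80 q ^+ 11 * J2 8 80 q ^+ 2 * J2 24 80 q ^+ 2 * J2 40 80 q
            / (J2 4 80 q ^+ 3 * J2 12 80 q ^+ 3 * J2 16 80 q
               * J2 20 80 q ^+ 2 * J2 28 80 q ^+ 3 * J2 32 80 q
               * J2 36 80 q ^+ 3))).
Proof.
rewrite -(product_id4_even hq) -(product_id4_odd hq) [2 * (_ * _)]mulrA [q * (_ * _)]mulrA.
apply: has_sum_outer => //; first by left.
apply: (tends_outer_parity
  (e := fun i => t ^+ 'C(i.+1, 2) * (poch (- t) t i * poch (-1) t i / poch t t (i + i)))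
  (o := fun i => q ^+ (4 * (i * i) + 8 * i) *
     (poch (- q ^+ 4) t i * poch (- q ^+ 4) t i.+1 / poch t t (i + i).+1))
  _ _ sum_4_even sum_4_odd) => m.
  rewrite outer_term_4_even tX; congr (_ * (_ * _)); rewrite (exprnP q); congr (q ^ _).
  by have := bin2Z m.+1; lia.
rewrite outer_term_4_odd -expr2 [q * _]mulrC -[RHS]mulrA [X in _ = _ * X]mulrA -exprS.
rewrite [poch _ _ _ * poch _ _ m]mulrC; congr (_ * (_ * _)); rewrite (exprnP q); congr (q ^ _); lia.
Qed.

Lemma has_sum_5 : has_sum (summand q 4 0 0)
        (J2 8 80 q ^+ 2 * J 80 q ^+ 11 * J2 24 80 q * J2 40 80 q ^+ 2
           / (J2 4 80 q ^+ 2 * J2 12 80 q ^+ 3 * J2 16 80 q ^+ 2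
              * J2 20 80 q ^+ 4 * J2 28 80 q ^+ 3 * J2 36 80 q ^+ 2)
         + 4 * q ^+ 7 *
           (J 80 q ^+ 11
            / (J2 8 80 q ^+ 3 * J2 16 80 q * J2 24 80 q ^+ 4
               * J2 32 80 q * J2 40 80 q ^+ 2))).
Proof.
rewrite -(product_id5_even hq) -(product_id5_odd hq) [4 * q ^+ 7 * _]mulrA.
apply: has_sum_outer => //; first by right.
apply: (tends_outer_parity
  (e := fun i => q ^+ (4 * (i * i) + 8 * i) * (poch (- q ^+ 4) t i ^+ 2 / poch t t (i + i)))
  (o := fun i => q ^+ (4 * (i * i) + 12 * i) * (poch (- t) t i ^+ 2 / poch t t (i + i).+1))
  _ _ sum_5_even sum_5_odd) => m.
  rewrite outer_term_even; congr (_ * (_ * _)); rewrite (exprnP q); congr (q ^ _); lia.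
rewrite outer_term_odd [4 * q ^+ 7 * _]mulrAC -[RHS]mulrA [X in _ = _ * X]mulrA -exprD.
by congr (_ * (_ * _)); rewrite (exprnP q); congr (q ^ _); lia.
Qed.

End TripleSums.

(** * The degenerate case q = 0 *)

Section ZeroBase.
Variable R : realType.
Local Notation C := (Cplx R).

Let poch_zero (z : C) n : poch 0 z n = 1.
Proof. by rewrite /poch big1 // => i _; rewrite mul0r subr0. Qed.

Lemma qprod_zero a m : (0 < a)%N -> (0 < m)%N -> qprod (0 : C) a m = 1.
Proof.
case: a => // a _; case: m => // m _; rewrite /qprod !expr0n /=.
have h0 : nm (0 : C) < 1 by rewrite nm0.
apply: (tends_uniq (qpoch_tends 0 h0)).
by apply: (eq_tends (u := fun=> 1)) (tends_cst _) => n; exact: (esym (poch_zero 0 n)).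
Qed.

Lemma J_zero m : (0 < m)%N -> J m (0 : C) = 1.
Proof. by move=> m0; rewrite J_qprod qprod_zero. Qed.

Lemma J2_zero r m : (0 < r)%N -> (r < m)%N -> J2 r m (0 : C) = 1.
Proof.
move=> r0 rm; rewrite J2_qprod !qprod_zero ?mulr1 ?subn_gt0 //; exact: ltn_trans rm.
Qed.

(** At q = 0 a summand is 1 or 0 according to whether its exponent vanishes. By [expo_lower] a
    vanishing exponent forces i + j + k <= 6, whence [box 7]. *)
Lemma has_sum_zero (b c d : int) : 0 <= b -> -4 <= c -> 0 <= d ->
  has_sum (summand (0 : C) b c d)
    (count (fun x : nat * nat * nat => expo b c d x.1.1 x.1.2 x.2 == 0) (box 7))%:R.
Proof.
move=> hb hc hd; apply: has_sum_finite => [[[i j] k]|[[i j] k] /eqP /= e].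
  have pz n : qpoch (0 : C) 0 n = 1 := poch_zero 0 n.
  by rewrite /summand !expr0n /= !pz !mulr1 divr1 exp0rz.
by rewrite mem_box; have := expo_lower i j k hb hc hd; rewrite e; lia.
Qed.

(** The quotient of the two values is 1 by [half_power_ratio]; a zero denominator would make it
    0. *)
Lemma half_power_zero : half_power (@J2 R 20 40) 1 0 != 0 :> C /\
  half_power (@J R 40) 11 0 = half_power (@J2 R 20 40) 1 0 :> C.
Proof.
have h0 : nm (0 : C) < 1 by rewrite nm0.
have hr := half_power_ratio h0; rewrite J_zero // qprod_zero // expr1n divr1 in hr.
have hn : half_power (@J2 R 20 40) 1 0 != 0 :> C.
  by apply: contra_eq_neq hr => ->; rewrite invr0 mulr0 eq_sym oner_neq0.
by split=> //; rewrite -[LHS](divfK hn) hr mul1r.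
Qed.

End ZeroBase.

Theorem theorem3p9 (R : realType) (q : Cplx R) (hq : `|q| < 1) :
  [/\ has_sum (summand q 2 (-4) 0)
        (2 * (J2 2 8 q * J 10 q ^+ 2 * J2 2 20 q
              / (J 2 q * J 20 q * J2 1 10 q * J2 4 20 q))),
      has_sum (summand q 0 0 0)
        (J 80 q ^+ 11 * J2 8 80 q * J2 24 80 q ^+ 2 * J2 40 80 q ^+ 2
           / (J2 4 80 q ^+ 3 * J2 12 80 q ^+ 2 * J2 20 80 q ^+ 4
              * J2 28 80 q ^+ 2 * J2 32 80 q ^+ 2 * J2 36 80 q ^+ 3)
         + 4 * q ^+ 3 *
           (J 80 q ^+ 11
            / (J2 8 80 q ^+ 4 * J2 16 80 q * J2 24 80 q ^+ 3
               * J2 32 80 q * J2 40 80 q ^+ 2))),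
      has_sum (summand q 4 (-4) 0)
        (2 * (half_power (@J R 40) 11 q
              * J2 6 40 q * J2 10 40 q * J2 14 40 q
              / (J2 3 40 q * J2 4 40 q * J2 7 40 q * J2 8 40 q
                 * J2 12 40 q ^+ 2 * J2 13 40 q * J2 17 40 q
                 * half_power (@J2 R 20 40) 1 q))),
      has_sum (summand q 2 (-4) 4)
        (2 * (J 80 q ^+ 11
              / (J2 8 80 q ^+ 4 * J2 16 80 q * J2 24 80 q ^+ 4
                 * J2 32 80 q * J2 40 80 q))
         + q *
           (J 80 q ^+ 11 * J2 8 80 q ^+ 2 * J2 24 80 q ^+ 2 * J2 40 80 q
            / (J2 4 80 q ^+ 3 * J2 12 80 q ^+ 3 * J2 16 80 q
               * J2 20 80 q ^+ 2 * J2 28 80 q ^+ 3 * J2 32 80 q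
               * J2 36 80 q ^+ 3)))
    & has_sum (summand q 4 0 0)
        (J2 8 80 q ^+ 2 * J 80 q ^+ 11 * J2 24 80 q * J2 40 80 q ^+ 2
           / (J2 4 80 q ^+ 2 * J2 12 80 q ^+ 3 * J2 16 80 q ^+ 2
              * J2 20 80 q ^+ 4 * J2 28 80 q ^+ 3 * J2 36 80 q ^+ 2)
         + 4 * q ^+ 7 *
           (J 80 q ^+ 11
            / (J2 8 80 q ^+ 3 * J2 16 80 q * J2 24 80 q ^+ 4
               * J2 32 80 q * J2 40 80 q ^+ 2)))].
Proof.
rewrite norm_lt1 in hq; have [->|q0] := eqVneq q 0; last first.
  by split; [exact: has_sum_1 | exact: has_sum_2 | exact: has_sum_3 | exact: has_sum_4 | exact: has_sum_5].
have [hn ->] := half_power_zero R.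
have zero b c d (n : nat) (s : Cplx R) : 0 <= b -> -4 <= c -> 0 <= d -> s = n%:R ->
    count (fun x : nat * nat * nat => expo b c d x.1.1 x.1.2 x.2 == 0) (box 7) = n ->
    has_sum (summand (0 : Cplx R) b c d) s.
  by move=> hb hc hd -> <-; apply: has_sum_zero.
(* For c = -4 the exponent vanishes at (0,0,0) and (0,1,0), otherwise only at the origin; [count]
   confirms this by computation. *)
split; [apply: (zero _ _ _ 2%N) | apply: (zero _ _ _ 1%N) | apply: (zero _ _ _ 2%N)
  | apply: (zero _ _ _ 2%N) | apply: (zero _ _ _ 1%N)] => //.
- by rewrite !J_zero // !J2_zero // !(expr1n, mulr1, divr1).
- by rewrite !J_zero // !J2_zero // !expr0n /= !(expr1n, mulr1, divr1, mulr0, mul0r, addr0).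
- by rewrite !J2_zero // !(expr1n, mulr1, mul1r) divff // mulr1.
- by rewrite !J_zero // !J2_zero // !(expr1n, mulr1, divr1, mul0r, addr0).
- by rewrite !J_zero // !J2_zero // !expr0n /= !(expr1n, mulr1, divr1, mulr0, mul0r, addr0).
Qed.
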